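(* Let $k\ge1$ and $\mathbf d\in(\mathbb Z_{\ge0})^k$. The map $\xi:\mathcal T_c(\mathbf d)\to\mathcal T_s(\mathbf d)$ defined by $$\xi(f)(\mathbf D,W,t)=\sum_{x\in B_{\mathbf D,W,t}}f(x),\qquad B_{\mathbf D,W,t}=\{(\mathbf D',W',t')\in\mathfrak T(\mathbf d): W'=W,\ t'=t,\ \alpha(\ker t,\mathbf D')=\alpha(\ker t,\mathbf D)\},$$ is an isomorphism of $\mathbf U_q$-modules.
   Context: **Counting convention.** $\mathbb F$ is a finite field whose cardinality is written $q^2$; vector spaces are finite-dimensional over $\mathbb F$. Functions take values in $\mathbb C(q)$, $q$ an indeterminate, and spans are $\mathbb C(q)$-spans. $\mathbf 1_Y$ is the indicator function of $Y$. Numbers of points are viewed in $\mathbb C(q)$: the sets counted are given by the same linear-algebra conditions over every finite field and have $P_Y(|\mathbb F|)$ points for a polynomial $P_Y$, and $\chi_q(Y):=P_Y(q^2)$. Sums of function values over points are understood accordingly: for $f=\sum c_i\mathbf 1_{Y_i}$, $\sum_{x\in X}f(x)=\sum c_i\chi_q(X\cap Y_i)$. **Quantum group.** $\mathbf U_q=U_q(\mathfrak{sl}_2)$ is the $\mathbb C(q)$-algebra generated by $E,F,K^{\pm1}$ with $KK^{-1}=K^{-1}K=1$, $KE=q^2EK$, $KF=q^{-2}FK$, $EF-FE=(K-K^{-1})/(q-q^{-1})$, with coproduct $\Delta K^{\pm1}=K^{\pm1}\otimes K^{\pm1}$, $\Delta E=E\otimes1+K\otimes E$, $\Delta F=F\otimes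 K^{-1}+1\otimes F$; tensor products are modules via iterated $\Delta$. $[n]=(q^n-q^{-n})/(q-q^{-1})$. $V_n$ has basis $v_n,v_{n-2},\dots,v_{-n}$ with $K^{\pm1}v_m=q^{\pm m}v_m$, $Ev_m=[\frac{n+m}2+1]v_{m+2}$, $Fv_m=[\frac{n-m}2+1]v_{m-2}$. Put $\otimes\,{}^{\mathbf e}v_{\mathbf u}=v_{\mathbf e_1-2\mathbf u_1}\otimes\cdots\otimes v_{\mathbf e_k-2\mathbf u_k}$. **Tensor product variety.** Let $d=\sum_i\mathbf d_i$ and $D$ a $d$-dimensional space. $\mathfrak T(\mathbf d)$ is the set of triples $(\mathbf D,W,t)$, where $\mathbf D=(0=\mathbf D_0\subset\cdots\subset\mathbf D_k=D)$ is a flag with $\dim\mathbf D_i/\mathbf D_{i-1}=\mathbf d_i$, $W\subset D$ is a subspace, $t\in\mathrm{End}\,D$, $t(\mathbf D_i)\subset\mathbf D_{i-1}$ and $\operatorname{im}t\subset W\subset\ker t$. For a subspace $X\subset D$, $\alpha(X,\mathbf D)_i=\dim(X\cap\mathbf D_i)/(X\cap\mathbf D_{i-1})$. Set $A_{\mathbf w,\mathbf r,\mathbf n}=\{(\mathbf D,W,t)\in\mathfrak T(\mathbf d):\alpha(W,\mathbf D)=\mathbf w,\ \alpha(\operatorname{im}t,\mathbf D)=\mathbf r,\ \alpha(\ker t,\mathbf D)=\mathbf n\}$ and $f_{\mathbf w,\mathbf r,\mathbf n}=q^{\sum_{i<j}(\mathbf r_i\mathbf w_j+\mathbf w_i\mathbf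 n_j-\mathbf w_i\mathbf w_j)}\mathbf 1_{A_{\mathbf w,\mathbf r,\mathbf n}}$. $\mathcal T(\mathbf d)=\operatorname{Span}\{f_{\mathbf w,\mathbf r,\mathbf n}\}$, $\mathcal T_0(\mathbf d)=\operatorname{Span}\{f_{\mathbf w,\mathbf 0,\mathbf d}\}_{\mathbf w}$. $\mathbf U_q$ acts on $\mathcal T(\mathbf d)$ by $(Ef)(\mathbf D,W,t)=q^{-(\dim\ker t-\dim W-1)}\sum_{W\subset U\subset\ker t,\ \dim U=\dim W+1}f(\mathbf D,U,t)$, $(Ff)(\mathbf D,W,t)=q^{-(\dim W-\operatorname{rank}t-1)}\sum_{\operatorname{im}t\subset U\subset W,\ \dim U=\dim W-1}f(\mathbf D,U,t)$, $(K^{\pm1}f)(\mathbf D,W,t)=q^{\pm(d-2\dim W)}f(\mathbf D,W,t)$. $\mathcal T_s(\mathbf d)$ is the space of $f\in\mathcal T(\mathbf d)$ whose value at $(\mathbf D,W,t)$ depends only on $\dim W$ and $\alpha(\ker t,\mathbf D)$. For $(\mathbf r,\mathbf n)$ occurring in a non-empty $A_{\mathbf w,\mathbf r,\mathbf n}$, $\eta_{\mathbf r,\mathbf n}:\operatorname{Span}\{f_{\mathbf w,\mathbf r,\mathbf n}\}_{\mathbf w}\to V_{\mathbf n_1-\mathbf r_1}\otimes\cdots\otimes V_{\mathbf n_k-\mathbf r_k}$ is the linear isomorphism $f_{\mathbf w,\mathbf r,\mathbf n}\mapsto\otimes\,{}^{\mathbf n-\mathbf r}v_{\mathbf w-\mathbf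 r}$. **Lower crossingless matches.** Place $k$ boxes from left to right, box $i$ having $\mathbf d_i$ vertices. A lower crossingless match $S$ is a set of pairwise non-crossing arcs drawn above the line, each joining two vertices of different boxes, each vertex on at most one arc, and no unmatched vertex lying under an arc. $\mathbf r^S_i$ is the number of left endpoints of arcs in box $i$ and $\mathbf n^S_i$ is $\mathbf d_i$ minus the number of right endpoints of arcs in box $i$. **The space $\mathcal T_c(\mathbf d)$.** Let $\iota_n:V_n\to V_1^{\otimes n}$ and $\pi_n:V_1^{\otimes n}\to V_n$ be the $\mathbf U_q$-maps with $v_n\mapsto v_1^{\otimes n}$, resp. $v_1^{\otimes n}\mapsto v_n$; let $\varepsilon:V_1\otimes V_1\to\mathbb C(q)$ be the $\mathbf U_q$-map with $\varepsilon(v_{-1}\otimes v_1)=1$, $\varepsilon(v_1\otimes v_{-1})=-q^{-1}$, $\varepsilon(v_{\pm1}\otimes v_{\pm1})=0$. For a lower crossingless match $S$, $\gamma_{\mathbf r^S,\mathbf n^S}:V_{\mathbf d_1}\otimes\cdots\otimes V_{\mathbf d_k}\to V_{\mathbf n^S_1-\mathbf r^S_1}\otimes\cdots\otimes V_{\mathbf n^S_k-\mathbf r^S_k}$ is: apply $\iota_{\mathbf d_1}\otimes\cdots\otimes\iota_{\mathbf d_k}$ (tensor factors of $V_1^{\otimes d}$ correspond to vertices), contract the pairs of factors joined by arcs of $S$ with $\varepsilon$ (innermost first), and apply $\pi_{\mathbf n^S_1-\mathbf r^S_1}\otimes\cdots\otimes\pi_{\mathbf n^S_k-\mathbf r^S_k}$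 to the remaining factors. ($S\mapsto(\mathbf r^S,\mathbf n^S)$ is injective.) Put $\gamma_{\mathbf r,\mathbf n}=0$ for all other $(\mathbf r,\mathbf n)$. Then $\epsilon(f)=\sum_{\mathbf r,\mathbf n}\eta_{\mathbf r,\mathbf n}^{-1}\gamma_{\mathbf r,\mathbf n}\eta_{\mathbf 0,\mathbf d}(f)$ for $f\in\mathcal T_0(\mathbf d)$, and $\mathcal T_c(\mathbf d)=\epsilon(\mathcal T_0(\mathbf d))\subset\mathcal T(\mathbf d)$. *)

(* Defs.v *)
(* classical_sets serves only to provide the choice operator xget. *)
From HB Require Import structures.
From mathcomp Require Import all_boot all_order all_algebra.
From mathcomp Require Import boolp classical_sets.

Set Implicit Arguments.
Unset Strict Implicit.
Unset Printing Implicit Defensive.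

Import GRing.Theory.
Local Open Scope ring_scope.

Section FiniteInstances.
Import VectorInternalTheory.
HB.instance Definition _ (F : finFieldType) (V : vectType F) :=
  [Countable of {vspace V} by <:].
HB.instance Definition _ (F : finFieldType) (V : vectType F) :=
  [Finite of {vspace V} by <:].
HB.instance Definition _ (F : finFieldType) (V W : vectType F) :=
  [Countable of 'Hom(V, W) by <:].
HB.instance Definition _ (F : finFieldType) (V W : vectType F) :=
  [Finite of 'Hom(V, W) by <:].
End FiniteInstances.

Notation "C `(q)" := {fraction {poly C}} (at level 2, format "C `(q)") : type_scope.

Section Scalars.
Variable C : fieldType.

Definition qq : C`(q) := tofrac 'X.

Definition qint (n : nat) : C`(q) := (qq ^+ n - qq ^- n) / (qq - qq^-1).

(* The space with basis I; phi is the vector \sum_u phi u *: basis u. *)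
Definition fvec (I : finType) := {ffun I -> (C`(q))^o}.

HB.instance Definition _ (I : finType) := Vector.on (fvec I).

Definition basis (I : finType) (u : I) : fvec I := [ffun v => (v == u)%:R].

(* M a b is the coefficient of basis a in the image of basis b. *)
Definition opmx_fun (I J : finType) (M : I -> J -> C`(q)) (f : fvec J) : fvec I :=
  [ffun a => \sum_b M a b * f b].

Lemma opmx_linear (I J : finType) (M : I -> J -> C`(q)) : linear (opmx_fun M).
Proof.
move=> c f g; apply/ffunP => a; rewrite !ffunE /GRing.scale /= mulr_sumr -big_split /=.
by apply: eq_bigr => b _; rewrite !ffunE /GRing.scale /= mulrDr mulrCA.
Qed.

HB.instance Definition _ (I J : finType) (M : I -> J -> C`(q)) :=
  GRing.isLinear.Build _ _ _ _ (opmx_fun M) (opmx_linear M).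

Definition opmx (I J : finType) (M : I -> J -> C`(q)) : 'Hom(fvec J, fvec I) :=
  linfun (opmx_fun M).

(* U_q(sl_2) is presented by generators and relations, so a module over it is a space
   on which E, F, K, K^-1 act subject to the defining relations, and a homomorphism is
   a linear map commuting with these four operators.  They are operators on the whole
   of V; the relations are required on the submodule M only. *)

Record uq_ops (V : vectType C`(q)) :=
  UqOps { uE : 'End(V); uF : 'End(V); uK : 'End(V); uKi : 'End(V) }.

Definition uq_module (V : vectType C`(q)) (o : uq_ops V) (M : {pred V}) : Prop :=
  submod_closed M /\
  {in M, forall x,
    [/\ uE o x \in M, uF o x \in M, uK o x \in M & uKi o x \in M] /\
    [/\ uK o (uKi o x) = x,
        uKi o (uK o x) = x,
        uK o (uE o x) = qq ^+ 2 *: uE o (uK o x),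
        uK o (uF o x) = qq ^- 2 *: uF o (uK o x) &
        uE o (uF o x) - uF o (uE o x) = (qq - qq^-1)^-1 *: (uK o x - uKi o x)]}.

Definition uq_hom (V W : vectType C`(q)) (o : uq_ops V) (o' : uq_ops W)
    (M : {pred V}) (N : {pred W}) (g : 'Hom(V, W)) : Prop :=
  {in M, forall x, g x \in N /\
    [/\ g (uE o x) = uE o' (g x), g (uF o x) = uF o' (g x),
        g (uK o x) = uK o' (g x) & g (uKi o x) = uKi o' (g x)]}.

Definition uq_iso (V W : vectType C`(q)) (o : uq_ops V) (o' : uq_ops W)
    (M : {pred V}) (N : {pred W}) (g : 'Hom(V, W)) : Prop :=
  [/\ uq_module o M, uq_module o' N, uq_hom o o' M N g,
      {in M &, injective g} & {in N, forall y, exists2 x, x \in M & g x = y}].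

(* The basis vector v_m of V_n is indexed by u = (n - m) / 2, 0 <= u <= n. *)
Definition vE n (a b : 'I_n.+1) : C`(q) :=
  if a.+1 == b :> nat then qint (n - b).+1 else 0.
Definition vF n (a b : 'I_n.+1) : C`(q) :=
  if a == b.+1 :> nat then qint b.+1 else 0.
Definition vK n (a b : 'I_n.+1) : C`(q) :=
  if a == b then qq ^ (n%:Z - 2 * b%:Z) else 0.
Definition vKi n (a b : 'I_n.+1) : C`(q) :=
  if a == b then qq ^ (- (n%:Z - 2 * b%:Z)) else 0.
Definition vid n (a b : 'I_n.+1) : C`(q) := (a == b)%:R.

Definition vmod n := fvec 'I_n.+1.
Definition vops n : uq_ops (vmod n) :=
  UqOps (opmx (@vE n)) (opmx (@vF n)) (opmx (@vK n)) (opmx (@vKi n)).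

Section Tensor.
Variables (k : nat) (e : 'I_k -> nat).

(* u : tidx indexes v_{e_1 - 2 u_1} (x) ... (x) v_{e_k - 2 u_k}. *)
Definition tidx := {dffun forall i : 'I_k, 'I_(e i).+1}.
Definition tens := fvec tidx.

Definition tensmx (M : forall i : 'I_k, 'I_(e i).+1 -> 'I_(e i).+1 -> C`(q))
    (a b : tidx) : C`(q) := \prod_i M i (a i) (b i).

(* The iterated coproduct:
   E |-> \sum_i K (x) .. (x) K (x) E (x) 1 (x) .. (x) 1 and
   F |-> \sum_i 1 (x) .. (x) 1 (x) F (x) K^-1 (x) .. (x) K^-1, E or F in position i. *)
Definition tE (a b : tidx) : C`(q) := \sum_(i < k)
  tensmx (fun j => if (j < i)%N then @vK _ else if j == i then @vE _ else @vid _) a b.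
Definition tF (a b : tidx) : C`(q) := \sum_(i < k)
  tensmx (fun j => if (j < i)%N then @vid _ else if j == i then @vF _ else @vKi _) a b.
Definition tK : tidx -> tidx -> C`(q) := tensmx (fun j => @vK _).
Definition tKi : tidx -> tidx -> C`(q) := tensmx (fun j => @vKi _).

Definition tops : uq_ops tens := UqOps (opmx tE) (opmx tF) (opmx tK) (opmx tKi).

End Tensor.

Definition v1pow n := tens (fun _ : 'I_n => 1%N).
Definition v1ops n : uq_ops (v1pow n) := tops (fun _ : 'I_n => 1%N).
Definition v1top n : v1pow n := basis (finfun (fun _ : 'I_n => ord0 : 'I_2)).

(* The module maps determined by the image of the highest weight vector. *)
Definition iota_map n : 'Hom(vmod n, v1pow n) :=
  xget 0 [set g | uq_hom (vops n) (v1ops n) predT predT g /\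
                  g (basis ord0) = v1top n].
Definition pi_map n : 'Hom(v1pow n, vmod n) :=
  xget 0 [set g | uq_hom (v1ops n) (vops n) predT predT g /\
                  g (v1top n) = basis ord0].

(* In 'I_2, 0 stands for v_1 and 1 for v_{-1}. *)
Definition ev (a b : 'I_2) : C`(q) :=
  if (a == 1) && (b == 0) then 1 else if (a == 0) && (b == 1) then - qq^-1 else 0.

End Scalars.

Section Variety.
Variables (k : nat) (d : 'I_k -> nat).

Definition dsum : nat := \sum_i d i.

Section Points.
Variable F : finFieldType.

Definition dspace := 'rV[F]_dsum.
HB.instance Definition _ := Vector.on dspace.

Definition lo (i : 'I_k) : 'I_k.+1 := widen_ord (leqnSn k) i.
Definition hi (i : 'I_k) : 'I_k.+1 := lift ord0 i.

Definition in_tvar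
    (x : {ffun 'I_k.+1 -> {vspace dspace}} * {vspace dspace} * 'End(dspace)) : bool :=
  let: (fl, W, t) := x in
  [&& fl ord0 == 0%VS, fl ord_max == fullv,
      [forall i : 'I_k, [&& (fl (lo i) <= fl (hi i))%VS,
         \dim (fl (hi i)) == (\dim (fl (lo i)) + d i)%N &
         (t @: fl (hi i) <= fl (lo i))%VS]] &
      (limg t <= W <= lker t)%VS].

Definition tvar := {x | in_tvar x}.

Definition flag (x : tvar) : {ffun 'I_k.+1 -> {vspace dspace}} := (val x).1.1.
Definition sub (x : tvar) : {vspace dspace} := (val x).1.2.
Definition nil_end (x : tvar) : 'End(dspace) := (val x).2.
Definition kern (x : tvar) : {vspace dspace} := lker (nil_end x).
Definition imag (x : tvar) : {vspace dspace} := limg (nil_end x).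

Definition alpha (X : {vspace dspace}) (fl : {ffun 'I_k.+1 -> {vspace dspace}})
    (i : 'I_k) : nat :=
  (\dim (X :&: fl (hi i)) - \dim (X :&: fl (lo i)))%N.

Definition inA (w r n : 'I_k -> nat) (x : tvar) : bool :=
  [forall i, [&& alpha (sub x) (flag x) i == w i, alpha (imag x) (flag x) i == r i &
                 alpha (kern x) (flag x) i == n i]].

End Points.

Definition same_type (F F' : finFieldType) (x : tvar F) (y : tvar F') : bool :=
  [forall i, [&& alpha (sub x) (flag x) i == alpha (sub y) (flag y) i,
                 alpha (imag x) (flag x) i == alpha (imag y) (flag y) i &
                 alpha (kern x) (flag x) i == alpha (kern y) (flag y) i]].

(* Multi-indices; this bound loses nothing, as all entries of w, r, n are at most
   dsum when A_{w,r,n} is non-empty. *)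
Definition midx := {ffun 'I_k -> 'I_dsum.+1}.
Definition mval (w : midx) : 'I_k -> nat := fun i => w i.
Coercion mval : midx >-> Funclass.

(* A set of points attached to each point, given over all finite fields at once. *)
Definition corresp := forall F : finFieldType, tvar F -> tvar F -> bool.

Definition E_rel : corresp := fun F p x =>
  [&& flag x == flag p, nil_end x == nil_end p, (sub p <= sub x)%VS &
      \dim (sub x) == (\dim (sub p)).+1].

Definition F_rel : corresp := fun F p x =>
  [&& flag x == flag p, nil_end x == nil_end p, (sub x <= sub p)%VS &
      (\dim (sub x)).+1 == \dim (sub p)].

Definition B_rel : corresp := fun F p x =>
  [&& sub x == sub p, nil_end x == nil_end p &
      [forall i, alpha (kern x) (flag x) i == alpha (kern p) (flag p) i]].

Section Functions.
Variables (C : fieldType) (F : finFieldType).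
Local Notation K := C`(q).
Local Notation q := (qq C).

(* P(q^2), where P is the polynomial whose value at #|F'| is, for every finite field
   F', the number of points of X_p \cap A_{w,r,n} over F'.  The point p enters the
   conditions over F' through any point p' over F' in the same stratum; P is unique
   because every stratum that has a point over F has points over all finite fields. *)
Definition chi (X : corresp) (p : tvar F) (w r n : 'I_k -> nat) : K :=
  tofrac (xget 0 [set P : {poly C} |
      forall (F' : finFieldType) (p' : tvar F'), same_type p p' ->
        #|[set x : tvar F' | X F' p' x && inA w r n x]|%:R = P.[#|F'|%:R] ]
    \Po 'X^2).

Definition tfun := fvec C (tvar F).
HB.instance Definition _ := Vector.on tfun.

(* The value on A_{w,r,n} of a function constant on A_{w,r,n}, and 0 if that is empty. *)
Definition val_on (f : tfun) (w r n : 'I_k -> nat) : K :=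
  if [pick x | inA w r n x] is Some x then f x else 0.

(* \sum_(x in X_p) f x, for f = \sum_(w,r,n) val_on f w r n * 1_{A_{w,r,n}}. *)
Definition qsum (X : corresp) (f : tfun) (p : tvar F) : K :=
  \sum_(w : midx) \sum_(r : midx) \sum_(n : midx) val_on f w r n * chi X p w r n.

Definition fexp (w r n : 'I_k -> nat) : int :=
  \sum_(i < k) \sum_(j < k | (i < j)%N)
    ((r i)%:Z * (w j)%:Z + (w i)%:Z * (n j)%:Z - (w i)%:Z * (w j)%:Z).

Definition fwrn (w r n : 'I_k -> nat) : tfun :=
  [ffun x => q ^ fexp w r n * (inA w r n x)%:R].

Definition tspace : {vspace tfun} :=
  <<[seq fwrn s.1.1 s.1.2 s.2 | s : midx * midx * midx]>>%VS.

Definition t0space : {vspace tfun} :=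
  <<[seq fwrn w (fun=> 0%N) d | w : midx]>>%VS.

Definition actE_fun (f : tfun) : tfun := [ffun p =>
  q ^ (- ((\dim (kern p))%:Z - (\dim (sub p))%:Z - 1)) * qsum E_rel f p].
Definition actF_fun (f : tfun) : tfun := [ffun p =>
  q ^ (- ((\dim (sub p))%:Z - (\dim (imag p))%:Z - 1)) * qsum F_rel f p].
Definition actK_fun (f : tfun) : tfun := [ffun p =>
  q ^ (dsum%:Z - 2 * (\dim (sub p))%:Z) * f p].
Definition actKi_fun (f : tfun) : tfun := [ffun p =>
  q ^ (- (dsum%:Z - 2 * (\dim (sub p))%:Z)) * f p].
Definition xi_fun (f : tfun) : tfun := [ffun p => qsum B_rel f p].

Lemma val_onD c f g w r n :
  val_on (c *: f + g) w r n = c * val_on f w r n + val_on g w r n.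
Proof.
rewrite /val_on; case: pickP => [x _|_]; last by rewrite mulr0 addr0.
by rewrite !ffunE.
Qed.

Lemma qsumD X c f g p : qsum X (c *: f + g) p = c * qsum X f p + qsum X g p.
Proof.
rewrite /qsum; do 3! (rewrite mulr_sumr -big_split /=; apply: eq_bigr => ? _).
by rewrite val_onD mulrDl mulrA.
Qed.

Lemma actE_linear : linear actE_fun.
Proof. by move=> c f g; apply/ffunP => p; rewrite !ffunE qsumD mulrDr mulrCA. Qed.
Lemma actF_linear : linear actF_fun.
Proof. by move=> c f g; apply/ffunP => p; rewrite !ffunE qsumD mulrDr mulrCA. Qed.
Lemma actK_linear : linear actK_fun.
Proof. by move=> c f g; apply/ffunP => p; rewrite !ffunE mulrDr mulrCA. Qed.
Lemma actKi_linear : linear actKi_fun.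
Proof. by move=> c f g; apply/ffunP => p; rewrite !ffunE mulrDr mulrCA. Qed.
Lemma xi_linear : linear xi_fun.
Proof. by move=> c f g; apply/ffunP => p; rewrite !ffunE qsumD. Qed.

HB.instance Definition _ := GRing.isLinear.Build _ _ _ _ actE_fun actE_linear.
HB.instance Definition _ := GRing.isLinear.Build _ _ _ _ actF_fun actF_linear.
HB.instance Definition _ := GRing.isLinear.Build _ _ _ _ actK_fun actK_linear.
HB.instance Definition _ := GRing.isLinear.Build _ _ _ _ actKi_fun actKi_linear.
HB.instance Definition _ := GRing.isLinear.Build _ _ _ _ xi_fun xi_linear.

Definition act_ops : uq_ops tfun :=
  UqOps (linfun actE_fun) (linfun actF_fun) (linfun actK_fun) (linfun actKi_fun).

Definition xi : 'End(tfun) := linfun xi_fun.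

Definition ts_pred : {pred tfun} := fun f => (f \in tspace) &&
  [forall p : tvar F, forall p' : tvar F,
    ((\dim (sub p) == \dim (sub p')) &&
     [forall i, alpha (kern p) (flag p) i == alpha (kern p') (flag p') i])
    ==> (f p == f p')].

(* eta_{r,n} and its inverse, with e = n - r: the coefficient of f_{u+r,r,n} in f
   becomes the coefficient of the basis vector indexed by u. *)
Definition eta_fun (e r n : 'I_k -> nat) (f : tfun) : tens C e :=
  [ffun u : tidx e => q ^ (- fexp (fun i => u i + r i)%N r n) *
                      val_on f (fun i => u i + r i)%N r n].
Definition etainv_fun (e r n : 'I_k -> nat) (phi : tens C e) : tfun :=
  \sum_(u : tidx e) phi u *: fwrn (fun i => u i + r i)%N r n.

Lemma eta_linear e r n : linear (@eta_fun e r n).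
Proof. by move=> c f g; apply/ffunP => p; rewrite !ffunE val_onD mulrDr mulrCA. Qed.
Lemma etainv_linear e r n : linear (@etainv_fun e r n).
Proof.
move=> c f g; rewrite /etainv_fun scaler_sumr -big_split /=; apply: eq_bigr => u _.
by rewrite !ffunE scalerDl scalerA.
Qed.

HB.instance Definition _ e r n :=
  GRing.isLinear.Build _ _ _ _ (@eta_fun e r n) (@eta_linear e r n).
HB.instance Definition _ e r n :=
  GRing.isLinear.Build _ _ _ _ (@etainv_fun e r n) (@etainv_linear e r n).

Definition eta e r n : 'Hom(tfun, tens C e) := linfun (@eta_fun e r n).
Definition etainv e r n : 'Hom(tens C e, tfun) := linfun (@etainv_fun e r n).

End Functions.

(* The vertices: a box together with a position in that box. *)
Definition vertex := {i : 'I_k & 'I_(d i)}.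

Definition vlt (u v : vertex) : bool :=
  (tag u < tag v)%N || (tag u == tag v) && (tagged u < tagged v)%N.

(* An arc is the pair of its left and right endpoints. *)
Definition matched (S : {set vertex * vertex}) (v : vertex) : bool :=
  [exists a in S, (a.1 == v) || (a.2 == v)].

Definition lower_match (S : {set vertex * vertex}) : bool :=
  [&& [forall a in S, (tag a.1 < tag a.2)%N],
      [forall a in S, forall b in S, (a != b) ==>
         [&& a.1 != b.1, a.1 != b.2, a.2 != b.1 & a.2 != b.2]],
      [forall a in S, forall b in S,
         ~~ [&& vlt a.1 b.1, vlt b.1 a.2 & vlt a.2 b.2]] &
      [forall a in S, forall v, (vlt a.1 v && vlt v a.2) ==> matched S v]].

Definition rS (S : {set vertex * vertex}) (i : 'I_k) : nat :=
  #|[set a in S | tag a.1 == i]|.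
Definition nS (S : {set vertex * vertex}) (i : 'I_k) : nat :=
  (d i - #|[set a in S | tag a.2 == i]|)%N.

Section Epsilon.
Variables (C : fieldType) (F : finFieldType).
Local Notation K := C`(q).

(* x labels each vertex by a basis vector of V_1. *)
Definition box_idx (x : {ffun vertex -> 'I_2}) (i : 'I_k) :
    tidx (fun _ : 'I_(d i) => 1%N) :=
  finfun (fun j : 'I_(d i) => x (Tagged (fun i => 'I_(d i)) j) : 'I_2).

(* The labels of the unmatched vertices of box i from left to right; for m the number
   of these vertices, the default value of nth is never used. *)
Definition free_idx (S : {set vertex * vertex}) (x : {ffun vertex -> 'I_2})
    (i : 'I_k) (m : nat) : tidx (fun _ : 'I_m => 1%N) :=
  finfun (fun j : 'I_m =>
    nth ord0 [seq x (Tagged (fun i => 'I_(d i)) l) | l <- enum 'I_(d i)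
              & ~~ matched S (Tagged (fun i => 'I_(d i)) l)] j : 'I_2).

(* The coefficient of basis a in gamma_S (basis b), for r = rS S and n = nS S. *)
Definition gammaS (S : {set vertex * vertex}) (r n : 'I_k -> nat)
    (a : tidx (fun i => n i - r i)%N) (b : tidx d) : K :=
  \sum_(x : {ffun vertex -> 'I_2})
    (\prod_i iota_map C (d i) (basis C (b i)) (box_idx x i)) *
    (\prod_(c in S) ev C (x c.1) (x c.2)) *
    (\prod_i pi_map C (n i - r i)
       (basis C (free_idx S x i (n i - r i))) (a i)).

Definition gamma (r n : 'I_k -> nat) :
    'Hom(tens C d, tens C (fun i => n i - r i)%N) :=
  if [pick T | lower_match T && [forall i, (rS T i == r i) && (nS T i == n i)]]
    is Some T then opmx (@gammaS T r n) else 0.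

Definition epsilon : 'End(tfun C F) :=
  \sum_(r : midx) \sum_(n : midx)
    (etainv C F (fun i => n i - r i)%N r n \o gamma r n \o
     eta C F d (fun=> 0%N) d)%VF.

Definition tc_space : {vspace tfun C F} := (epsilon @: t0space C F)%VS.

End Epsilon.
End Variety.

(* Main.v *)
(* T(d) consists of the functions constant on the strata A_{w,r,n}, and there E and F act by
   explicit sums over the boxes whose coefficients are powers of q times quantum integers.
   The number of points of a stratum satisfying the conditions at hand is a polynomial in
   |F| with nonnegative coefficients; so xi commutes with E and F by double counting over
   every finite field, and T_c is a submodule because eta and gamma_S are intertwiners.

   Applying F shows that xi is onto as soon as its image contains, for each type n of ker t,
   the indicator function of the points with alpha(ker t, D) = n and W = im t.  These are
   reached by triangularity.  A lower match S is determined by n^S, every type n is some n^S,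
   and the coefficient of the highest weight vector in gamma_S(v_b) vanishes unless
   sum_i i b_i <= sum_i i (d_i - n^S_i), with equality only for b = d - n^S.

   For injectivity, compare dimensions: u |-> (n, dim W - rank t) embeds the index set of the
   basis of V_{d_1} (x) ... (x) V_{d_k} into the values of the two invariants that separate
   T_s.  As T_c is a quotient of that tensor product, xi is injective. *)
Require Import Defs.
From mathcomp Require Import all_boot all_order all_algebra finfield reals complex.
From mathcomp Require Import boolp classical_sets zify ring.

Set Implicit Arguments.
Unset Strict Implicit.
Unset Printing Implicit Defensive.

Import GRing.Theory.
Local Open Scope ring_scope.

(** * Quantum integers *)

(** [chi] is a polynomial chosen to fit all finite fields at once, so counts are made in
    [{poly nat}]. A nonzero polynomial with natural coefficients is positive at every field size;
    hence a type that occurs over one field occurs over all, the prime fields identify the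
    polynomial, and identities of counts become identities at q^2.

    One identity makes E and F computable on strata, on T_s and in iota and pi: sum_i q^(l_i - r_i)
    [m_i] = [sum_i m_i], where l_i and r_i are the sums of the m_j left and right of i.

    For triangularity the obstacle is that xi of the image of a basis vector lives on several kernel
    types. On points with W = im t only a highest weight coefficient of gamma_S is seen: the free
    vertices carry v_1 and each arc carries one v_{-1}, which can move right only up to its right
    endpoint. Smaller ranks of t also occur, so the induction is on the rank first.

    A type n is some n^S exactly under a ballot condition; for ker t it follows from t(D_i) lying in
    the intersection of ker t and D_{i-1}. The embedding that bounds the dimension is the bracketing
    rule of crystals: each v_{-1} cancels an earlier free v_1. *)

Section QuantumIntegers.
Variable C : numFieldType.
Local Notation K := C`(q).
Local Notation q := (qq C).

Lemma qq_neq0 : q != 0.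
Proof. by rewrite tofrac_eq0 polyX_eq0. Qed.

Lemma expq_eq1 (z : int) : (q ^ z == 1) = (z == 0).
Proof.
have nat_case n : (q ^+ n.+1 == 1) = false.
  rewrite -tofracXn -tofrac1 tofrac_eq; apply/eqP => /(congr1 (fun P => size (polyseq P))).
  by rewrite size_polyXn size_poly1.
case: z => [[|n]|n]; first by rewrite expr0z !eqxx.
  by rewrite -exprnP nat_case.
by rewrite NegzE -exprnN invr_eq1 nat_case.
Qed.

Lemma expq_inj : injective (fun z : int => q ^ z).
Proof.
move=> x y exy; apply/eqP; rewrite -subr_eq0 -expq_eq1 expfzDr ?qq_neq0 //.
by rewrite exy -expfzDr ?qq_neq0 // subrr expr0z.
Qed.

Lemma qden_neq0 : q - q^-1 != 0.
Proof.
rewrite subr_eq0 -[q in X in X == _]expr1z -exprN1; by apply/eqP => /expq_inj e; have {e}: (1 : int) = -1 := e; lia.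
Qed.

(** Quantum integers at arbitrary integers, so that differences of dimensions can be inserted
    without case distinctions. *)
Definition qz (z : int) : K := (q ^ z - q ^ (- z)) / (q - q^-1).

Lemma qintE n : qint C n = qz n%:Z.
Proof. by rewrite /qint exprnP exprnN. Qed.

Lemma qz_eq0 z : (qz z == 0) = (z == 0).
Proof.
rewrite mulf_eq0 invr_eq0 (negPf qden_neq0) orbF subr_eq0.
apply/eqP/eqP => [/expq_inj|->//]; lia.
Qed.

Lemma qz0 : qz 0 = 0.
Proof. by apply/eqP; rewrite qz_eq0. Qed.

Section Telescoping.
Variable n : nat.
Implicit Types m : 'I_n -> int.

Definition lsum m (i : 'I_n) : int := \sum_(j : 'I_n | (j < i)%N) m j.
Definition rsum m (i : 'I_n) : int := \sum_(j : 'I_n | (i < j)%N) m j.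

Lemma lrsum m i : lsum m i + m i + rsum m i = \sum_j m j.
Proof.
rewrite [RHS](bigID (fun j : 'I_n => (j < i)%N)) /= -addrA; congr (_ + _).
rewrite [RHS](bigD1 i) ?ltnn //=; congr (_ + _); apply: eq_bigl => j.
by rewrite -leqNgt ltn_neqAle andbC eq_sym.
Qed.

(** A change of one box in additive form, so that it can be pushed through [lsum], [rsum] and the
    inversion counts below. *)
Definition pulse (l : 'I_n) (c : int) : 'I_n -> int := fun j => if j == l then c else 0.

Lemma sum_pulse (P : pred 'I_n) m l c :
  \sum_(j | P j) (m j + pulse l c j) = \sum_(j | P j) m j + (if P l then c else 0).
Proof.
rewrite big_split /=; congr (_ + _); rewrite /pulse -big_mkcondr /=.
case: ifP => Pl; last first.
  by apply: big_pred0 => j; case: (eqVneq j l) => [->|_]; rewrite ?Pl ?andbF.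
apply: (big_pred1 l) => j; rewrite /=.
by case: (eqVneq j l) => [->|_]; rewrite ?Pl ?andbF.
Qed.

End Telescoping.

(** With l_i, r_i the sums left and right of i, the i-th term times q - q^-1 is q^(l_i + m_i - r_i)
    - q^(l_i - m_i - r_i); since l_i + m_i = l_(i+1) and m_i + r_i = r_(i-1), the sum telescopes. *)
Lemma qz_telescope n (m : 'I_n -> int) :
  \sum_i q ^ (lsum m i - rsum m i) * qz (m i) = qz (\sum_i m i).
Proof.
elim: n m => [|n IH] m; first by rewrite !big_ord0 qz0.
rewrite !big_ord_recr /=; set m' := fun i : 'I_n => m (widen_ord (leqnSn n) i).
set z := m ord_max; have lm : lsum m ord_max = \sum_i m' i.
  rewrite /lsum big_mkcond big_ord_recr /= ltnn addr0.
  by apply: eq_bigr => i _; rewrite ltn_ord.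
have rm : rsum m ord_max = 0.
  by rewrite /rsum big_pred0 // => i; rewrite ltnNge -ltnS ltn_ord.
have -> : \sum_(i < n) q ^ (lsum m (widen_ord (leqnSn n) i) - rsum m (widen_ord (leqnSn n) i))
    * qz (m (widen_ord (leqnSn n) i)) = q ^ (- z) * qz (\sum_i m' i).
  rewrite -IH mulr_sumr; apply: eq_bigr => i _; rewrite mulrA -expfzDr ?qq_neq0 //.
  congr (q ^ _ * _).
  have -> : lsum m (widen_ord (leqnSn n) i) = lsum m' i.
    rewrite /lsum big_mkcond big_ord_recr /= ltnNge (ltnW (ltn_ord i)) /= addr0.
    by rewrite -big_mkcond.
  have -> : rsum m (widen_ord (leqnSn n) i) = rsum m' i + z.
    by rewrite /rsum big_mkcond big_ord_recr /= ltn_ord -big_mkcond.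
  by lia.
rewrite lm rm subr0 -/z /qz; set S := \sum_i m' i.
rewrite !mulrA -mulrDl; congr (_ / _); rewrite !mulrBr -!expfzDr ?qq_neq0 // opprD.
rewrite [- z + S]addrC [- S - z]addrC; set a := q ^ _; set b := q ^ _; set c := q ^ _.
by rewrite addrC subrKA.
Qed.

Lemma qzN z : qz (- z) = - qz z.
Proof. by rewrite /qz opprK -mulNr opprB. Qed.

Lemma qz_telescope_rev n (m : 'I_n -> int) :
  \sum_i q ^ (rsum m i - lsum m i) * qz (m i) = qz (\sum_i m i).
Proof.
apply: oppr_inj; rewrite -qzN -!sumrN -qz_telescope; apply: eq_bigr => i _.
by rewrite qzN mulrN /lsum /rsum !sumrN opprK addrC.
Qed.

End QuantumIntegers.

(** * Counting subspaces and flags *)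

Definition gsum (Q a : nat) : nat := (\sum_(l < a) Q ^ l)%N.

Lemma gsum_geo Q a : ((Q.+1 - 1) * gsum Q.+1 a + 1 = Q.+1 ^ a)%N.
Proof.
rewrite /gsum subn1 /=; elim: a => [|a IH]; first by rewrite big_ord0 muln0.
by rewrite big_ord_recr /= mulnDr addnAC IH expnS mulSn addnC.
Qed.

(** This is X^(e c) times the Gaussian binomial of x over c, given by its Pascal recurrence so that
    the coefficients are natural numbers. Where the exponent truncates, the other factor is 0. *)
Fixpoint gpoly (x e c : nat) : {poly nat} :=
  match x, c with
  | _, 0%N => 1
  | 0%N, _.+1 => 0
  | x'.+1, c'.+1 => gpoly x' e c + 'X^(e + x' - c') * gpoly x' e c'
  end.

Lemma gpoly_0 x e : gpoly x e 0 = 1.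
Proof. by case: x. Qed.

Lemma gpoly_gt x e c : (x < c)%N -> gpoly x e c = 0.
Proof.
elim: x c => [|x IH] [|c] //= ltc.
by rewrite !IH ?mulr0 ?addr0 //; lia.
Qed.

Lemma gpoly_diag c e : gpoly c e c = 'X^(e * c).
Proof.
elim: c => [|c IH] /=; first by rewrite muln0 expr0.
by rewrite IH gpoly_gt // add0r -exprD addnK mulnS.
Qed.

Lemma horner_addn (p r : {poly nat}) x : (p + r).[x] = (p.[x] + r.[x])%N.
Proof. exact: hornerD. Qed.

Lemma horner_muln (p r : {poly nat}) x : (p * r).[x] = (p.[x] * r.[x])%N.
Proof. exact: hornerM. Qed.

Lemma horner_Xnn n x : ('X^n : {poly nat}).[x] = (x ^ n)%N.
Proof. by rewrite hornerXn natrXE. Qed.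

Section SubspaceCounting.
Variables (F : finFieldType) (m : nat).
Local Notation V := 'rV[F]_m.
Local Notation Q := #|F|.
Implicit Types (U W X Y Z A H : {vspace V}).

Lemma card_vs U : #|[pred v | v \in U]| = (Q ^ \dim U)%N.
Proof. exact: (@card_vspace F V _ U). Qed.

Lemma card_vsD U W : (U <= W)%VS ->
  #|[pred v | (v \in W) && (v \notin U)]| = (Q ^ \dim W - Q ^ \dim U)%N.
Proof.
move=> sUW; rewrite -!card_vs -(cardID [pred v | v \in U] [pred v | v \in W]).
have -> : #|[predI [pred v | v \in W] & [pred v | v \in U]]| = #|[pred v | v \in U]|.
  apply: eq_card => v; rewrite !inE; case vU: (v \in U); rewrite ?andbF //.
  by rewrite (subvP sUW).
by rewrite addKn; apply: eq_card => v; rewrite !inE andbC.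
Qed.

Lemma card_gt1 : (1 < Q)%N. Proof. exact: finNzRing_gt1. Qed.

Lemma dim_addv_line Y v : v \notin Y -> \dim (Y + <[v]>) = (\dim Y).+1.
Proof.
move=> vY; rewrite dimv_disjoint_sum ?dim_vline.
  by case: eqP vY => [->|_]; rewrite ?mem0v //= addn1.
apply/eqP; rewrite -subv0; apply/subvP => u; rewrite memv_cap memv0 => /andP[uY].
case/vlineP=> c uc; rewrite uc; case: (eqVneq c 0) => [->|c0]; first by rewrite scale0r.
by move: uY; rewrite uc rpredZeq (negPf c0) (negPf vY).
Qed.

(** Each v in X outside Z gives such an H = Y + <v>. Conversely H meets Z only in Y, so H arises
    from exactly the vectors of H outside Y. *)
Lemma card_line_ext Y Z X : (Y <= Z)%VS -> (Z <= X)%VS ->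
  #|[set H | [&& (Y <= H)%VS, (H <= X)%VS, ~~ (H <= Z)%VS & \dim H == (\dim Y).+1]]| =
  (Q ^ (\dim Z - \dim Y) * gsum Q (\dim X - \dim Z))%N.
Proof.
move=> sYZ sZX; set S := [set H | _].
have yz := dimvS sYZ; have zx := dimvS sZX.
have eq1 : (#|S| * (Q ^ (\dim Y).+1 - Q ^ \dim Y) = Q ^ \dim X - Q ^ \dim Z)%N.
  rewrite -(card_vsD sZX) -[RHS]sum1_card (partition_big (fun v => Y + <[v]>)%VS (mem S)) /=.
    rewrite -sum_nat_const; apply: eq_bigr => H; rewrite inE => /and4P[YH HX HZ /eqP dH].
    rewrite -dH -card_vsD // sum1_card; apply: eq_card => v.
    rewrite -[LHS]/((v \in H) && (v \notin Y)).
    rewrite -[RHS]/((v \in X) && (v \notin Z) && (Y + <[v]> == H)%VS).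
    apply/idP/idP => [/andP[vH vY]|/andP[/andP[vX vZ] /eqP <-]].
      have eH : (Y + <[v]>)%VS = H.
        by apply/eqP; rewrite eqEdim dim_addv_line // dH subv_add YH -memvE vH leqnn.
      rewrite (subvP HX) //= eH eqxx andbT; apply: contra HZ => vZ.
      by rewrite -eH subv_add sYZ -memvE.
    rewrite (contra ((subvP sYZ) v) vZ) andbT.
    by apply: (subvP (addvSr _ _)); rewrite memv_line.
  move=> v /andP[vX vZ]; rewrite inE addvSl subv_add (subv_trans sYZ sZX) -memvE vX /=.
  rewrite dim_addv_line ?eqxx ?andbT; last by apply: contra vZ; apply: (subvP sYZ).
  by apply: contra vZ => /subvP; apply; apply: (subvP (addvSr _ _)); rewrite memv_line.
have Qgt0 := card_gt1; case: Q Qgt0 eq1 => [//|q] q0.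
have pos : (0 < q.+1 ^ \dim Y * (q.+1 - 1))%N by rewrite muln_gt0 expn_gt0; lia.
move=> eq1; apply/eqP; rewrite -(eqn_pmul2r pos); apply/eqP.
have -> : (q.+1 ^ \dim Y * (q.+1 - 1) = q.+1 ^ (\dim Y).+1 - q.+1 ^ \dim Y)%N.
  by rewrite expnSr mulnBr muln1.
rewrite eq1 expnSr -{2}[(q.+1 ^ \dim Y)%N]muln1 -mulnBr mulnACA -expnD subnK //.
rewrite [(gsum _ _ * _)%N]mulnC.
have /(congr1 (subn^~ 1)) := gsum_geo q (\dim X - \dim Z); rewrite addnK => ->.
by rewrite mulnBr muln1 -expnD subnKC.
Qed.

Lemma hyperplane_between A X : (A <= X)%VS -> (\dim A < \dim X)%N ->
  exists2 Z, (A <= Z <= X)%VS & \dim X = (\dim Z).+1.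
Proof.
move=> sAX ltAX; pose B := (X :\: A)%VS.
have AB : (A + B = X)%VS by rewrite addvC addv_diff; apply/addv_idPl.
have cAB : (A :&: B = 0)%VS by rewrite capvC capv_diff.
have dB : (\dim A + \dim B = \dim X)%N by rewrite -AB dimv_disjoint_sum.
have B0 : B != 0%VS by rewrite -dimv_eq0; lia.
pose B' := (B :\: <[vpick B]>)%VS; have sB' : (B' <= B)%VS by exact: diffvSl.
have dB' : \dim B = (\dim B').+1.
  have := dimv_cap_compl B <[vpick B]>; rewrite -/B'.
  have /capv_idPr-> : (<[vpick B]> <= B)%VS by rewrite -memvE memv_pick.
  by rewrite dim_vline vpick0 B0 => <-.
have cAB' : (A :&: B' = 0)%VS by apply/eqP; rewrite -subv0 -cAB capvS.
exists (A + B')%VS; first by rewrite addvSl -AB addvS.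
by rewrite dimv_disjoint_sum // -addnS -dB'.
Qed.

(** Induction on the codimension of A in X. For a hyperplane Z of X through A, either H lies in Z or
    it meets Z in codimension 1; these cases are the two terms of the recurrence of [gpoly]. *)
Lemma card_ext X A Y c : (Y <= A)%VS -> (A <= X)%VS ->
  #|[set H | [&& (H <= X)%VS, (H :&: A)%VS == Y & \dim H == (\dim Y + c)%N]]| =
  (gpoly (\dim X - \dim A) (\dim A - \dim Y) c).[Q].
Proof.
move=> sYA; have ya := dimvS sYA.
move dx : (\dim X - \dim A)%N => x; elim: x X dx c => [|x IH] X dx c sAX.
  have eXA : X = A by apply/esym/eqP; rewrite eqEdim sAX -subn_eq0 dx.
  rewrite eXA; have -> : [set H | [&& (H <= A)%VS, (H :&: A)%VS == Y & \dim H == (\dim Y + c)%N]]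
     = if c is 0%N then [set Y] else finset.set0.
    apply/setP => H; rewrite inE.
    have -> : [&& (H <= A)%VS, (H :&: A)%VS == Y & \dim H == (\dim Y + c)%N] =
              [&& H == Y & c == 0%N].
      apply/and3P/andP => [[HA /eqP HAY /eqP dH]|[/eqP-> /eqP->]].
        by move: HAY dH; rewrite (capv_idPl HA) => ->; rewrite eqxx => dH; split => //; apply/eqP; lia.
      by rewrite sYA (capv_idPl sYA) addn0 !eqxx.
    by case: c => [|c]; rewrite ?andbT ?andbF ?inE.
  by case: c => [|c] /=; rewrite ?cards1 ?cards0 ?hornerE.
case: c => [|c].
  rewrite gpoly_0 hornerC; have -> : [set H | [&& (H <= X)%VS, (H :&: A)%VS == Y &
      \dim H == (\dim Y + 0)%N]] = [set Y]; last by rewrite cards1.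
  apply/setP => H; rewrite !inE addn0; apply/and3P/eqP => [[HX /eqP HY /eqP dH]|->].
    by apply/eqP; rewrite eq_sym eqEdim -{1}HY capvSl dH leqnn.
  by rewrite (subv_trans sYA sAX) (capv_idPl sYA) !eqxx.
have [Z /andP[AZ ZX] dZ] : exists2 Z, (A <= Z <= X)%VS & \dim X = (\dim Z).+1.
  by apply: hyperplane_between => //; lia.
have dZA : (\dim Z - \dim A = x)%N by have := dimvS AZ; lia.
rewrite /= horner_addn -(IH Z dZA c.+1 AZ).
rewrite -[LHS](cardsID [set H | (H <= Z)%VS]); congr (_ + _)%N.
  apply: eq_card => H; rewrite !inE andbC; case HZ: (H <= Z)%VS => //=.
  by rewrite (subv_trans HZ ZX).
rewrite horner_muln -(IH Z dZA c AZ) horner_Xnn mulnC.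
set S := [set H | _] :\: _; set S' := [set H | _].
have capZ H : H \in S -> (\dim H = (\dim (H :&: Z)).+1)%N.
  rewrite !inE => /and4P[HZ HX _ _]; have := dimv_sum_cap H Z.
  have sX : (H + Z <= X)%VS by rewrite subv_add HX.
  have : (\dim Z < \dim (H + Z))%N.
    rewrite ltn_neqAle dimvS ?addvSr // andbT; apply: contra HZ => /eqP e.
    have /eqP-> : Z == (H + Z)%VS by rewrite eqEdim addvSr e leqnn.
    exact: addvSl.
  by have := dimvS sX; lia.
rewrite -sum1_card (partition_big (fun H => (H :&: Z)%VS) (mem S')) /=; last first.
  move=> H HS; have := capZ H HS; move: HS; rewrite !inE => /and4P[HZ HX /eqP HA /eqP dH] cZ.
  rewrite capvSr -capvA (capv_idPr AZ) HA eqxx /=; apply/eqP; lia.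
rewrite -sum_nat_const; apply: eq_bigr => H'.
rewrite inE => /and3P[H'Z /eqP H'A /eqP dH'].
(* An H outside Z that meets Z in H' is H' plus a line; as Z is a hyperplane of X, the factor [gsum]
   is 1. *)
have := card_line_ext H'Z ZX; rewrite dZ subSnn /gsum big_ord1 expn0 muln1.
have -> : (\dim Z - \dim H' = \dim A - \dim Y + x - c)%N by have := dimvS AZ; lia.
move=> <-; rewrite sum1_card; apply: eq_card => H; rewrite [RHS]inE.
rewrite -[LHS]/((H \in S) && ((H :&: Z)%VS == H')).
apply/idP/idP => [/andP[HS /eqP <-]|/and4P[H'H HX HZ /eqP dH]].
   have := capZ H HS; move: HS; rewrite !inE => /and4P[-> -> _ _] <-.
  by rewrite capvSl /=.
have eH : (H :&: Z)%VS = H'.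
  apply/esym/eqP; rewrite eqEdim subv_cap H'H H'Z /= -ltnS -dH ltn_neqAle dimvS ?capvSl //.
  rewrite andbT; apply: contra HZ => /eqP e.
  by have /eqP <- : (H :&: Z)%VS == H; rewrite ?capvSr // eqEdim capvSl e leqnn.
rewrite !inE HZ HX eH eqxx andbT /= dH dH' addnS eqxx andbT -H'A -eH -capvA.
by rewrite (capv_idPr AZ).
Qed.

(** Enlarge A to Z by one vector. The hyperplanes through Z are counted by induction; the others
    meet Z exactly in A, and [card_ext] counts them by a single power of |F|. *)
Lemma card_hyperplanes A X : (A <= X)%VS ->
  #|[set H | [&& (A <= H)%VS, (H <= X)%VS & (\dim H).+1 == \dim X]]| =
  gsum Q (\dim X - \dim A).
Proof.
move=> sAX; move dx : (\dim X - \dim A)%N => c; elim: c A sAX dx => [|c IH] A sAX dx.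
  rewrite /gsum big_ord0; apply: eq_card0 => H; rewrite !inE.
  by apply/and3P => -[AH HX /eqP dH]; have := dimvS AH; lia.
have [v vX vA] : exists2 v, v \in X & v \notin A.
  by apply/subvPn; apply/negP => XA; have := dimvS XA; lia.
pose Z := (A + <[v]>)%VS; have dZ : \dim Z = (\dim A).+1 by exact: dim_addv_line.
have ZX : (Z <= X)%VS by rewrite subv_add sAX -memvE.
rewrite -[LHS](cardsID [set H | (Z <= H)%VS]) /gsum big_ord_recr /=; congr (_ + _)%N.
  rewrite -[LHS](_ : #|[set H | [&& (Z <= H)%VS, (H <= X)%VS & (\dim H).+1 == \dim X]]| = _).
    by apply: IH => //; lia.
  apply: eq_card => H; rewrite !inE; case ZH: (Z <= H)%VS; rewrite ?andbF ?andbT //=.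
  by rewrite (subv_trans (addvSl _ _) ZH).
have := @card_ext X Z A c (addvSl _ _) ZX.
rewrite (_ : \dim X - \dim Z = c)%N ?dZ ?subSnn; last by lia.
rewrite gpoly_diag mul1n horner_Xnn => <-; apply: eq_card => H; rewrite !inE.
apply/idP/idP => [/and4P[ZH AH HX /eqP dH]|/and3P[HX /eqP HZ /eqP dH]].
  rewrite HX /=; apply/andP; split; last by apply/eqP; lia.
  rewrite eq_sym eqEdim subv_cap AH addvSl /= -ltnS -dZ ltn_neqAle dimvS ?capvSr // andbT.
  apply: contra ZH => /eqP e.
  by have /eqP <- : (H :&: Z)%VS == Z; rewrite ?capvSl // eqEdim capvSr e leqnn.
rewrite HX -HZ capvSl /=; apply/andP; split; last by apply/eqP; lia.
by apply/negP => ZH; move: HZ; rewrite (capv_idPr ZH) => e; move: dZ; rewrite e; lia.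
Qed.

Lemma card_hyperplanesD A1 A2 X : (A1 <= A2)%VS -> (A2 <= X)%VS ->
  (#|[set H | [&& (A1 <= H)%VS, (H <= X)%VS, ~~ (A2 <= H)%VS & (\dim H).+1 == \dim X]]| =
  Q ^ (\dim X - \dim A2) * gsum Q (\dim A2 - \dim A1))%N.
Proof.
move=> s12 s2X; have s1X := subv_trans s12 s2X.
have := card_hyperplanes s1X; rewrite -(cardsID [set H | (A2 <= H)%VS]).
rewrite (_ : #|_ :&: _| = gsum Q (\dim X - \dim A2)); last first.
  rewrite -card_hyperplanes //; apply: eq_card => H; rewrite !inE andbC.
  by case sH: (A2 <= H)%VS => //=; rewrite (subv_trans s12 sH).
rewrite (_ : #|_ :\: _| = #|[set H | [&& (A1 <= H)%VS, (H <= X)%VS, ~~ (A2 <= H)%VS & (\dim H).+1 == \dim X]]|); last first.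
  by apply: eq_card => H; rewrite !inE; do !case: (_ <= _)%VS.
have -> : (\dim X - \dim A1 = (\dim X - \dim A2) + (\dim A2 - \dim A1))%N.
  by have := dimvS s12; have := dimvS s2X; lia.
rewrite {2}/gsum big_split_ord /= -/(gsum _ _) => /addnI ->.
by rewrite big_distrr /=; apply: eq_bigr => i _; rewrite expnD.
Qed.

(** The guard matters: for h1 < h0 the truncated difference would turn the count 0 into 1. *)
Definition extpoly (x1 x0 h1 h0 : nat) : {poly nat} :=
  if (h0 <= h1)%N then gpoly (x1 - x0) (x0 - h0) (h1 - h0) else 0.

(** All fibres of the map from H to its intersection with X0 have the size given by [card_ext]. The
    arbitrary condition P on that intersection allows iteration along a chain. *)
Lemma card_ext_pred (P : pred {vspace V}) X1 X0 h1 h0 : (X0 <= X1)%VS ->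
  #|[set H | [&& (H <= X1)%VS, P (H :&: X0)%VS, \dim (H :&: X0) == h0 & \dim H == h1]]| =
  (#|[set H | [&& (H <= X0)%VS, P H & \dim H == h0]]| *
   (extpoly (\dim X1) (\dim X0) h1 h0).[Q])%N.
Proof.
move=> s01; rewrite -sum1_card.
rewrite (partition_big (fun H => (H :&: X0)%VS)
   (mem [set H | [&& (H <= X0)%VS, P H & \dim H == h0]])) /=; last first.
  by move=> H; rewrite !inE capvSr => /and4P[_ -> -> _].
rewrite -sum_nat_const; apply: eq_bigr => Y; rewrite inE => /and3P[YX PY /eqP dY].
rewrite sum1_card /extpoly; case: leqP => [le01|lt01]; last first.
  rewrite horner0; apply: eq_card0 => H.
  apply/negP => /andP[]; rewrite inE => /and4P[_ _ /eqP d0 /eqP d1] _.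
  by have := dimvS (capvSl H X0); lia.
rewrite -dY -(card_ext _ YX s01); apply: eq_card => H; rewrite [RHS]inE.
rewrite -[LHS]/((H \in [set H | _]) && _) inE.
rewrite (_ : \dim Y + (h1 - \dim Y) = h1)%N; last by lia.
case: (eqVneq (H :&: X0)%VS Y) => [->|_]; rewrite ?andbT ?andbF //=.
by rewrite PY dY eqxx.
Qed.

Definition chainpoly (i x0 x1 x2 x3 h0 h1 h2 h3 : nat) : {poly nat} :=
  extpoly x0 i h0 i * extpoly x1 x0 h1 h0 * extpoly x2 x1 h2 h1 * extpoly x3 x2 h3 h2.

(** Four uses of [card_ext_pred], where each of [P1], [P2], [P3] collects the conditions imposed
    lower in the chain. In a flag, H is the step just below U, and the chain consists of t(U), the
    intersections of U with im t, W and ker t, and U itself. *)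
Lemma card_chain I X0 X1 X2 X3 h0 h1 h2 h3 :
  (I <= X0)%VS -> (X0 <= X1)%VS -> (X1 <= X2)%VS -> (X2 <= X3)%VS ->
  #|[set H | [&& (I <= H)%VS, (H <= X3)%VS, \dim (H :&: X0) == h0, \dim (H :&: X1) == h1,
       \dim (H :&: X2) == h2 & \dim H == h3]]| =
  (chainpoly (\dim I) (\dim X0) (\dim X1) (\dim X2) (\dim X3) h0 h1 h2 h3).[Q].
Proof.
move=> sI0 s01 s12 s23; rewrite /chainpoly !horner_muln.
pose P0 Y := (I <= Y)%VS.
pose P1 Y := P0 (Y :&: I)%VS && (\dim (Y :&: I) == \dim I).
pose P2 Y := P1 (Y :&: X0)%VS && (\dim (Y :&: X0) == h0).
pose P3 Y := P2 (Y :&: X1)%VS && (\dim (Y :&: X1) == h1).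
have -> : (extpoly (\dim X0) (\dim I) h0 (\dim I)).[Q] =
    #|[set H | [&& (H <= X0)%VS, P1 H & \dim H == h0]]|.
  transitivity (#|[set H | [&& (H <= I)%VS, P0 H & \dim H == \dim I]]| *
     (extpoly (\dim X0) (\dim I) h0 (\dim I)).[Q])%N; last first.
    by rewrite -card_ext_pred //; apply: eq_card => H; rewrite !inE /P1 !andbA.
  rewrite (_ : #|_| = 1%N) ?mul1n //; rewrite -[RHS](cards1 I); apply: eq_card => H; rewrite !inE /P0.
  apply/and3P/eqP => [[HI IH _]|->]; last by rewrite subvv eqxx.
  by apply/eqP; rewrite eqEsubv HI IH.
rewrite -[X in (X * _ * _)%N](_ : #|[set H | [&& (H <= X1)%VS, P2 H & \dim H == h1]]| = _); last first.
  rewrite -card_ext_pred //; apply: eq_card => H.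
  by rewrite !inE /P2 !andbA.
rewrite -[X in (X * _)%N](_ : #|[set H | [&& (H <= X2)%VS, P3 H & \dim H == h2]]| = _); last first.
  rewrite -card_ext_pred //; apply: eq_card => H.
  by rewrite !inE /P3 !andbA.
rewrite -card_ext_pred //; apply: eq_card => H; rewrite !inE.
have sI1 := subv_trans sI0 s01; have s02 := subv_trans s01 s12.
rewrite /P3 /P2 /P1 /P0 -!capvA.
rewrite !(capv_idPr sI0, capv_idPr sI1, capv_idPr (subv_trans sI1 s12)).
rewrite !(capv_idPr s01, capv_idPr s02, capv_idPr s12).
rewrite subv_cap subvv andbT; apply/idP/idP => [/and5P[IH -> -> ->]|].
  by move=> /andP[-> ->]; rewrite IH (capv_idPr IH) eqxx.
by move=> /and4P[-> /andP[/andP[/andP[-> _] ->] ->] -> ->].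
Qed.

End SubspaceCounting.

Definition psum (f : nat -> nat) (i : nat) : nat := (\sum_(l < i) f l)%N.

Lemma psumS f i : psum f i.+1 = (psum f i + f i)%N.
Proof. by rewrite /psum big_ord_recr. Qed.

Lemma forall_ord_recr n (P : pred 'I_n.+1) :
  [forall j, P j] = [forall j : 'I_n, P (widen_ord (leqnSn n) j)] && P ord_max.
Proof.
apply/forallP/andP => [allP|[/forallP allP Pmax] j].
  by split=> //; apply/forallP.
have [j' ->|->] := unliftP ord_max j => //.
by have := allP j'; congr P; apply/val_inj; rewrite /= /bump leqNgt ltn_ord.
Qed.

Section FlagCounting.
Variables (F : finFieldType) (m : nat).
Local Notation V := 'rV[F]_m.
Local Notation Q := #|F|.
Variables (t : 'End(V)) (R W N : {vspace V}) (d r w n : nat -> nat).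

Definition flag_step (j : nat) (Y Z : {vspace V}) : bool :=
  [&& (Y <= Z)%VS, \dim Z == (\dim Y + d j)%N, (t @: Z <= Y)%VS,
      (\dim (W :&: Z) - \dim (W :&: Y))%N == w j,
      (\dim (R :&: Z) - \dim (R :&: Y))%N == r j &
      (\dim (N :&: Z) - \dim (N :&: Y))%N == n j].

Definition is_flag (i : nat) (U : {vspace V}) (fl : {ffun 'I_i.+1 -> {vspace V}}) : bool :=
  [&& fl ord0 == 0%VS, fl ord_max == U &
      [forall j : 'I_i, flag_step j (fl (widen_ord (leqnSn i) j)) (fl (lift ord0 j))]].

(** Factor j counts the possible steps j below a given step j + 1. By rank-nullity,
    [psum d j.+1 - psum n j.+1] is the dimension of the image under t of the latter. *)
Definition flagpoly (i : nat) : {poly nat} :=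
  \prod_(j < i) chainpoly (psum d j.+1 - psum n j.+1)
    (psum r j.+1) (psum w j.+1) (psum n j.+1) (psum d j.+1)
    (psum r j) (psum w j) (psum n j) (psum d j).

Definition flag_rcons i (U : {vspace V}) (fl : {ffun 'I_i.+1 -> {vspace V}}) :
    {ffun 'I_i.+2 -> {vspace V}} :=
  [ffun j => if unlift ord_max j is Some j' then fl j' else U].

Lemma flag_rcons_lift i U (fl : {ffun 'I_i.+1 -> {vspace V}}) j :
  flag_rcons U fl (lift ord_max j) = fl j.
Proof. by rewrite ffunE liftK. Qed.

Lemma flag_rcons_max i U (fl : {ffun 'I_i.+1 -> {vspace V}}) :
  flag_rcons U fl ord_max = U.
Proof. by rewrite ffunE unlift_none. Qed.

Lemma is_flag_rcons i U (fl : {ffun 'I_i.+1 -> {vspace V}}) :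
  is_flag U (flag_rcons U fl) = is_flag (fl ord_max) fl && flag_step i (fl ord_max) U.
Proof.
have eL (x : 'I_i.+2) (y : 'I_i.+1) : x = y :> nat -> flag_rcons U fl x = fl y.
  move=> exy; rewrite -(flag_rcons_lift U fl y); congr (fun_of_fin _ _).
  by apply/val_inj; rewrite /= exy /bump leqNgt ltn_ord.
rewrite /is_flag forall_ord_recr flag_rcons_max !eqxx /= (eL _ ord0) // -!andbA.
congr (_ && _); congr andb.
  apply: eq_forallb => j; rewrite (eL _ (widen_ord (leqnSn i) j)) //.
  by rewrite (eL _ (lift ord0 j)).
rewrite (eL _ ord_max) //; congr flag_step.
transitivity (flag_rcons U fl ord_max); last exact: flag_rcons_max.
by congr (fun_of_fin _ _); apply/val_inj.
Qed.

Hypotheses (sRW : (R <= W)%VS) (sWN : (W <= N)%VS) (tR : (limg t <= R)%VS) (Nt : N = lker t).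

(** Induction from the top. The last proper step H of a flag in U must contain t(U) and meet U, W,
    im t and ker t in prescribed dimensions, so by [card_chain] the number of choices depends on
    dimensions only; what remains is a flag in H, which t preserves. *)
Lemma card_flags i U : (t @: U <= U)%VS -> \dim U = psum d i ->
  \dim (R :&: U) = psum r i -> \dim (W :&: U) = psum w i -> \dim (N :&: U) = psum n i ->
  #|[set fl : {ffun 'I_i.+1 -> {vspace V}} | is_flag U fl]| = (flagpoly i).[Q].
Proof.
elim: i U => [|i IH] U tU dU dR dW dN.
  rewrite /flagpoly big_ord0 hornerC; apply/eqP/cards1P; exists [ffun=> 0%VS].
  have U0 : U = 0%VS by apply/eqP; rewrite -dimv_eq0 dU /psum big_ord0.
  apply/setP => fl; rewrite !inE /is_flag U0; apply/and3P/eqP => [[/eqP f0 _ _]|->].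
    by apply/ffunP => j; rewrite ord1 f0 ffunE.
  by rewrite !ffunE !eqxx; split=> //; apply/forallP => -[].
rewrite /flagpoly big_ord_recr /= -/(flagpoly i) horner_muln.
pose S := [set H | [&& (t @: U <= H)%VS, (H <= U)%VS, \dim (H :&: (R :&: U)) == psum r i,
   \dim (H :&: (W :&: U)) == psum w i, \dim (H :&: (N :&: U)) == psum n i & \dim H == psum d i]].
have dtU : \dim (t @: U) = (psum d i.+1 - psum n i.+1)%N.
  by rewrite -dU -dN -(limg_ker_dim t U) Nt capvC addKn.
rewrite -dtU -dR -dW -dN -dU -card_chain; first last.
- exact: capvSr.
- exact: capvS.
- exact: capvS.
- by rewrite subv_cap tU andbT (subv_trans _ tR) // limgS // subvf.
have stepE H : flag_step i H U = (H \in S).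
  rewrite inE /flag_step andbCA; apply/idP/idP.
    case/and5P => dH HU tUH /eqP eW /andP[/eqP eR /eqP eN].
    rewrite tUH HU !capvA ![(H :&: _)%VS]capvC -!capvA (capv_idPl HU) /=.
    have lW := dimvS (capvS (subvv W) HU); have lR := dimvS (capvS (subvv R) HU).
    have lN := dimvS (capvS (subvv N) HU).
    have aux (a b c x : nat) : a = (b + x)%N -> (a - c = x)%N -> (c <= a)%N -> c = b by lia.
    move: dU dR dW dN dH; rewrite !psumS => dU dR dW dN /eqP dH.
    rewrite (aux _ _ _ _ dR eR lR) (aux _ _ _ _ dW eW lW) (aux _ _ _ _ dN eN lN) !eqxx /=.
    by rewrite -(eqn_add2r (d i)) -dU dH.
  case/and5P => tUH HU; rewrite !capvA ![(H :&: _)%VS]capvC -!capvA (capv_idPl HU).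
  move=> /eqP hR /eqP hW /andP[/eqP hN /eqP hd]; rewrite HU tUH.
  by rewrite dR dW dN dU hR hW hN hd !psumS !addKn !eqxx.
set A := [set fl : {ffun 'I_i.+2 -> {vspace V}} | is_flag U fl].
transitivity (\sum_(fl in A) 1)%N; first by rewrite sum1_card.
rewrite (partition_big (fun fl : {ffun 'I_i.+2 -> {vspace V}} =>
   fl (lift ord_max ord_max)) (fun H => H \in S)); last first.
  move=> fl; rewrite inE => /and3P[_ /eqP fU]; rewrite forall_ord_recr => /andP[_].
  rewrite -stepE.
  have -> : lift ord_max ord_max = widen_ord (leqnSn i.+1) ord_max.
    by apply/val_inj; rewrite /= /bump leqNgt ltnSn.
  by have -> : lift ord0 ord_max = ord_max :> 'I_i.+2; [apply/val_inj | rewrite fU].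
rewrite mulnC -sum_nat_const; apply: eq_bigr => H HS; rewrite sum1_card.
have := HS; rewrite inE !capvA ![(H :&: _)%VS]capvC -!capvA.
case/and5P => tUH HU; rewrite (capv_idPl HU) => /eqP hR /eqP hW /andP[/eqP hN /eqP hd].
rewrite -(IH H) //; last by rewrite (subv_trans _ tUH) // limgS.
have inj_rcons : injective (@flag_rcons i U).
  move=> f g efg; apply/ffunP => j.
  by rewrite -(flag_rcons_lift U f) -(flag_rcons_lift U g) efg.
pose B := [set fl : {ffun 'I_i.+1 -> {vspace V}} | is_flag H fl].
rewrite -[RHS]/#|B| -[RHS](card_imset (mem B) inj_rcons); apply: eq_card => fl.
rewrite -[LHS]/((fl \in A) && (fl (lift ord_max ord_max) == H)) inE.
apply/andP/imsetP => [[fF /eqP fH]|[fl' ]].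
  pose fl' := [ffun j => fl (lift ord_max j)].
  have flE : fl = flag_rcons U fl'.
    apply/ffunP => j; case: (unliftP ord_max j) => [j' ->|->].
      by rewrite flag_rcons_lift ffunE.
    by rewrite flag_rcons_max; case/and3P: fF => _ /eqP.
  exists fl'; last exact: flE.
  move: fF; rewrite flE is_flag_rcons inE => /andP[].
  by rewrite [fl' ord_max]ffunE fH.
rewrite inE => fF ->; rewrite is_flag_rcons flag_rcons_lift.
have fH : fl' ord_max = H by case/and3P: fF => _ /eqP.
by rewrite fH fF stepE HS eqxx.
Qed.

End FlagCounting.

(** * Coordinate subspaces and endomorphisms pairing coordinates *)

Section CoordinateSubspaces.
Variables (F : finFieldType) (m : nat).
Local Notation V := 'rV[F]_m.
Implicit Types (A B : {set 'I_m}) (S : {set 'I_m * 'I_m}).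

Definition cspan A : {vspace V} := <<[seq (delta_mx ord0 j : V) | j <- enum A]>>%VS.

Lemma mem_cspan A v : (v \in cspan A) = [forall (j | j \notin A), v 0 j == 0].
Proof.
apply/idP/forall_inP => [vA j jA|v0].
  have /subvP/(_ v vA) : (cspan A <= lker (linfun (mulmxr (delta_mx j ord0 : 'cV[F]_m))))%VS.
    apply/span_subvP => _ /mapP[l lA ->]; rewrite memv_ker lfunE /= mul_delta_mx_0 //.
    by apply: contraNneq jA => <-; rewrite mem_enum in lA.
  rewrite memv_ker lfunE /= -colE => /eqP/matrixP/(_ 0 0).
  by rewrite !mxE => ->.
rewrite (row_sum_delta v) (bigID (fun j => j \in A)) /=; apply: rpredD; apply: rpred_sum => j jA.
  by apply/rpredZ/memv_span/map_f; rewrite mem_enum.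
by rewrite (eqP (v0 j jA)) scale0r mem0v.
Qed.

Lemma cspanI A B : (cspan A :&: cspan B)%VS = cspan (A :&: B).
Proof.
apply/vspaceP => v; rewrite memv_cap !mem_cspan.
apply/andP/forall_inP => [[/forall_inP vA /forall_inP vB] j|vAB].
  by rewrite inE negb_and => /orP[/vA|/vB].
by split; apply/forall_inP => j jA; apply: vAB; rewrite inE (negPf jA) ?andbF.
Qed.

Lemma cspanT : cspan [set: 'I_m] = fullv.
Proof. by apply/vspaceP => v; rewrite memvf mem_cspan; apply/forall_inP => j; rewrite inE. Qed.

Lemma cspan0 : cspan finset.set0 = 0%VS.
Proof. by rewrite /cspan enum_set0 span_nil. Qed.

Lemma dim_rV : \dim {:V} = m.
Proof. by rewrite dimvf; exact: mul1n. Qed.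

Lemma dim_cspan A : \dim (cspan A) = #|A|.
Proof.
have leA B : (\dim (cspan B) <= #|B|)%N.
  by rewrite (leq_trans (dim_span _)) // size_map cardE.
have := leA (~: A)%SET; have := leA A; have := cardsC A; rewrite card_ord.
have eT : (cspan A + cspan (~: A)%SET)%VS = fullv.
  apply/vspaceP => v; rewrite memvf; rewrite (row_sum_delta v).
  apply: rpred_sum => j _; apply: rpredZ; case jA: (j \in A).
    by apply: (subvP (addvSl _ _)); apply/memv_span/map_f; rewrite mem_enum.
  by apply: (subvP (addvSr _ _)); apply/memv_span/map_f; rewrite mem_enum inE jA.
have := dimv_sum_cap (cspan A) (cspan (~: A)%SET); rewrite eT dim_rV.
rewrite cspanI finset.setICr cspan0 dimv0 => *; lia.
Qed.

Lemma cspanS A B : A \subset B -> (cspan A <= cspan B)%VS.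
Proof. by move=> /finset.setIidPl eA; rewrite -eA -cspanI capvSr. Qed.

(** Vectors are rows, so the basis vector j goes to the sum of the basis vectors c.1 over the c in S
    with c.2 = j. *)
Definition pairing_end S : 'End(V) :=
  linfun (mulmxr (\sum_(c in S) delta_mx c.2 c.1)).

Lemma pairing_endE S v a : pairing_end S v 0 a = \sum_(c in S | c.1 == a) v 0 c.2.
Proof.
rewrite /pairing_end lfunE /= mulmx_sumr summxE big_mkcondr; apply: eq_bigr => c _.
rewrite {1}(row_sum_delta v) mulmx_suml summxE (bigD1 c.2) //= -scalemxAl mul_delta_mx.
rewrite big1 => [|j jc]; last by rewrite -scalemxAl mul_delta_mx_0 // scaler0 mxE.
by rewrite !mxE addr0 eqxx eq_sym; case: eqP; rewrite ?mulr1 ?mulr0.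
Qed.

Section Pairing.
Variable S : {set 'I_m * 'I_m}.
Hypotheses (inj1 : {in S &, injective fst}) (inj2 : {in S &, injective snd}).

Lemma lker_pairing : lker (pairing_end S) = cspan (~: [set c.2 | c in S])%SET.
Proof.
apply/vspaceP => v; rewrite memv_ker mem_cspan.
apply/eqP/forall_inP => [tv0 j|v0].
  rewrite inE negbK => /imsetP[c cS ->]; have /matrixP/(_ 0 c.1) := tv0.
  rewrite mxE pairing_endE (bigD1 c) ?cS ?eqxx //= big1 ?addr0 => [->//|c'].
  by case/andP=> /andP[c'S /eqP e]; rewrite (inj1 c'S cS e) eqxx.
apply/rowP => a; rewrite mxE pairing_endE big1 // => c /andP[cS _]; apply/eqP/v0.
by rewrite inE negbK; apply: imset_f.
Qed.

(** One inclusion is direct, and rank-nullity with [lker_pairing] gives equal dimensions. *)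
Lemma limg_pairing : limg (pairing_end S) = cspan [set c.1 | c in S].
Proof.
apply/eqP; rewrite eqEdim; apply/andP; split.
  apply/subvP => _ /memv_imgP[u _ ->]; rewrite mem_cspan; apply/forall_inP => j jS.
  rewrite pairing_endE big_pred0 // => c; apply/negbTE; apply: contra jS => /andP[cS /eqP <-].
  exact: imset_f.
have := limg_ker_dim (pairing_end S) fullv.
rewrite capfv dim_rV lker_pairing !dim_cspan card_in_imset //.
have := cardsC [set c.2 | c in S]; rewrite card_ord card_in_imset //.
by move=> e1; rewrite -[X in _ = X]e1 [RHS]addnC => /addnI->.
Qed.

Lemma pairing_img (A B : {set 'I_m}) : (forall c, c \in S -> c.2 \in A -> c.1 \in B) ->
  (pairing_end S @: cspan A <= cspan B)%VS.
Proof.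
move=> SAB; apply/subvP => _ /memv_imgP[u uA ->].
rewrite mem_cspan; apply/forall_inP => j jB; rewrite pairing_endE big1 // => c /andP[cS /eqP cj].
move: uA; rewrite mem_cspan => /forall_inP uA; apply/eqP/uA; apply: contra jB => cA.
by rewrite -cj SAB.
Qed.

End Pairing.
End CoordinateSubspaces.

(** * Polynomial point counts *)

Section PolynomialCounts.
Variable C : numFieldType.
Local Notation K := C`(q).

(** Counts stay in [{poly nat}], where positivity is available; only here do they enter C(q), with
    |F| replaced by q^2. *)
Definition evq (P : {poly nat}) : K := (map_poly (fun n : nat => n%:R) P).[qq C ^+ 2].

Lemma evqD P R : evq (P + R) = evq P + evq R.
Proof. by rewrite /evq rmorphD hornerD. Qed.

Lemma evqM P R : evq (P * R) = evq P * evq R.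
Proof. by rewrite /evq rmorphM hornerM. Qed.

Lemma evq0 : evq 0 = 0.
Proof. by rewrite /evq rmorph0 horner0. Qed.

Lemma evq_Xn n : evq 'X^n = qq C ^+ (2 * n).
Proof. by rewrite /evq map_polyXn hornerXn exprM. Qed.

Lemma evq_sum (I : Type) (s : seq I) (P : pred I) f :
  evq (\sum_(i <- s | P i) f i) = \sum_(i <- s | P i) evq (f i).
Proof. by rewrite /evq rmorph_sum horner_sum. Qed.

Lemma evqE P : evq P = tofrac (map_poly (fun n : nat => n%:R) P \Po 'X^2).
Proof.
elim/poly_ind: P => [|P c IH]; first by rewrite evq0 rmorph0 comp_poly0 tofrac0.
rewrite evqD evqM IH /evq map_polyX hornerX map_polyC hornerC /=.
rewrite rmorphD rmorphM /= map_polyX map_polyC /= comp_poly_MXaddC.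
by rewrite tofracD tofracM tofracXn polyC_natr rmorph_nat.
Qed.

Lemma evq_eq0 P : (evq P == 0) = (P == 0).
Proof.
rewrite evqE tofrac_eq0 comp_poly_eq0 ?size_polyXn //.
case: (eqVneq P 0) => [->|P0]; first by rewrite rmorph0 eqxx.
by rewrite map_poly_eq0_id0 ?(negPf P0) // Num.Theory.pnatr_eq0 lead_coef_eq0.
Qed.

(** The leading term is already positive. This is what carries non-emptiness from one finite field
    to another. *)
Lemma horner_nat_gt0 (P : {poly nat}) x : P != 0 -> (0 < x)%N -> (0 < P.[x])%N.
Proof.
rewrite -lead_coef_eq0 => P0 x0; rewrite horner_coef.
have sP : (0 < size P)%N by rewrite lt0n size_poly_eq0 -lead_coef_eq0.
rewrite -(prednK sP) big_ord_recr /= -[(_ + _)%R]/(_ + _)%N -[(_ * _)%R]/(_ * _)%N.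
by rewrite addn_gt0 muln_gt0 [X in _ || (X && _)]lt0n [X in X && _]P0 natrXE expn_gt0 x0 orbT.
Qed.

(** There are infinitely many primes, and each prime is the size of a field; the natural numbers are
    distinct in C since its characteristic is 0. *)
Lemma poly_eq_primes (P R : {poly C}) :
  (forall l, prime l -> P.[l%:R] = R.[l%:R]) -> P = R.
Proof.
move=> eqPR; apply/eqP; rewrite -subr_eq0; apply/negPn/negP => PR0.
have [s [us ps ss]] : exists s : seq nat, [/\ uniq s, all prime s & size s = size (P - R)].
  elim: (size (P - R)) => [|n [s [us ps <-]]]; first by exists [::].
  have [p ltp pp] := prime_above (\max_(i <- s) i).
  exists (p :: s); rewrite /= us ps pp andbT; split=> //.
  by apply/negP => pS; have := @leq_bigmax_seq _ s xpredT id p pS isT; rewrite leqNgt ltp.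
have := max_poly_roots (rs := [seq x%:R | x <- s]) PR0.
rewrite size_map ss ltnn => nroots; suff: false by []; apply: nroots.
  apply/allP => _ /mapP[l ls ->]; rewrite rootE hornerD hornerN eqPR ?subrr //.
  exact: (allP ps).
by rewrite map_inj_uniq // => x y /eqP; rewrite Num.Theory.eqr_nat => /eqP.
Qed.

Lemma horner_natC (P : {poly nat}) x :
  (map_poly (fun n : nat => n%:R) P).[x%:R] = P.[x]%:R :> C.
Proof. by rewrite (horner_map (GRing.natmul 1)). Qed.

Lemma nat_poly_eq_primes (P R : {poly nat}) :
  (forall l, prime l -> P.[l] = R.[l]) -> P = R.
Proof.
move=> eqPR; apply: (@map_inj_poly nat C (fun n => n%:R)) => //.
  by move=> x y /eqP; rewrite Num.Theory.eqr_nat => /eqP.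
by apply: poly_eq_primes => l pl; rewrite !horner_natC eqPR.
Qed.

End PolynomialCounts.

(** * Types of points and their occurrence over all finite fields *)

Section Points.
Variables (k : nat) (d : 'I_k -> nat).

Definition ext0 (f : 'I_k -> nat) (j : nat) : nat := oapp f 0%N (insub j).

Lemma ext0E f (i : 'I_k) : ext0 f i = f i.
Proof. by rewrite /ext0 valK. Qed.

Lemma psum_ext0 f : psum (ext0 f) k = (\sum_i f i)%N.
Proof. by apply: eq_bigr => i _; rewrite ext0E. Qed.

Lemma psum_ord f (i : 'I_k) : psum (ext0 f) i = (\sum_(j : 'I_k | (j < i)%N) f j)%N.
Proof.
rewrite /psum (big_ord_widen k (ext0 f)) 1?ltnW //.
by apply: eq_bigr => j _; rewrite ext0E.
Qed.

Section OnePoint.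
Variable F : finFieldType.
Implicit Types (p x : tvar d F) (X Y U : {vspace dspace d F}).

Lemma val_tvar p : val p = (flag p, sub p, nil_end p).
Proof. by rewrite /flag /sub /nil_end; case: (val p) => [[]]. Qed.

Lemma tvarP p : [/\ flag p ord0 = 0%VS, flag p ord_max = fullv,
  forall i : 'I_k, [/\ (flag p (lo i) <= flag p (hi i))%VS,
     \dim (flag p (hi i)) = (\dim (flag p (lo i)) + d i)%N &
     (nil_end p @: flag p (hi i) <= flag p (lo i))%VS] &
  (imag p <= sub p)%VS /\ (sub p <= kern p)%VS].
Proof.
have := valP p; rewrite val_tvar => /and4P[/eqP-> /eqP-> /forallP fl /andP[tW Wt]].
by split=> // i; have /and3P[? /eqP ? ?] := fl i.
Qed.

Lemma tvar_inj p x : flag p = flag x -> sub p = sub x -> nil_end p = nil_end x -> p = x.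
Proof. by move=> ef es et; apply/val_inj; rewrite !val_tvar ef es et. Qed.

Definition lev p (j : nat) : {vspace dspace d F} := flag p (inord j).

Lemma lev_lo p (i : 'I_k) : flag p (lo i) = lev p i.
Proof. by congr (flag p _); apply/val_inj; rewrite /= inordK // ltnS ltnW. Qed.

Lemma lev_hi p (i : 'I_k) : flag p (hi i) = lev p i.+1.
Proof. by congr (flag p _); apply/val_inj; rewrite /= inordK // ltnS. Qed.

Lemma lev0 p : lev p 0 = 0%VS.
Proof.
have [<- _ _ _] := tvarP p; congr (flag p _); apply/val_inj.
by rewrite /= inordK.
Qed.

Lemma lev_full p : lev p k = fullv.
Proof.
have [_ <- _ _] := tvarP p; congr (flag p _); apply/val_inj.
by rewrite /= inordK.
Qed.

Lemma levS p j : (j < k)%N -> (lev p j <= lev p j.+1)%VS.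
Proof.
move=> jk; have [_ _ /(_ (Ordinal jk))[+ _ _] _] := tvarP p.
by rewrite lev_lo lev_hi.
Qed.

Lemma lev_mono p i j : (i <= j <= k)%N -> (lev p i <= lev p j)%VS.
Proof.
case/andP=> /subnKC <-; elim: (j - i)%N => [|n IH]; rewrite ?addn0 // addnS => jk.
exact: subv_trans (IH (ltnW jk)) (levS _ jk).
Qed.

Lemma nil_lev p j : (j < k)%N -> (nil_end p @: lev p j.+1 <= lev p j)%VS.
Proof.
move=> jk; have [_ _ /(_ (Ordinal jk))[_ _ +] _] := tvarP p.
by rewrite lev_lo lev_hi.
Qed.

Lemma alphaE X p i : alpha X (flag p) i = (\dim (X :&: lev p i.+1) - \dim (X :&: lev p i))%N.
Proof. by rewrite /alpha lev_lo lev_hi. Qed.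

Lemma dim_cap_levS X p (i : 'I_k) :
  \dim (X :&: lev p i.+1) = (\dim (X :&: lev p i) + alpha X (flag p) i)%N.
Proof. by rewrite alphaE subnKC // dimvS // capvS // levS. Qed.

Lemma dim_cap_lev X p j : (j <= k)%N ->
  \dim (X :&: lev p j) = psum (ext0 (alpha X (flag p))) j.
Proof.
elim: j => [|j IH] jk; first by rewrite lev0 capv0 dimv0 /psum big_ord0.
rewrite psumS -IH ?(ltnW jk) // (dim_cap_levS X p (Ordinal jk)).
by rewrite -(ext0E (alpha X (flag p))).
Qed.

Lemma sum_alpha X p : (\sum_i alpha X (flag p) i)%N = \dim X.
Proof. by rewrite -psum_ext0 -dim_cap_lev // lev_full capvf. Qed.

Lemma dim_lev p j : (j <= k)%N -> \dim (lev p j) = psum (ext0 d) j.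
Proof.
elim: j => [|j IH] jk; first by rewrite lev0 dimv0 /psum big_ord0.
rewrite psumS -IH ?(ltnW jk) //; have [_ _ /(_ (Ordinal jk))[_ + _] _] := tvarP p.
by rewrite lev_lo lev_hi => ->; rewrite -(ext0E d (Ordinal jk)).
Qed.

Lemma alpha_full p i : alpha fullv (flag p) i = d i.
Proof.
have [_ _ /(_ i)[_ + _] _] := tvarP p; rewrite alphaE !capfv lev_lo lev_hi => ->.
by rewrite addKn.
Qed.

(** The i-th subquotient of X embeds into that of Y, since the part of X in step i + 1 meets the
    part of Y in step i exactly in the part of X in step i. *)
Lemma alphaS X Y p i : (X <= Y)%VS -> (alpha X (flag p) i <= alpha Y (flag p) i)%N.
Proof.
move=> sXY; have := dim_cap_levS X p i; have := dim_cap_levS Y p i.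
have := dimv_sum_cap (X :&: lev p i.+1) (Y :&: lev p i).
have -> : (X :&: lev p i.+1 :&: (Y :&: lev p i) = X :&: lev p i)%VS.
  rewrite -capvA (capvC (lev p i.+1)) -capvA (capv_idPl (levS p (ltn_ord i))).
  by rewrite capvA (capv_idPl sXY).
have : (\dim (X :&: lev p i.+1 + Y :&: lev p i) <= \dim (Y :&: lev p i.+1))%N.
  by rewrite dimvS // subv_add !capvS // levS.
by move=> le1 e1 e2 e3; rewrite e2 e3 in le1 e1; lia.
Qed.

Lemma inAP w r n p : reflect
  [/\ alpha (sub p) (flag p) =1 w, alpha (imag p) (flag p) =1 r & alpha (kern p) (flag p) =1 n]
  (inA w r n p).
Proof.
apply: (iffP forallP) => [h|[h1 h2 h3] i]; last by rewrite h1 h2 h3 !eqxx.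
by split=> i; have /and3P[/eqP h1 /eqP h2 /eqP h3] := h i.
Qed.

Lemma inA_self p : inA (alpha (sub p) (flag p)) (alpha (imag p) (flag p)) (alpha (kern p) (flag p)) p.
Proof. by apply/inAP. Qed.

Lemma rank_nullity p : (\dim (imag p) + \dim (kern p) = \sum_i d i)%N.
Proof.
have := limg_ker_dim (nil_end p) fullv; rewrite capfv addnC => ->.
by rewrite -(lev_full p) dim_lev // psum_ext0.
Qed.

Lemma is_flagE (t : 'End(dspace d F)) W (r w n : 'I_k -> nat) fl :
  (limg t <= W)%VS -> (W <= lker t)%VS ->
  is_flag t (limg t) W (lker t) (ext0 d) (ext0 r) (ext0 w) (ext0 n) (i := k) fullv fl =
  in_tvar (fl, W, t) && [forall i, [&& alpha W fl i == w i, alpha (limg t) fl i == r i &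
    alpha (lker t) fl i == n i]].
Proof.
move=> tW Wt; rewrite /in_tvar tW Wt /= andbT /is_flag -!andbA; do 2 congr (_ && _).
apply/forallP/andP => [h|[/forallP h1 /forallP h2] i].
  split; apply/forallP => i; have := h i; rewrite /flag_step !ext0E.
    by case/and5P=> h1 h2 h3 _ _; apply/and3P.
  by case/and5P=> _ _ _ h1 /andP[h2 h3]; apply/and3P.
have /and3P[e1 e2 e3] := h1 i; have /and3P[e4 e5 e6] := h2 i.
by rewrite /flag_step !ext0E; apply/and5P; split; rewrite ?e5.
Qed.

End OnePoint.

Lemma same_typeP (F F' : finFieldType) (x : tvar d F) (y : tvar d F') : reflect
  [/\ alpha (sub x) (flag x) =1 alpha (sub y) (flag y),
      alpha (imag x) (flag x) =1 alpha (imag y) (flag y) &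
      alpha (kern x) (flag x) =1 alpha (kern y) (flag y)]
  (same_type x y).
Proof.
apply: (iffP forallP) => [h|[h1 h2 h3] i]; last by rewrite h1 h2 h3 !eqxx.
by split=> i; have /and3P[/eqP h1 /eqP h2 /eqP h3] := h i.
Qed.

(** B_p fixes W and t and varies the flag, so p enters only through dim W, the rank of t and the
    type of ker t; if these disagree with (w, r, n), there is no point to count. *)
Definition Bpoly (w0 r0 n0 w r n : 'I_k -> nat) : {poly nat} :=
  if [&& (\sum_i w0 i == \sum_i w i)%N, (\sum_i r0 i == \sum_i r i)%N & [forall i, n0 i == n i]]
  then flagpoly (ext0 d) (ext0 r) (ext0 w) (ext0 n) k else 0.

Lemma card_tvar_flags (F : finFieldType) (t : 'End(dspace d F)) W (r w n : 'I_k -> nat) :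
  (limg t <= W)%VS -> (W <= lker t)%VS -> \dim (limg t) = (\sum_i r i)%N ->
  \dim W = (\sum_i w i)%N -> \dim (lker t) = (\sum_i n i)%N ->
  #|[set x : tvar d F | [&& sub x == W, nil_end x == t & inA w r n x]]| =
  (flagpoly (ext0 d) (ext0 r) (ext0 w) (ext0 n) k).[#|F|].
Proof.
move=> tW Wt dt dW dk; rewrite -(@card_flags F _ t (limg t) W (lker t) _ _ _ _ tW Wt _ _ _ fullv);
  rewrite ?capvf ?psum_ext0 ?subvv ?subvf ?dim_rV //.
set S := [set x | _]; have inj : {in S &, injective (@flag k d F)}.
  move=> x y; rewrite !inE => /and3P[/eqP sx /eqP tx _] /and3P[/eqP sy /eqP ty _] exy.
  by apply: tvar_inj; rewrite // ?sx ?tx.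
rewrite -(card_in_imset inj); apply: eq_card => fl; rewrite [RHS]inE.
apply/imsetP/idP => [[x xS ->]|].
  move: xS; rewrite inE is_flagE // => /and3P[/eqP sx /eqP tx /inAP[h1 h2 h3]].
  rewrite -sx -tx -val_tvar (valP x); apply/forallP => i.
  by rewrite h1 h2 h3 !eqxx.
rewrite is_flagE // => /andP[fT flA].
exists (Sub (fl, W, t) fT); last by [].
by rewrite inE /sub /nil_end /= !eqxx; exact: flA.
Qed.

Lemma card_B (F : finFieldType) (p : tvar d F) (w r n : 'I_k -> nat) :
  #|[set x | B_rel p x && inA w r n x]| =
  (Bpoly (alpha (sub p) (flag p)) (alpha (imag p) (flag p)) (alpha (kern p) (flag p)) w r n).[#|F|].
Proof.
rewrite /Bpoly; case: ifPn => [/and3P[/eqP dw /eqP dr /forallP en]|nE].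
  have [_ _ _ [RW WN]] := tvarP p.
  rewrite -(@card_tvar_flags F (nil_end p) (sub p)) -?dw -?dr ?sum_alpha //; last first.
    by rewrite -(sum_alpha (kern p) p); apply: eq_bigr => i _; apply/eqP.
  apply: eq_card => x; rewrite !inE /B_rel -!andbA; congr [&& _, _ & _].
  case xA: (inA w r n x); rewrite ?andbF // andbT; apply/forallP => i.
  by have /inAP[_ _ ->] := xA; rewrite (eqP (en i)).
rewrite horner0; apply: eq_card0 => x; rewrite !inE; apply/negP.
case/andP=> /and3P[/eqP sx /eqP tx /forallP nx] /inAP[h1 h2 h3].
case/negP: nE; apply/and3P; split.
- by rewrite sum_alpha -sx -(sum_alpha _ x); apply/eqP/eq_bigr => i _; rewrite h1.
- by rewrite sum_alpha /imag -tx -(sum_alpha _ x); apply/eqP/eq_bigr => i _; rewrite -h2.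
- by apply/forallP => i; rewrite -(eqP (nx i)) h3.
Qed.

Lemma card_ord_lt m b : (b <= m)%N -> #|[set i : 'I_m | (i < b)%N]| = b.
Proof.
move=> bm; rewrite -sum1dep_card -[RHS]card_ord -sum1_card.
by rewrite (big_ord_widen_cond m xpredT (fun=> 1%N) bm) /=; apply: eq_bigl.
Qed.

Lemma exists_nil_end (F : finFieldType) (a b c : nat) : (a <= b)%N -> (b <= c)%N ->
  (a + c = dsum d)%N -> exists t : 'End(dspace d F), exists2 W : {vspace dspace d F},
    [/\ (limg t <= W)%VS & (W <= lker t)%VS] &
    [/\ \dim (limg t) = a, \dim W = b & \dim (lker t) = c].
Proof.
(* t moves the coordinate c + i to i. As a + c is the dimension of the space, im t and ker t are
   spanned by the first a and the first c coordinates, and W is taken to be the span of the first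
   b. *)
move=> ab bc ac; pose S := [set ij : 'I_(dsum d) * 'I_(dsum d) | ij.2 == (c + ij.1)%N :> nat].
have inj1 : {in S &, injective fst}.
  move=> [i j] [i' j']; rewrite !inE /= => /eqP e /eqP e' ei; congr (_, _) => //.
  by apply/val_inj; rewrite /= e e' ei.
have inj2 : {in S &, injective snd}.
  move=> [i j] [i' j']; rewrite !inE /= => /eqP e /eqP e' ei; congr (_, _) => //.
  by apply/val_inj/eqP; rewrite -(eqn_add2l c) /= -e -e' ei.
have S1 : [set ij.1 | ij in S] = [set i : 'I_(dsum d) | (i < a)%N].
  apply/setP => i; rewrite inE; apply/imsetP/idP => [[[i' j] + ->]|ia].
    rewrite inE /= => /eqP e; rewrite -(ltn_add2l c) -e [(c + a)%N]addnC ac; exact: ltn_ord.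
  have ji : (c + nat_of_ord i < dsum d)%N by rewrite addnC -[X in (_ < X)%N]ac ltn_add2r.
  by exists (i, Ordinal ji); rewrite ?inE.
have S2 : (~: [set ij.2 | ij in S])%SET = [set i : 'I_(dsum d) | (i < c)%N].
  apply/setP => j; rewrite !inE ltnNge; congr (~~ _).
  apply/imsetP/idP => [[[i j'] + ->]|cj].
    by rewrite inE /= => /eqP->; exact: leq_addr.
  have ij : (j - c < dsum d)%N by rewrite (leq_ltn_trans (leq_subr _ _)).
  by exists (Ordinal ij, j); rewrite ?inE //= subnKC.
have le_sub x y : (x <= y)%N -> [set i : 'I_(dsum d) | (i < x)%N] \subset [set i : 'I_(dsum d) | (i < y)%N].
  by move=> xy; apply/fintype.subsetP => i; rewrite !inE => /leq_trans; apply.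
exists (pairing_end F S), (cspan F [set i : 'I_(dsum d) | (i < b)%N]).
  by rewrite limg_pairing // lker_pairing // S1 S2 !cspanS ?le_sub.
rewrite limg_pairing // lker_pairing // S1 S2 !dim_cspan !card_ord_lt -?ac ?leq_addl ?leq_addr //.
exact: leq_trans bc (leq_addl _ _).
Qed.

(** Over F' take t' and W' with the same dimensions. The flags of the given type are counted by the
    same polynomial over both fields; it is nonzero because of p, hence positive at |F'|. *)
Lemma type_transfer (F F' : finFieldType) (p : tvar d F) :
  exists p' : tvar d F', same_type p p'.
Proof.
set w := alpha (sub p) (flag p); set r := alpha (imag p) (flag p); set n := alpha (kern p) (flag p).
have [_ _ _ [RW WN]] := tvarP p.
have [|||t' [W' [RW' WN'] [d1 d2 d3]]] :=
  @exists_nil_end F' (\dim (imag p)) (\dim (sub p)) (\dim (kern p)).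
- exact: dimvS.
- exact: dimvS.
- exact: rank_nullity.
have := @card_tvar_flags F (nil_end p) (sub p) r w n RW WN.
have := @card_tvar_flags F' t' W' r w n RW' WN'.
rewrite d1 d2 d3 !sum_alpha => /(_ erefl erefl erefl) c' /(_ erefl erefl erefl) c.
have P0 : flagpoly (ext0 d) (ext0 r) (ext0 w) (ext0 n) k != 0.
  apply/eqP => P0; move: c; rewrite P0 horner0 => /eqP; rewrite cards_eq0 => /eqP/setP/(_ p).
  by rewrite !inE !eqxx inA_self.
have := horner_nat_gt0 P0 (ltnW (card_gt1 F')); rewrite -c' card_gt0 => /set0Pn[p'].
rewrite inE => /and3P[_ _ /inAP[h1 h2 h3]]; exists p'; apply/same_typeP.
by split=> i; rewrite ?h1 ?h2 ?h3.
Qed.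

End Points.

Section Counts.
Variables (k : nat) (d : 'I_k -> nat).

(** Two candidates for the chosen polynomial agree at every prime l, because [type_transfer]
    provides a point of the type of p over the field with l elements. *)
Lemma chiE (C : numFieldType) (F : finFieldType) (X : corresp d) (p : tvar d F) w r n P :
  (forall (F' : finFieldType) (p' : tvar d F'), same_type p p' ->
     #|[set x : tvar d F' | X F' p' x && inA w r n x]| = P.[#|F'|]) ->
  chi C X p w r n = evq C P.
Proof.
move=> countP; rewrite /chi evqE; congr (tofrac (_ \Po _)).
apply: xget_unique => [F' p' pp'|R countR]; first by rewrite countP // horner_natC.
apply: poly_eq_primes => l pl; have [p' pp'] := type_transfer 'F_l p.
by have := countR _ _ pp'; rewrite countP // -horner_natC card_Fp.
Qed.

Section Neighbours.
Variable F : finFieldType.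
Implicit Types (p x : tvar d F) (U W : {vspace dspace d F}).

Lemma card_fiber p (P : pred {vspace dspace d F}) :
  #|[set x | [&& flag x == flag p, nil_end x == nil_end p & P (sub x)]]| =
  #|[set U | [&& (imag p <= U)%VS, (U <= kern p)%VS & P U]]|.
Proof.
set S := [set x | _]; have inj : {in S &, injective (@sub k d F)}.
  move=> x y; rewrite !inE => /and3P[/eqP sx /eqP tx _] /and3P[/eqP sy /eqP ty _] exy.
  by apply: tvar_inj; rewrite // ?sx ?tx.
rewrite -[LHS](card_in_imset inj); apply: eq_card => U; rewrite [RHS]inE.
apply/imsetP/and3P => [[x + ->]|[RU UN PU]].
  rewrite inE => /and3P[_ /eqP tx Px]; have [_ _ _ [RW WN]] := tvarP x.
  by rewrite /imag /kern -tx.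
have xT : in_tvar (flag p, U, nil_end p).
  have := valP p; rewrite val_tvar => /and4P[h1 h2 h3 _].
  by apply/and4P; split=> //; rewrite RU.
exists (Sub (flag p, U, nil_end p) xT); last by [].
by rewrite inE /flag /nil_end /sub /= !eqxx.
Qed.

(** U meets step j in more than W does exactly when U = W + <v> for some v in ker t and in step
    j. *)
Lemma dim_up_lev p U j : (j <= k)%N -> (sub p <= U)%VS -> (U <= kern p)%VS ->
  \dim U = (\dim (sub p)).+1 ->
  \dim (U :&: lev p j) =
  (\dim (sub p :&: lev p j) + (U <= sub p + (kern p :&: lev p j))%VS)%N.
Proof.
move=> jk WU UN dU; set W := sub p in WU dU *; set L := lev p j.
case: (boolP (U <= _)%VS) => UWL /=.
  have [u uU uW] : exists2 u, u \in U & u \notin W.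
    by apply/subvPn; apply/negP => /dimvS; rewrite dU ltnn.
  have /memv_addP[w wW [v]] := subvP UWL u uU; rewrite memv_cap => /andP[vN vL] euv.
  have vU : v \in U.
    have -> : v = u - w by rewrite euv addrAC subrr add0r.
    by rewrite rpredB // (subvP WU).
  have vW : v \notin W by apply: contra uW => vW; rewrite euv rpredD.
  have capW : (U :&: L :&: W = W :&: L)%VS.
    by rewrite capvC capvA (capv_idPl WU).
  have := dimv_sum_cap (U :&: L) W; rewrite capW.
  have : (\dim (U :&: L + W) <= (\dim W).+1)%N.
    by rewrite -dU dimvS // subv_add capvSl.
  have : (\dim W < \dim (U :&: L + W))%N.
    rewrite ltn_neqAle dimvS ?addvSr // andbT; apply: contra vW => /eqP e.
    have /eqP-> : W == (U :&: L + W)%VS by rewrite eqEdim addvSr e leqnn.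
    by apply: (subvP (addvSl _ _)); rewrite memv_cap vU.
  by move=> l1 l2 e; rewrite addn1; lia.
rewrite addn0; congr (\dim _); apply/eqP; rewrite eqEsubv; apply/andP; split; last by rewrite capvS.
rewrite subv_cap capvSr andbT.
apply: contraR UWL => /subvPn[v]; rewrite memv_cap => /andP[vU vL] vW.
have -> : U = (W + <[v]>)%VS.
  by apply/eqP; rewrite eq_sym eqEdim subv_add WU -memvE vU dim_addv_line // dU leqnn.
by rewrite addvS // -memvE memv_cap vL (subvP UN).
Qed.

(** The hyperplane U of W either contains the part of W in step j or cuts its dimension by one. *)
Lemma dim_down_lev p U j : (U <= sub p)%VS -> (\dim U).+1 = \dim (sub p) ->
  \dim (sub p :&: lev p j) = (\dim (U :&: lev p j) + ~~ (sub p :&: lev p j <= U)%VS)%N.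
Proof.
set W := sub p; set L := lev p j => UW dU; case: (boolP (W :&: L <= U)%VS) => WLU /=; rewrite ?addn0.
  congr (\dim _); apply/eqP; rewrite eqEsubv; apply/andP; split; last by rewrite capvS.
  by rewrite subv_cap WLU capvSr.
have capU : (W :&: L :&: U = U :&: L)%VS.
  by rewrite capvC capvA (capv_idPl UW).
have := dimv_sum_cap (W :&: L) U; rewrite capU.
have : (\dim (W :&: L + U) <= (\dim U).+1)%N.
  by rewrite dU dimvS // subv_add capvSl.
have : (\dim U < \dim (W :&: L + U))%N.
  rewrite ltn_neqAle dimvS ?addvSr // andbT; apply: contra WLU => /eqP e.
  by have /eqP-> : U == (W :&: L + U)%VS; rewrite ?addvSl // eqEdim addvSr e leqnn.
by move=> l1 l2 e; rewrite addn1; lia.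
Qed.

End Neighbours.

End Counts.

(** * The action on functions *)

Notation aW p := (alpha (sub p) (flag p)).
Notation aR p := (alpha (imag p) (flag p)).
Notation aN p := (alpha (kern p) (flag p)).

Definition gsumX (a : nat) : {poly nat} := \sum_(l < a) 'X^l.

Lemma horner_gsumX a x : (gsumX a).[x] = gsum x a.
Proof.
rewrite /gsumX /gsum horner_sum -[RHS]/(\sum_(l < a) x ^ l)%N.
by apply: eq_bigr => l _; exact: horner_Xnn.
Qed.

(** A monotone sequence of truth values jumps at most once. This assigns to every neighbour of p the
    single box in which its type differs from that of p. *)
Lemma nat_sum_telescope n (b : nat -> bool) : (forall j, (j < n)%N -> b j ==> b j.+1) ->
  (\sum_(i < n) (b i.+1 && ~~ b i) + b 0 = b n)%N.
Proof.
elim: n => [|n IH] bS; first by rewrite big_ord0.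
rewrite big_ord_recr /= addnAC IH => [|j jn]; last by apply: bS; exact: ltnW.
by have := bS n (ltnSn n); case: (b n); case: (b n.+1).
Qed.

(** * Counting the neighbours of W in the correspondences of E and F *)

Section Neighbours.
Variables (k : nat) (d : 'I_k -> nat).

(** The type grows in box i when the line U/W lies in the image of the part of ker t in step i + 1,
    but not of that in step i; the summand counts these lines by [card_line_ext]. *)
Definition Epoly (w0 r0 n0 w r n : 'I_k -> nat) : {poly nat} :=
  \sum_(i < k) if [forall j, [&& w j == (w0 j + (j == i))%N, r j == r0 j & n j == n0 j]]
    then 'X^(psum (ext0 n0) i - psum (ext0 w0) i) * gsumX (n0 i - w0 i) else 0.

(** The type drops in box i when U contains im t and the part of W in step i, but not the part of W
    in step i + 1; the summand counts these hyperplanes of W by [card_hyperplanesD]. *)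
Definition Fpoly (w0 r0 n0 w r n : 'I_k -> nat) : {poly nat} :=
  \sum_(i < k) if [forall j, [&& (w j + (j == i))%N == w0 j, r j == r0 j & n j == n0 j]]
    then 'X^((psum (ext0 w0) k - psum (ext0 w0) i.+1) - (psum (ext0 r0) k - psum (ext0 r0) i.+1))
       * gsumX (w0 i - r0 i) else 0.

Variable F : finFieldType.
Implicit Types (p x : tvar d F) (U W : {vspace dspace d F}).

Lemma card_split_jump (S : {set tvar d F}) (J : 'I_k -> pred (tvar d F)) :
  (forall x, x \in S -> (\sum_i J i x)%N = 1%N) ->
  #|S| = (\sum_(i < k) #|[set x in S | J i x]|)%N.
Proof.
move=> J1; rewrite -sum1_card; transitivity (\sum_(x in S) \sum_i J i x)%N.
  by apply: eq_bigr => x /J1->.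
rewrite exchange_big /=; apply: eq_bigr => i _; rewrite -sum1_card big_mkcond /= [RHS]big_mkcond /=.
by apply: eq_bigr => x _; rewrite inE; case: (x \in S).
Qed.

Lemma psum_alpha (X : {vspace dspace d F}) p j : (j <= k)%N -> psum (ext0 (alpha X (flag p))) j = \dim (X :&: lev p j).
Proof. by move=> jk; rewrite dim_cap_lev. Qed.

Lemma dim_sub_add_lev p (X Y : {vspace dspace d F}) j : (X <= Y)%VS ->
  (\dim (X + (Y :&: lev p j)) + \dim (X :&: lev p j) = \dim X + \dim (Y :&: lev p j))%N.
Proof.
move=> XY; rewrite -(dimv_sum_cap X) capvA (capv_idPl XY); congr (_ + _)%N.
Qed.

Lemma card_E p w r n :
  #|[set x | E_rel p x && inA w r n x]| = (Epoly (aW p) (aR p) (aN p) w r n).[#|F|].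
Proof.
have [_ _ _ [RW WN]] := tvarP p.
pose b U j := (U <= sub p + (kern p :&: lev p j))%VS.
pose J (i : 'I_k) x := b (sub x) i.+1 && ~~ b (sub x) i.
have bS U j : (j < k)%N -> b U j ==> b U j.+1.
  by move=> jk; apply/implyP => /subv_trans; apply; rewrite addvS // capvS // levS.
rewrite (@card_split_jump _ J) => [|x]; last first.
  rewrite inE => /andP[/and4P[/eqP fx /eqP tx Wx /eqP dx] _].
  have := @nat_sum_telescope k (b (sub x)) (bS _).
  have [_ _ _ [_ xN]] := tvarP x.
  have -> : b (sub x) 0 = false.
    by rewrite /b lev0 capv0 addv0; apply/negP => /dimvS; rewrite dx ltnn.
  rewrite addn0 => ->; rewrite /b lev_full capvf.
  by rewrite (subv_trans _ (addvSr _ _)) // /kern -tx.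
rewrite /Epoly horner_sum -[RHS]/(\sum_(i < k) _)%N; apply: eq_bigr => i _.
pose PU U := [&& (sub p <= U)%VS, \dim U == (\dim (sub p)).+1, b U i.+1 & ~~ b U i].
have alphax x : [&& flag x == flag p, nil_end x == nil_end p & PU (sub x)] ->
    inA w r n x = [forall j, [&& w j == (aW p j + (j == i))%N, r j == aR p j & n j == aN p j]].
  case/and3P=> /eqP fx /eqP tx /and4P[Wx /eqP dx b1 b0].
  apply: eq_forallb => j; rewrite /imag /kern fx tx [_ == r j]eq_sym [_ == n j]eq_sym.
  rewrite [_ == w j]eq_sym. congr andb; congr eq_op.
  have [_ _ _ [_ xN]] := tvarP x; have xN' : (sub x <= kern p)%VS by rewrite /kern -tx.
  rewrite !alphaE !(@dim_up_lev k d F p (sub x)) ?(ltnW (ltn_ord j)) //.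
  rewrite -/(b (sub x) j) -/(b (sub x) j.+1).
  have -> : b (sub x) j.+1 = (b (sub x) j || (j == i)).
    case: (ltngtP j i) => [ji|ij|/val_inj ->]; last by rewrite b1 eqxx orbT.
      have bj l : (l <= i)%N -> b (sub x) l = false.
        move=> li; apply: contraNF b0 => /subv_trans; apply.
        by rewrite addvS // capvS // lev_mono // li ltnW.
      by rewrite !bj // 1?ltnW // -val_eqE /= ltn_eqF.
    have bj l : (i < l)%N -> (l <= k)%N -> b (sub x) l.
      move=> il lk; apply: subv_trans b1 _.
      by rewrite addvS // capvS // lev_mono // il.
    by rewrite !bj // 1?ltnW // ltnW.
  have := dimvS (capvS (subvv (sub p)) (levS p (ltn_ord j))).
  case: (eqVneq j i) => [->|ji]; first by rewrite (negPf b0) /=; lia.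
  by rewrite orbF addn0; lia.
rewrite [LHS](_ : _ = #|[set x | [&& flag x == flag p, nil_end x == nil_end p & PU (sub x)] &&
    [forall j, [&& w j == (aW p j + (j == i))%N, r j == aR p j & n j == aN p j]]]|); last first.
  apply: eq_card => x; rewrite !inE.
  case xP: [&& flag x == flag p, nil_end x == nil_end p & PU (sub x)].
    rewrite -(alphax x xP) /=; case/and3P: xP => fx tx /and4P[Wx dx b1 b0].
    by rewrite /E_rel fx tx Wx dx /J b1 b0 /= andbT.
  apply: contraFF xP => /andP[/andP[/and4P[-> -> h1 h2] _] /andP[b1 b0]].
  by rewrite /PU h1 h2 b1.
case: ifP => [cond|_]; last first.
  by rewrite horner0; apply: eq_card0 => x; rewrite inE andbF.
rewrite [LHS](_ : _ = #|[set x | [&& flag x == flag p, nil_end x == nil_end p & PU (sub x)]]|); last first.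
  by apply: eq_card => x; rewrite !inE andbT.
rewrite card_fiber horner_muln horner_Xnn horner_gsumX.
have sZX : (sub p + (kern p :&: lev p i) <= sub p + (kern p :&: lev p i.+1))%VS.
  by rewrite addvS // capvS // levS.
have := card_line_ext (addvSl (sub p) (kern p :&: lev p i)) sZX.
have eZ := dim_sub_add_lev p i WN; have eX := dim_sub_add_lev p i.+1 WN.
have lZ := dimvS (capvS WN (subvv (lev p i))).
rewrite !psum_alpha 1?ltnW //.
have -> : (\dim (sub p + (kern p :&: lev p i)) - \dim (sub p) =
   \dim (kern p :&: lev p i) - \dim (sub p :&: lev p i))%N by lia.
have -> : (\dim (sub p + (kern p :&: lev p i.+1)) - \dim (sub p + (kern p :&: lev p i)) =
   aN p i - aW p i)%N.
  rewrite !alphaE; have := dimvS (capvS WN (subvv (lev p i.+1))).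
  have := dimvS (capvS (subvv (sub p)) (levS p (ltn_ord i))).
  have := dimvS (capvS (subvv (kern p)) (levS p (ltn_ord i))).
  by move: eZ eX lZ; lia.
move=> <-; apply: eq_card => U; rewrite !inE /PU /b.
apply/idP/idP => [/and5P[_ _ -> -> /andP[-> ->]] //|/and4P[WU UX UZ dU]].
rewrite (subv_trans RW WU) WU dU UX UZ !andbT (subv_trans UX) //.
by rewrite subv_add WN capvSl.
Qed.

Lemma card_F p w r n :
  #|[set x | F_rel p x && inA w r n x]| = (Fpoly (aW p) (aR p) (aN p) w r n).[#|F|].
Proof.
have [_ _ _ [RW WN]] := tvarP p.
pose b U j := ~~ (sub p :&: lev p j <= U)%VS.
pose J (i : 'I_k) x := b (sub x) i.+1 && ~~ b (sub x) i.
have b_mono U j l : (j <= l <= k)%N -> b U j -> b U l.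
  by move=> jl; apply: contra; apply: subv_trans; rewrite capvS // lev_mono.
rewrite (@card_split_jump _ J) => [|x]; last first.
  rewrite inE => /andP[/and4P[/eqP fx /eqP tx Wx /eqP dx] _].
  have := @nat_sum_telescope k (b (sub x)).
  have -> : b (sub x) 0 = false by rewrite /b lev0 capv0 sub0v.
  rewrite addn0 => -> => [|j jk]; last by apply/implyP/b_mono; rewrite leqnSn.
  rewrite /b lev_full capvf; case: (boolP (sub p <= _)%VS) => // /dimvS.
  by rewrite -dx ltnn.
rewrite /Fpoly horner_sum -[RHS]/(\sum_(i < k) _)%N; apply: eq_bigr => i _.
pose PU U := [&& (U <= sub p)%VS, (\dim U).+1 == \dim (sub p), b U i.+1 & ~~ b U i].
have alphax x : [&& flag x == flag p, nil_end x == nil_end p & PU (sub x)] ->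
    inA w r n x = [forall j, [&& (w j + (j == i))%N == aW p j, r j == aR p j & n j == aN p j]].
  case/and3P=> /eqP fx /eqP tx /and4P[xW /eqP dx b1 b0].
  apply: eq_forallb => j; rewrite /imag /kern fx tx [_ == r j]eq_sym [_ == n j]eq_sym.
  congr andb; rewrite !alphaE !(@dim_down_lev k d F p (sub x)) //.
  rewrite -/(b (sub x) j) -/(b (sub x) j.+1).
  have -> : b (sub x) j.+1 = (b (sub x) j || (j == i)).
    case: (ltngtP j i) => [ji|ij|/val_inj ->]; last by rewrite b1 eqxx orbT.
      have bj l : (l <= i)%N -> b (sub x) l = false.
        by move=> li; apply: contraNF b0; apply: b_mono; rewrite li ltnW.
      by rewrite !bj // 1?ltnW // -val_eqE /= ltn_eqF.
    have bj l : (i < l)%N -> (l <= k)%N -> b (sub x) l.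
      by move=> il lk; apply: b_mono b1; rewrite il.
    by rewrite !bj // 1?ltnW // ltnW.
  have := dimvS (capvS (subvv (sub x)) (levS p (ltn_ord j))).
  case: (eqVneq j i) => [->|ji]; first by rewrite (negPf b0) /=; lia.
  by rewrite orbF addn0; lia.
rewrite [LHS](_ : _ = #|[set x | [&& flag x == flag p, nil_end x == nil_end p & PU (sub x)] &&
    [forall j, [&& (w j + (j == i))%N == aW p j, r j == aR p j & n j == aN p j]]]|); last first.
  apply: eq_card => x; rewrite !inE.
  case xP: [&& flag x == flag p, nil_end x == nil_end p & PU (sub x)].
    rewrite -(alphax x xP) /=; case/and3P: xP => fx tx /and4P[Wx dx b1 b0].
    by rewrite /F_rel fx tx Wx dx /J b1 b0 /= andbT.
  apply: contraFF xP => /andP[/andP[/and4P[-> -> h1 h2] _] /andP[b1 b0]].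
  by rewrite /PU h1 h2 b1.
case: ifP => [cond|_]; last first.
  by rewrite horner0; apply: eq_card0 => x; rewrite inE andbF.
rewrite [LHS](_ : _ = #|[set x | [&& flag x == flag p, nil_end x == nil_end p & PU (sub x)]]|); last first.
  by apply: eq_card => x; rewrite !inE andbT.
rewrite card_fiber horner_muln horner_Xnn horner_gsumX.
have s12 : (imag p + (sub p :&: lev p i) <= imag p + (sub p :&: lev p i.+1))%VS.
  by rewrite addvS // capvS // levS.
have s2W : (imag p + (sub p :&: lev p i.+1) <= sub p)%VS by rewrite subv_add RW capvSl.
have := card_hyperplanesD s12 s2W.
have e1 := dim_sub_add_lev p i RW; have e2 := dim_sub_add_lev p i.+1 RW.
have l1 := dimvS (capvS RW (subvv (lev p i))); have l2 := dimvS (capvS RW (subvv (lev p i.+1))).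
have lR := dimvS (capvSl (imag p) (lev p i.+1)); have lW := dimvS (capvSl (sub p) (lev p i.+1)).
have le2 := dimvS s2W.
rewrite !psum_alpha // lev_full !capvf.
have -> : (\dim (sub p) - \dim (imag p + (sub p :&: lev p i.+1)) =
   \dim (sub p) - \dim (sub p :&: lev p i.+1) - (\dim (imag p) - \dim (imag p :&: lev p i.+1)))%N.
  by move: e2 l2 lR lW; lia.
have -> : (\dim (imag p + (sub p :&: lev p i.+1)) - \dim (imag p + (sub p :&: lev p i)) =
   aW p i - aR p i)%N.
  rewrite !alphaE.
  have := dimvS (capvS (subvv (imag p)) (levS p (ltn_ord i))).
  have := dimvS (capvS (subvv (sub p)) (levS p (ltn_ord i))).
  by move: e1 e2 l1 l2; lia.
move=> <-; apply: eq_card => U; rewrite !inE /PU /b negbK.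
apply/idP/idP => [/and5P[RU _ UW dU /andP[b1 b0]]|/and4P[AU UW A2U dU]].
  by rewrite !subv_add RU b0 UW dU /= andbT.
move: AU A2U; rewrite !subv_add => /andP[RU ->]; rewrite RU /= => ->.
by rewrite UW dU (subv_trans UW WN).
Qed.

End Neighbours.

(** Stated over an arbitrary field so that [field] sees q and q^a as atoms. *)
Lemma geometric_step_identity (L : fieldType) (x A : L) : x != 0 -> A != 0 -> x - x^-1 != 0 ->
  A / x * ((A - A^-1) / (x - x^-1)) + A ^+ 2 = A * ((A * x - A^-1 / x) / (x - x^-1)).
Proof.
move=> x0 A0 xd; have x2 : x * x - 1 != 0.
  by apply: contra xd => /eqP e; apply/eqP/(mulIf x0); rewrite mulrBl mulVf // e mul0r.
by field; rewrite x0 A0 x2.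
Qed.

Section RawFormulas.
Variables (k : nat) (d : 'I_k -> nat).
Implicit Types w r n : 'I_k -> nat.

Definition wadd w (i : 'I_k) : 'I_k -> nat := fun j => (w j + (j == i))%N.
Definition wsub w (i : 'I_k) : 'I_k -> nat := fun j => (w j - (j == i))%N.

Definition idiff n w : 'I_k -> int := fun j => (n j)%:Z - (w j)%:Z.

Variable C : numFieldType.
Local Notation K := C`(q).
Local Notation q := (qq C).

Definition Eco (x : 'I_k -> int) i : K := q ^ (lsum x i - rsum x i) * qz C (x i).
Definition Fco (y : 'I_k -> int) i : K := q ^ (rsum y i - lsum y i) * qz C (y i).

Lemma evq_gsumX a : evq C (gsumX a) = q ^ (a%:Z - 1) * qz C a.
Proof.
elim: a => [|a IH]; first by rewrite /gsumX big_ord0 evq0 qz0 mulr0.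
rewrite /gsumX big_ord_recr /= evqD -/(gsumX a) IH evq_Xn /qz.
set A := q ^ a%:Z; have A0 : A != 0 by rewrite expfz_neq0 ?qq_neq0.
have -> : q ^ (a%:Z - 1) = A / q by rewrite expfzDr ?qq_neq0 // exprN1.
have -> : q ^ (- a%:Z) = A^-1 by rewrite invr_expz.
have -> : q ^+ (2 * a) = A ^+ 2 by rewrite /A -exprnP mulnC exprM.
have -> : q ^ (a.+1%:Z - 1) = A by congr (q ^ _); lia.
have -> : q ^ (- a.+1%:Z) = A^-1 / q.
  rewrite invr_expz -exprN1 -expfzDr ?qq_neq0 //; congr (q ^ _); lia.
have -> : q ^ a.+1%:Z = A * q by rewrite /A -!exprnP exprSr.
exact: geometric_step_identity (qq_neq0 C) A0 (qden_neq0 C).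
Qed.

Variable F : finFieldType.
Implicit Types p x : tvar d F.

Lemma val_on_inA (f : tfun d C F) w r n x : inA w r n x -> 
  (forall y y', same_type y y' -> f y = f y') -> val_on f w r n = f x.
Proof.
move=> /inAP[h1 h2 h3] fc; rewrite /val_on; case: pickP => [y|/(_ x)].
  move=> /inAP[g1 g2 g3]; apply: fc; apply/same_typeP.
  by split=> i; rewrite ?h1 ?h2 ?h3 ?g1 ?g2 ?g3.
by move/inAP: (And3 h1 h2 h3) => ->.
Qed.

Lemma sum_midx g (h : ('I_k -> nat) -> K) : (forall j, g j <= dsum d)%N ->
  \sum_(w : midx d) (if [forall j, w j == g j] then h w else 0) = h g.
Proof.
move=> gle; pose w0 : midx d := [ffun j => inord (g j)].
have w0E : mval w0 = g by apply/funext => j; rewrite /mval ffunE inordK // ltnS.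
rewrite (bigD1 w0) //= big1 => [|w ww0]; last first.
  case: forallP => // wg; case/eqP: ww0; apply/ffunP => j; apply/val_inj.
  by rewrite ffunE /= inordK ?ltnS //; apply/eqP/wg.
rewrite addr0; case: forallP => [_|[]]; first by rewrite w0E.
by move=> j; rewrite w0E.
Qed.

Lemma aN_le p j : (aN p j <= dsum d)%N.
Proof.
rewrite (leq_trans (@alphaS k d F _ fullv p j (subvf _))) // alpha_full.
by rewrite /dsum (bigD1 j) //= leq_addr.
Qed.

Lemma aW_le_aN p j : (aW p j <= aN p j)%N.
Proof. by have [_ _ _ [_ WN]] := tvarP p; exact: alphaS. Qed.

Lemma aR_le_aW p j : (aR p j <= aW p j)%N.
Proof. by have [_ _ _ [RW _]] := tvarP p; exact: alphaS. Qed.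

Lemma aN_le_d p j : (aN p j <= d j)%N.
Proof.
by rewrite (leq_trans (@alphaS k d F _ fullv p j (subvf _))) // alpha_full.
Qed.

Lemma qsum_jump (X : corresp d) (f : tfun d C F) p (g : 'I_k -> 'I_k -> nat) (c : 'I_k -> K) :
  (forall w r n, chi C X p w r n = \sum_i (if [forall j, [&& w j == g i j, r j == aR p j & n j == aN p j]]
     then c i else 0)) ->
  (forall i, c i = 0 \/ forall j, (g i j <= dsum d)%N) ->
  qsum X f p = \sum_i c i * val_on f (g i) (aR p) (aN p).
Proof.
move=> chiE gle; rewrite /qsum.
under eq_bigr => w _ do under eq_bigr => r _ do under eq_bigr => n _ do
  rewrite chiE mulr_sumr.
transitivity (\sum_i \sum_(w : midx d) \sum_(r : midx d) \sum_(n : midx d) val_on f w r n *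
   (if [forall j, [&& w j == g i j, r j == aR p j & n j == aN p j]] then c i else 0)).
  rewrite [RHS]exchange_big /=; apply: eq_bigr => w _; rewrite [RHS]exchange_big /=.
  by apply: eq_bigr => r _; rewrite [RHS]exchange_big.
apply: eq_bigr => i _; have [->|gi] := gle i.
  rewrite mul0r big1 // => w _; rewrite big1 // => r _; rewrite big1 // => n _.
  by rewrite if_same mulr0.
have RN j : (aR p j <= dsum d)%N.
  by rewrite (leq_trans (aR_le_aW _ _)) // (leq_trans (aW_le_aN _ _)) // aN_le.
rewrite -(sum_midx (fun w => c i * val_on f w (aR p) (aN p)) gi); apply: eq_bigr => w _.
case: ifP => wE.
  rewrite -(sum_midx (fun r => c i * val_on f (mval w) r (aN p)) RN); apply: eq_bigr => r _.
  case: ifP => rE.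
    rewrite -(sum_midx (fun n => c i * val_on f (mval w) (mval r) n) (aN_le p)); apply: eq_bigr => n _.
    have -> : [forall j, [&& mval w j == g i j, mval r j == aR p j & mval n j == aN p j]] =
        [forall j, mval n j == aN p j].
      by apply: eq_forallb => j; rewrite (forallP wE) (forallP rE).
    by case: ifP; rewrite ?mulr0 // mulrC.
  rewrite big1 // => n _; case: ifP => [/forallP h|_]; last by rewrite mulr0.
  by case/forallP: rE => j; have /and3P[] := h j.
rewrite big1 // => r _; rewrite big1 // => n _; case: ifP => [/forallP h|_]; last by rewrite mulr0.
by case/forallP: wE => j; have /and3P[] := h j.
Qed.

Lemma Posz_sum (I : Type) (s : seq I) (P : pred I) (f : I -> nat) :
  (\sum_(i <- s | P i) f i)%N%:Z = \sum_(i <- s | P i) (f i)%:Z.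
Proof. exact: (big_morph Posz PoszD). Qed.

Lemma sum_idiff n w : \sum_i idiff n w i = (\sum_i n i)%N%:Z - (\sum_i w i)%N%:Z.
Proof. by rewrite /idiff sumrB !Posz_sum. Qed.

Lemma lsum_idiff n w (i : 'I_k) : (psum (ext0 n) i)%:Z - (psum (ext0 w) i)%:Z = lsum (idiff n w) i.
Proof. by rewrite !psum_ord /lsum /idiff sumrB !Posz_sum. Qed.

Lemma psum_le (f g : 'I_k -> nat) i : (forall j, f j <= g j)%N -> (psum (ext0 f) i <= psum (ext0 g) i)%N.
Proof.
by move=> fg; apply: leq_sum => j _; rewrite /ext0; case: insub.
Qed.

Lemma psum_tail (f : 'I_k -> nat) (i : 'I_k) :
  (psum (ext0 f) k - psum (ext0 f) i.+1)%N = (\sum_(j : 'I_k | (i < j)%N) f j)%N.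
Proof.
rewrite psumS psum_ord ext0E psum_ext0 (bigID (fun j : 'I_k => (j < i)%N)) /=.
rewrite subnDl (bigD1 i) ?ltnn //= addKn; apply: eq_bigl => j.
by rewrite -leqNgt ltn_neqAle andbC eq_sym.
Qed.

Lemma rsum_idiff w r (i : 'I_k) : (forall j, r j <= w j)%N ->
  ((psum (ext0 w) k - psum (ext0 w) i.+1) - (psum (ext0 r) k - psum (ext0 r) i.+1))%N%:Z =
  rsum (idiff w r) i.
Proof.
move=> rw; rewrite !psum_tail -subzn; last by apply: leq_sum => j _.
by rewrite !Posz_sum -sumrB.
Qed.

(** Let m_i be the entries of [idiff (aN p) (aW p)], with partial sums l and r at box i. The count
    gives q^(2 l) q^(m_i - 1) [m_i], and the prefactor in E has exponent 1 - (l + m_i + r), which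
    leaves the symmetric exponent l - r. *)
Lemma actE_raw (f : tfun d C F) p :
  actE_fun f p = \sum_i Eco (idiff (aN p) (aW p)) i * val_on f (wadd (aW p) i) (aR p) (aN p).
Proof.
rewrite ffunE (@qsum_jump _ _ _ (fun i => wadd (aW p) i)
  (fun i => evq C ('X^(psum (ext0 (aN p)) i - psum (ext0 (aW p)) i) * gsumX (aN p i - aW p i)))).
- rewrite mulr_sumr; apply: eq_bigr => i _; rewrite mulrA; congr (_ * _).
  rewrite evqM evq_Xn evq_gsumX exprnP mulrA /Eco.
  have -> : (aN p i - aW p i)%N%:Z = idiff (aN p) (aW p) i.
    by rewrite /idiff -subzn // aW_le_aN.
  rewrite !mulrA -!expfzDr ?qq_neq0 //; congr (q ^ _ * _ / _).
  rewrite PoszM -subzn ?psum_le // ?lsum_idiff; last exact: aW_le_aN.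
  rewrite -{1}(sum_alpha (kern p) p) -{1}(sum_alpha (sub p) p) -sum_idiff -(lrsum _ i).
  by move: (lsum _ i) (rsum _ i) (idiff _ _ i) => a b c; lia.
- move=> w r n; rewrite (@chiE _ _ _ _ _ _ _ _ _ (Epoly (aW p) (aR p) (aN p) w r n)).
    rewrite /Epoly evq_sum; apply: eq_bigr => i _; rewrite /wadd.
    by case: ifP; rewrite ?evq0.
  move=> F' p' /same_typeP[/funext-> /funext-> /funext->].
  exact: card_E.
(* With no room in box i, w_i + 1 might exceed the bound of [midx], but then the coefficient is
   0. *)
- move=> i; have [e|lt] := leqP (aN p i) (aW p i); [left|right=> j].
    by rewrite (eqP e) /gsumX big_ord0 mulr0 evq0.
  rewrite /wadd; case: (eqVneq j i) => [->|_]; first by rewrite addn1 (leq_trans lt) // aN_le.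
  by rewrite addn0 (leq_trans (aW_le_aN _ _)) // aN_le.
Qed.

Lemma actF_raw (f : tfun d C F) p :
  actF_fun f p = \sum_i Fco (idiff (aW p) (aR p)) i * val_on f (wsub (aW p) i) (aR p) (aN p).
Proof.
rewrite ffunE (@qsum_jump _ _ _ (fun i => wsub (aW p) i)
  (fun i => evq C ('X^((psum (ext0 (aW p)) k - psum (ext0 (aW p)) i.+1) -
     (psum (ext0 (aR p)) k - psum (ext0 (aR p)) i.+1)) * gsumX (aW p i - aR p i)))).
- rewrite mulr_sumr; apply: eq_bigr => i _; rewrite mulrA; congr (_ * _).
  rewrite evqM evq_Xn evq_gsumX exprnP mulrA /Fco.
  have -> : (aW p i - aR p i)%N%:Z = idiff (aW p) (aR p) i.
    by rewrite /idiff -subzn // aR_le_aW.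
  rewrite !mulrA -!expfzDr ?qq_neq0 //; congr (q ^ _ * _ / _).
  rewrite PoszM rsum_idiff; last exact: aR_le_aW.
  rewrite -{1}(sum_alpha (sub p) p) -{1}(sum_alpha (imag p) p) -sum_idiff -(lrsum _ i).
  by move: (lsum _ i) (rsum _ i) (idiff _ _ i) => a b c; lia.
- move=> w r n; rewrite (@chiE _ _ _ _ _ _ _ _ _ (Fpoly (aW p) (aR p) (aN p) w r n)).
    rewrite /Fpoly evq_sum; apply: eq_bigr => i _.
    (* Either the factor [gsumX] is 0, or w_i is positive and [wsub] does not truncate, so that the
       two conditions on w agree. *)
    case: (posnP (aW p i - aR p i)%N) => [e0|lt].
      by rewrite e0 /gsumX big_ord0 mulr0 evq0 !if_same evq0.
    rewrite (_ : [forall j, _] = [forall j, [&& w j == wsub (aW p) i j, r j == aR p j & n j == aN p j]]).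
      by case: ifP; rewrite ?evq0.
    apply: eq_forallb => j; congr andb; rewrite /wsub.
    by case: (eqVneq j i) => [ej|_]; [rewrite ej in lt *|]; apply/eqP/eqP; lia.
  move=> F' p' /same_typeP[/funext-> /funext-> /funext->].
  exact: card_F.
- move=> i; right=> j; rewrite /wsub (leq_trans (leq_subr _ _)) //.
  by rewrite (leq_trans (aW_le_aN _ _)) // aN_le.
Qed.

End RawFormulas.

Lemma qz_commutator_identity (L : fieldType) (x A B : L) : x != 0 -> A != 0 -> B != 0 ->
  x - x^-1 != 0 ->
  (A - A^-1) / (x - x^-1) * ((B * x - (B * x)^-1) / (x - x^-1)) -
  (B - B^-1) / (x - x^-1) * ((A * x - (A * x)^-1) / (x - x^-1)) =
  (A / B - B / A) / (x - x^-1).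
Proof.
move=> x0 A0 B0 xd; have x2 : x * x - 1 != 0.
  by apply: contra xd => /eqP e; apply/eqP/(mulIf x0); rewrite mulrBl mulVf // e mul0r.
by field; rewrite x0 A0 B0 x2.
Qed.

(** * The relations of U_q on functions constant on strata *)

Section Relations.
Variables (k : nat) (d : 'I_k -> nat) (C : numFieldType) (F : finFieldType).
Local Notation K := C`(q).
Local Notation q := (qq C).
Implicit Types (p x y : tvar d F) (w r n : 'I_k -> nat) (f : tfun d C F).

Lemma qz_commutator (x y : int) :
  qz C x * qz C (y + 1) - qz C y * qz C (x + 1) = qz C (x - y).
Proof.
rewrite /qz; set A := q ^ x; set B := q ^ y.
have A0 : A != 0 by rewrite expfz_neq0 ?qq_neq0.
have B0 : B != 0 by rewrite expfz_neq0 ?qq_neq0.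
have -> : q ^ (- x) = A^-1 by rewrite invr_expz.
have -> : q ^ (- y) = B^-1 by rewrite invr_expz.
have eA : q ^ (x + 1) = A * q by rewrite expfzDr ?qq_neq0 ?expr1z.
have eB : q ^ (y + 1) = B * q by rewrite expfzDr ?qq_neq0 ?expr1z.
have -> : q ^ (- (x + 1)) = (A * q)^-1 by rewrite -eA invr_expz.
have -> : q ^ (- (y + 1)) = (B * q)^-1 by rewrite -eB invr_expz.
have -> : q ^ (x - y) = A / B by rewrite expfzDr ?qq_neq0 ?invr_expz.
have -> : q ^ (- (x - y)) = B / A by rewrite opprB expfzDr ?qq_neq0 ?invr_expz.
rewrite eA eB; exact: qz_commutator_identity (qq_neq0 C) A0 B0 (qden_neq0 C).
Qed.

Lemma inA_type w r n y y' : same_type y y' -> inA w r n y = inA w r n y' :> bool.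
Proof.
by move=> /same_typeP[e1 e2 e3]; apply: eq_forallb => j; rewrite e1 e2 e3.
Qed.

Lemma tspaceP f : reflect (forall y y', same_type y y' -> f y = f y') (f \in tspace d C F).
Proof.
apply: (iffP idP) => [fT y y' yy'|fc].
  rewrite (coord_span fT) !sum_ffunE; apply: eq_bigr => i _; rewrite !ffunE; congr (_ * _).
  set g := _`_i; have /mapP[s _ ->] : g \in [seq fwrn d C F s.1.1 s.1.2 s.2 | s : midx d * midx d * midx d].
    by rewrite mem_nth // size_image ltn_ord.
  rewrite !ffunE.
  by rewrite (inA_type _ _ _ yy').
have -> : f = \sum_(s : midx d * midx d * midx d)
   (q ^ (- fexp s.1.1 s.1.2 s.2) * val_on f s.1.1 s.1.2 s.2) *: fwrn d C F s.1.1 s.1.2 s.2.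
  apply/ffunP => x; rewrite sum_ffunE.
  pose h (g : 'I_k -> nat) : midx d := [ffun j => inord (g j)].
  have hE g : (forall j, g j <= dsum d)%N -> mval (h g) = g.
    by move=> gle; apply/funext => j; rewrite /mval ffunE inordK // ltnS.
  have hN := hE _ (@aN_le k d F x).
  have hW : mval (h (aW x)) = aW x.
    by apply: hE => j; rewrite (leq_trans (aW_le_aN _ _)) // aN_le.
  have hR : mval (h (aR x)) = aR x.
    by apply: hE => j; rewrite (leq_trans (aR_le_aW _ _)) // (leq_trans (aW_le_aN _ _)) // aN_le.
  rewrite (bigD1 (h (aW x), h (aR x), h (aN x))) //= big1 ?addr0 => [|s sx].
    rewrite !ffunE hN hW hR inA_self mulr1 /GRing.scale /= mulrAC -expfzDr ?qq_neq0 // addNr.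
    by rewrite expr0z mul1r (val_on_inA (inA_self x)).
  rewrite !ffunE; case: (boolP (inA _ _ _ x)) => [/inAP[e1 e2 e3]|_]; last by rewrite !mulr0 scaler0.
  case/eqP: sx; case: s e1 e2 e3 => [[a b] c] /= e1 e2 e3.
  congr (_, _, _); apply/ffunP => j; apply/val_inj; rewrite /= ffunE inordK.
  - by rewrite e1.
  - by rewrite e1 ltn_ord.
  - by rewrite e2.
  - by rewrite e2 ltn_ord.
  - by rewrite e3.
  - by rewrite e3 ltn_ord.
apply: rpred_sum => s _; apply/rpredZ/memv_span/map_f; exact: mem_enum.
Qed.

Lemma gsum_gt0 Q a : (0 < a)%N -> (0 < gsum Q a)%N.
Proof. by case: a => // a _; rewrite /gsum big_ord_recl /= expn0. Qed.

Lemma horner_sum_gt0 (I : finType) (f : I -> {poly nat}) (i : I) (z : nat) :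
  (0 < (f i).[z])%N -> (0 < (\sum_i f i).[z])%N.
Proof.
move=> fi; rewrite horner_sum -[X in (_ < X)%N]/(\sum_i (f i).[z])%N.
by rewrite (bigD1 i) //= addn_gt0 fi.
Qed.

(** The count of [card_E] has a positive summand at box i. *)
Lemma up_point p i : (aW p i < aN p i)%N -> exists x, inA (wadd (aW p) i) (aR p) (aN p) x.
Proof.
move=> lt; have := card_E p (wadd (aW p) i) (aR p) (aN p).
set S := [set x | _] => cS; have : (0 < #|S|)%N.
  rewrite cS; apply: (horner_sum_gt0 (i := i)).
  rewrite ifT; last by apply/forallP => j; rewrite /wadd !eqxx.
  rewrite horner_muln horner_Xnn horner_gsumX muln_gt0 expn_gt0.
  by rewrite (ltnW (card_gt1 F)) gsum_gt0 // subn_gt0.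
by rewrite card_gt0 => /set0Pn[x]; rewrite inE => /andP[_]; exists x.
Qed.

Lemma down_point p i : (aR p i < aW p i)%N -> exists x, inA (wsub (aW p) i) (aR p) (aN p) x.
Proof.
move=> lt; have := card_F p (wsub (aW p) i) (aR p) (aN p).
set S := [set x | _] => cS; have : (0 < #|S|)%N.
  rewrite cS; apply: (horner_sum_gt0 (i := i)).
  rewrite ifT; last first.
    apply/forallP => j; rewrite /wsub !eqxx /= andbT.
    by case: (eqVneq j i) => [ej|_]; apply/eqP; rewrite ?ej; lia.
  rewrite horner_muln horner_Xnn horner_gsumX muln_gt0 expn_gt0.
  by rewrite (ltnW (card_gt1 F)) gsum_gt0 // subn_gt0.
by rewrite card_gt0 => /set0Pn[x]; rewrite inE => /andP[_]; exists x.
Qed.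

Lemma Eco_eq0 n w i : Eco C (idiff n w) i = 0 <-> n i = w i.
Proof.
rewrite /Eco; split=> [/eqP|e]; last by rewrite /idiff e subrr qz0 mulr0.
by rewrite mulf_eq0 expfz_eq0 (negPf (qq_neq0 C)) andbF qz_eq0 /idiff; lia.
Qed.

Lemma Fco_eq0 n w i : Fco C (idiff n w) i = 0 <-> n i = w i.
Proof.
rewrite /Fco; split=> [/eqP|e]; last by rewrite /idiff e subrr qz0 mulr0.
by rewrite mulf_eq0 expfz_eq0 (negPf (qq_neq0 C)) andbF qz_eq0 /idiff; lia.
Qed.

(** Either the neighbouring stratum has a point or the coefficient vanishes, so the default value 0
    of [val_on] never intervenes. *)
Lemma Eco_val_on p i (g1 g2 : K) : 
  (forall x, inA (wadd (aW p) i) (aR p) (aN p) x -> g1 = g2) ->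
  Eco C (idiff (aN p) (aW p)) i * g1 = Eco C (idiff (aN p) (aW p)) i * g2.
Proof.
move=> g12; have [le|lt] := leqP (aN p i) (aW p i).
  have e : aN p i = aW p i by apply/eqP; rewrite eqn_leq le aW_le_aN.
  by have /Eco_eq0-> := e; rewrite !mul0r.
by have [x /g12->] := up_point lt.
Qed.

Lemma Fco_val_on p i (g1 g2 : K) : 
  (forall x, inA (wsub (aW p) i) (aR p) (aN p) x -> g1 = g2) ->
  Fco C (idiff (aW p) (aR p)) i * g1 = Fco C (idiff (aW p) (aR p)) i * g2.
Proof.
move=> g12; have [le|lt] := leqP (aW p i) (aR p i).
  have e : aW p i = aR p i by apply/eqP; rewrite eqn_leq le aR_le_aW.
  by have /Fco_eq0-> := e; rewrite !mul0r.
by have [x /g12->] := down_point lt.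
Qed.

Lemma inA_fun w r n x : inA w r n x -> [/\ aW x = w, aR x = r & aN x = n].
Proof. by move=> /inAP[/funext e1 /funext e2 /funext e3]. Qed.

Lemma actE_tspace f : actE_fun f \in tspace d C F.
Proof.
by apply/tspaceP => y y' /same_typeP[/funext e1 /funext e2 /funext e3]; rewrite !actE_raw e1 e2 e3.
Qed.

Lemma actF_tspace f : actF_fun f \in tspace d C F.
Proof.
by apply/tspaceP => y y' /same_typeP[/funext e1 /funext e2 /funext e3]; rewrite !actF_raw e1 e2 e3.
Qed.

Lemma same_type_dims y y' : same_type y y' ->
  [/\ \dim (sub y) = \dim (sub y'), \dim (imag y) = \dim (imag y') & \dim (kern y) = \dim (kern y')].
Proof.
move=> /same_typeP[/funext e1 /funext e2 /funext e3].
by rewrite -(sum_alpha (sub y) y) -(sum_alpha (imag y) y) -(sum_alpha (kern y) y) e1 e2 e3 !sum_alpha.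
Qed.

Lemma actK_tspace f : f \in tspace d C F -> actK_fun f \in tspace d C F.
Proof.
move=> /tspaceP fc; apply/tspaceP => y y' yy'; rewrite !ffunE (fc _ _ yy').
by have [-> _ _] := same_type_dims yy'.
Qed.

Lemma idiff_wadd w r i : idiff (wadd w i) r = fun j => idiff w r j + pulse i 1 j.
Proof. by apply/funext => j; rewrite /idiff /wadd /pulse PoszD; case: eqP => _ /=; lia. Qed.

Lemma idiff_wsub n w i : (0 < w i)%N -> idiff n (wsub w i) = fun j => idiff n w j + pulse i 1 j.
Proof.
by move=> wi; apply/funext => j; rewrite /idiff /wsub /pulse; case: (eqVneq j i) => [->|_] /=; lia.
Qed.

Lemma lsum_pulse (m : 'I_k -> int) i c j :
  lsum (fun l => m l + pulse i c l) j = lsum m j + (if (i < j)%N then c else 0).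
Proof. exact: sum_pulse. Qed.

Lemma rsum_pulse (m : 'I_k -> int) i c j :
  rsum (fun l => m l + pulse i c l) j = rsum m j + (if (j < i)%N then c else 0).
Proof. exact: sum_pulse. Qed.

(** The mixed terms cancel, the term of box i is q^(l_i - r_i) [x_i - y_i] by [qz_commutator], and
    [qz_telescope] applied to x - y sums them up. *)
Lemma actEF f p : f \in tspace d C F ->
  actE_fun (actF_fun f) p - actF_fun (actE_fun f) p =
  qz C (\sum_i idiff (aN p) (aW p) i - \sum_i idiff (aW p) (aR p) i) * f p.
Proof.
move=> fT; pose x := idiff (aN p) (aW p); pose y := idiff (aW p) (aR p).
pose g w := val_on f w (aR p) (aN p).
have gp : f p = g (aW p) by rewrite /g (val_on_inA (inA_self p)) //; apply/tspaceP.
have -> : actE_fun (actF_fun f) p = \sum_i \sum_j Eco C x i *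
    Fco C (fun l => y l + pulse i 1 l) j * g (wsub (wadd (aW p) i) j).
  rewrite actE_raw; apply: eq_bigr => i _; under [RHS]eq_bigr do rewrite -mulrA.
  rewrite -mulr_sumr; apply: Eco_val_on => z zA.
  rewrite (val_on_inA zA); last by apply/tspaceP/actF_tspace.
  by have [e1 e2 e3] := inA_fun zA; rewrite actF_raw e1 e2 e3 idiff_wadd.
have -> : actF_fun (actE_fun f) p = \sum_j \sum_i Fco C y j *
    Eco C (fun l => x l + pulse j 1 l) i * g (wadd (wsub (aW p) j) i).
  rewrite actF_raw; apply: eq_bigr => j _; under [RHS]eq_bigr do rewrite -mulrA.
  rewrite -mulr_sumr; have [le|lt] := leqP (aW p j) (aR p j).
    have e : aW p j = aR p j by apply/eqP; rewrite eqn_leq le aR_le_aW.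
    by have /Fco_eq0-> := e; rewrite !mul0r.
  apply: Fco_val_on => z zA.
  rewrite (val_on_inA zA); last by apply/tspaceP/actE_tspace.
  have [e1 e2 e3] := inA_fun zA; rewrite actE_raw e1 e2 e3 idiff_wsub //.
  exact: leq_ltn_trans lt.
rewrite [X in _ - X]exchange_big /= -sumrB.
rewrite -sumrB -qz_telescope mulr_suml; apply: eq_bigr => i _.
rewrite -sumrB (bigD1 i) //= big1 ?addr0 => [|j ji]; last first.
  (* For distinct boxes the two moves commute, and each shifts the exponent of the other by the same
     sign in both orders. *)
  rewrite /Eco /Fco !lsum_pulse !rsum_pulse.
  case: (posnP (aW p j)) => [wj0|wj].
    have yj : y j = 0 by rewrite /y /idiff wj0; have := aR_le_aW p j; rewrite wj0; lia.
    by rewrite yj /pulse (negPf ji) qz0 !(mulr0, mul0r) subrr.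
  have -> : wsub (wadd (aW p) i) j = wadd (wsub (aW p) j) i.
    apply/funext => l; rewrite /wsub /wadd.
    by case: (eqVneq l i) => [->|_]; rewrite ?addn0 // eq_sym (negPf ji) !subn0.
  rewrite -mulrBl; apply/eqP; rewrite mulf_eq0 subr_eq0; apply/orP; left; apply/eqP.
  rewrite {1}/pulse (negPf ji) {1}/pulse eq_sym (negPf ji) !addr0.
  rewrite mulrACA [RHS]mulrACA -!expfzDr ?qq_neq0 // [qz C (x i) * _]mulrC.
  by congr (q ^ _ * _); case: (ltngtP i j) => _; lia.
have -> : wsub (wadd (aW p) i) i = aW p.
  by apply/funext => l; rewrite /wsub /wadd addnK.
rewrite /Eco /Fco !lsum_pulse !rsum_pulse !ltnn !addr0 /pulse eqxx.
(* For w_i = 0, [wsub] truncates and lowering then raising does not return to w; but then y_i = 0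
   and that product vanishes. *)
case: (posnP (aW p i)) => [wi0|wi].
  have yi : y i = 0 by rewrite /y /idiff wi0; have := aR_le_aW p i; rewrite wi0; lia.
  rewrite -/(x i) -/(y i) yi qz0 !(mulr0, mul0r) subr0 add0r subr0.
  rewrite gp mulrACA -expfzDr ?qq_neq0 // (_ : qz C 1 = 1) ?mulr1; last first.
    by rewrite /qz expr1z exprN1 divff // qden_neq0.
  congr (q ^ _ * _ * _).
  rewrite /lsum /rsum !sumrB -/(lsum x i) -/(rsum x i) -/(lsum y i) -/(rsum y i); lia.
have -> : wadd (wsub (aW p) i) i = aW p.
  by apply/funext => l; rewrite /wsub /wadd; case: (eqVneq l i) => [->|_] /=; lia.
rewrite -mulrBl gp; congr (_ * _).
rewrite [X in X - _]mulrACA [X in _ - X]mulrACA -!expfzDr ?qq_neq0 // [_ + (lsum x i - _)]addrC -mulrBr.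
rewrite qz_commutator; congr (q ^ _ * _).
by rewrite /lsum /rsum !sumrB -/(lsum x i) -/(rsum x i) -/(lsum y i) -/(rsum y i); lia.
Qed.

End Relations.

Section UqRelations.
Variables (k : nat) (d : 'I_k -> nat) (C : numFieldType) (F : finFieldType).
Local Notation K := C`(q).
Local Notation q := (qq C).
Implicit Types (p x y : tvar d F) (w r n : 'I_k -> nat) (f : tfun d C F).

Lemma sum_wadd w i : (\sum_j wadd w i j)%N = (\sum_j w j).+1.
Proof.
rewrite /wadd big_split /= -addn1; congr (_ + _)%N.
by rewrite (bigD1 i) //= eqxx big1 // => j ji; rewrite (negPf ji).
Qed.

Lemma sum_wsub w i : (0 < w i)%N -> (\sum_j wsub w i j).+1 = (\sum_j w j)%N.
Proof.
move=> wi; rewrite -(sum_wadd _ i); apply: eq_bigr => j _; rewrite /wadd /wsub.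
by case: (eqVneq j i) => [->|_] /=; lia.
Qed.

Lemma actKE f p : f \in tspace d C F ->
  actK_fun (actE_fun f) p = q ^+ 2 * actE_fun (actK_fun f) p.
Proof.
move=> fT; rewrite ffunE !actE_raw !mulr_sumr; apply: eq_bigr => i _.
rewrite mulrCA [RHS]mulrCA; apply: Eco_val_on => x xA.
rewrite (val_on_inA xA); last by apply/tspaceP.
rewrite (val_on_inA xA); last by apply/tspaceP/actK_tspace.
rewrite ffunE mulrA; congr (_ * _); rewrite exprnP -expfzDr ?qq_neq0 //; congr (q ^ _).
have [e _ _] := inA_fun xA; rewrite -(sum_alpha (sub x) x) e -(sum_alpha (sub p) p).
by rewrite sum_wadd; lia.
Qed.

Lemma actKF f p : f \in tspace d C F ->
  actK_fun (actF_fun f) p = q ^- 2 * actF_fun (actK_fun f) p.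
Proof.
move=> fT; rewrite ffunE !actF_raw !mulr_sumr; apply: eq_bigr => i _.
have [le|lt] := leqP (aW p i) (aR p i).
  have e : aW p i = aR p i by apply/eqP; rewrite eqn_leq le aR_le_aW.
  by have /Fco_eq0-> := e; rewrite !(mul0r, mulr0).
rewrite mulrCA [RHS]mulrCA; apply: Fco_val_on => x xA.
rewrite (val_on_inA xA); last by apply/tspaceP.
rewrite (val_on_inA xA); last by apply/tspaceP/actK_tspace.
rewrite ffunE mulrA; congr (_ * _); rewrite exprnN -expfzDr ?qq_neq0 //; congr (q ^ _).
have [e _ _] := inA_fun xA; rewrite -(sum_alpha (sub x) x) e -(sum_alpha (sub p) p).
by rewrite -(sum_wsub (leq_ltn_trans (leq0n _) lt)); lia.
Qed.

Lemma uE_act f : uE (act_ops d C F) f = actE_fun f.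
Proof. exact: lfunE. Qed.

Lemma uF_act f : uF (act_ops d C F) f = actF_fun f.
Proof. exact: lfunE. Qed.

Lemma uK_act f : uK (act_ops d C F) f = actK_fun f.
Proof. exact: lfunE. Qed.

Lemma uKi_act f : uKi (act_ops d C F) f = actKi_fun f.
Proof. exact: lfunE. Qed.

Lemma actKKi f : actK_fun (actKi_fun f) = f.
Proof.
apply/ffunP => p; rewrite !ffunE mulrA -expfzDr ?qq_neq0 //.
by rewrite subrr expr0z mul1r.
Qed.

Lemma actKiK f : actKi_fun (actK_fun f) = f.
Proof.
apply/ffunP => p; rewrite !ffunE mulrA -expfzDr ?qq_neq0 //.
by rewrite addNr expr0z mul1r.
Qed.

Lemma actEF_KKi f : f \in tspace d C F ->
  actE_fun (actF_fun f) - actF_fun (actE_fun f) = (q - q^-1)^-1 *: (actK_fun f - actKi_fun f).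
Proof.
move=> fT; apply/ffunP => p.
transitivity (actE_fun (actF_fun f) p - actF_fun (actE_fun f) p); first by rewrite !ffunE.
rewrite actEF //; transitivity ((q - q^-1)^-1 * (actK_fun f p - actKi_fun f p)); last by rewrite !ffunE.
rewrite /qz !sum_idiff !sum_alpha [actK_fun f p]ffunE [actKi_fun f p]ffunE -mulrBl mulrA.
rewrite [_^-1 * _]mulrC; have := rank_nullity p; rewrite -/(dsum d) => rn.
have -> : (\dim (kern p))%:Z - (\dim (sub p))%:Z - ((\dim (sub p))%:Z - (\dim (imag p))%:Z) =
  (dsum d)%:Z - 2 * (\dim (sub p))%:Z by rewrite -rn; lia.
by [].
Qed.

Lemma act_uq_module (M : {pred tfun d C F}) : submod_closed M ->
  {in M, forall f, [/\ f \in tspace d C F, actE_fun f \in M, actF_fun f \in M,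
     actK_fun f \in M & actKi_fun f \in M]} ->
  uq_module (act_ops d C F) M.
Proof.
move=> Msub Mop; split=> // f fM; have [fT fE fF fK fKi] := Mop f fM.
rewrite !(uE_act, uF_act, uK_act, uKi_act); split=> //; split.
- exact: actKKi.
- exact: actKiK.
- by apply/ffunP => p; rewrite actKE // [RHS]ffunE.
- by apply/ffunP => p; rewrite actKF // [RHS]ffunE.
- exact: actEF_KKi.
Qed.

End UqRelations.

(** * Composition of correspondences and double counting *)

Section Composition.
Variables (k : nat) (d : 'I_k -> nat).
Local Notation mi := ('I_k -> nat).

Definition poly_count (X : corresp d) (P : mi -> mi -> mi -> mi -> mi -> mi -> {poly nat}) : Prop :=
  forall (F : finFieldType) (p : tvar d F) (w r n : mi),
    #|[set x | X F p x && inA w r n x]| = (P (aW p) (aR p) (aN p) w r n).[#|F|].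

Lemma chi_poly_count X P : poly_count X P -> forall (C : numFieldType) (F : finFieldType)
  (p : tvar d F) w r n, chi C X p w r n = evq C (P (aW p) (aR p) (aN p) w r n).
Proof.
move=> XP C F p w r n; apply: chiE => F' p' /same_typeP[/funext-> /funext-> /funext->].
exact: XP.
Qed.

(** Natural coefficients again: a zero count at the single size |F| forces the polynomial to be 0.
    Hence strata without points do not disturb compositions. *)
Lemma poly_count_eq0 X P : poly_count X P -> forall (F : finFieldType) (p : tvar d F) w r n,
  (forall x : tvar d F, ~~ inA w r n x) -> P (aW p) (aR p) (aN p) w r n = 0.
Proof.
move=> XP F p w r n A0; apply/eqP; apply: contraT => P0.
have := horner_nat_gt0 P0 (ltnW (card_gt1 F)); rewrite -XP card_gt0 => /set0Pn[x].
by rewrite inE (negPf (A0 x)) andbF.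
Qed.

Local Notation midx3 := (midx d * midx d * midx d)%type.

Lemma sum_types (F : finFieldType) (G : mi -> mi -> mi -> nat) (S : {set tvar d F}) :
  (\sum_(s : midx3) #|[set x in S | inA s.1.1 s.1.2 s.2 x]| * G s.1.1 s.1.2 s.2 =
   \sum_(x in S) G (aW x) (aR x) (aN x))%N.
Proof.
transitivity (\sum_(s : midx3) \sum_(x in [set x in S | inA s.1.1 s.1.2 s.2 x]) G s.1.1 s.1.2 s.2)%N.
  by apply: eq_bigr => s _; rewrite sum_nat_const.
transitivity (\sum_(x in S) \sum_(s : midx3 | inA s.1.1 s.1.2 s.2 x) G s.1.1 s.1.2 s.2)%N.
  rewrite [RHS](exchange_big_dep xpredT) //=; apply: eq_bigr => s _.
  by apply: eq_bigl => x; rewrite inE.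
apply: eq_bigr => x _; pose h (g : 'I_k -> nat) : midx d := [ffun j => inord (g j)].
have hE g : (forall j, g j <= dsum d)%N -> mval (h g) = g.
  by move=> gle; apply/funext => j; rewrite /mval ffunE inordK // ltnS.
have hN := hE _ (@aN_le k d F x).
have hW : mval (h (aW x)) = aW x.
  by apply: hE => j; rewrite (leq_trans (aW_le_aN _ _)) // aN_le.
have hR : mval (h (aR x)) = aR x.
  by apply: hE => j; rewrite (leq_trans (aR_le_aW _ _)) // (leq_trans (aW_le_aN _ _)) // aN_le.
rewrite (big_pred1 (h (aW x), h (aR x), h (aN x))) /= ?hW ?hR ?hN // => s /=.
apply/idP/eqP => [/inA_fun[e1 e2 e3]|->]; last by rewrite /= hW hR hN inA_self.
case: s e1 e2 e3 => [[a b] c] /= e1 e2 e3.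
by congr (_, _, _); apply/ffunP => j; apply/val_inj; rewrite /= ffunE ?e1 ?e2 ?e3 inord_val.
Qed.

Variables (X Y : corresp d) (PX PY : mi -> mi -> mi -> mi -> mi -> mi -> {poly nat}).
Hypotheses (XP : poly_count X PX) (YP : poly_count Y PY).

(** Both sides count the pairs (x, y) with x in X_p, y in Y_x and y of type (w, r, n), on the left
    sorted by the type of x. *)
Lemma horner_comp (F : finFieldType) (p : tvar d F) w r n :
  (\sum_(s : midx3) PX (aW p) (aR p) (aN p) s.1.1 s.1.2 s.2 * PY s.1.1 s.1.2 s.2 w r n).[#|F|] =
  (\sum_(y | inA w r n y) #|[set x | X p x && Y x y]|)%N.
Proof.
rewrite horner_sum; pose G a b c := (PY a b c w r n).[#|F|].
transitivity (\sum_(s : midx3) #|[set x in [set x | X p x] | inA s.1.1 s.1.2 s.2 x]| *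
    G s.1.1 s.1.2 s.2)%N.
  apply: eq_bigr => s _; rewrite horner_muln -XP; congr (_ * _)%N.
  by apply: eq_card => x; rewrite !inE.
rewrite sum_types; under eq_bigr => x _ do rewrite /G -YP -sum1_card.
under [RHS]eq_bigr => x _ do rewrite -sum1_card.
rewrite (exchange_big_dep (fun y => inA w r n y)) /=; last by move=> x y _; rewrite inE => /andP[].
by apply: eq_bigr => y yA; apply: eq_bigl => x; rewrite !inE yA andbT.
Qed.

Lemma qsum_comp (C : numFieldType) (F : finFieldType) (f : tfun d C F) p :
  qsum X [ffun x => qsum Y f x] p = \sum_(s : midx3) val_on f s.1.1 s.1.2 s.2 *
    evq C (\sum_(s' : midx3) PX (aW p) (aR p) (aN p) s'.1.1 s'.1.2 s'.2 *
       PY s'.1.1 s'.1.2 s'.2 s.1.1 s.1.2 s.2).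
Proof.
have qsumE Z PZ (g : tfun d C F) x : poly_count Z PZ -> qsum Z g x = \sum_(s : midx3)
    val_on g s.1.1 s.1.2 s.2 * evq C (PZ (aW x) (aR x) (aN x) s.1.1 s.1.2 s.2).
  move=> ZP; rewrite /qsum pair_big pair_big /=.
  by apply: eq_bigr => s _; rewrite (chi_poly_count ZP).
rewrite (qsumE _ _ _ _ XP).
under [RHS]eq_bigr => s _ do rewrite evq_sum mulr_sumr.
rewrite [RHS]exchange_big /=; apply: eq_bigr => s' _.
rewrite {1}/val_on; case: pickP => [x xA|A0].
  rewrite ffunE (qsumE _ _ _ _ YP) mulr_suml; apply: eq_bigr => s _.
  by have [-> -> ->] := inA_fun xA; rewrite evqM -!mulrA; congr (_ * _); rewrite mulrC.
rewrite mul0r big1 // => s _; rewrite (poly_count_eq0 XP) ?mul0r ?evq0 ?mulr0 // => x.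
by rewrite A0.
Qed.

End Composition.

(** The two composite polynomials agree at every prime by counting over that field, hence as
    polynomials, hence at q^2. *)
Lemma qsum_comm k (d : 'I_k -> nat) (X Y : corresp d) PX PY :
  poly_count X PX -> poly_count Y PY ->
  (forall (F : finFieldType) (p y : tvar d F),
     #|[set x | X F p x && Y F x y]| = #|[set x | Y F p x && X F x y]|) ->
  forall (C : numFieldType) (F : finFieldType) (f : tfun d C F) p,
  qsum X [ffun x => qsum Y f x] p = qsum Y [ffun x => qsum X f x] p.
Proof.
move=> XP YP XY C F f p; rewrite (qsum_comp XP YP) (qsum_comp YP XP).
apply: eq_bigr => s _; congr (_ * evq C _); apply: (@nat_poly_eq_primes C) => l pl.
have [p' /same_typeP[/funext-> /funext-> /funext->]] := type_transfer 'F_l p.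
rewrite -[l in _.[l] = _](card_Fp pl) -[l in _ = _.[l]](card_Fp pl).
by rewrite (horner_comp XP YP) (horner_comp YP XP); apply: eq_bigr => y _; rewrite XY.
Qed.

(** * Compatibility of xi with the action; the module T_s *)

Section XiCommutes.
Variables (k : nat) (d : 'I_k -> nat) (C : numFieldType) (F : finFieldType).
Local Notation K := C`(q).
Local Notation q := (qq C).
Implicit Types (p x y : tvar d F) (w r n : 'I_k -> nat) (f g : tfun d C F).

Lemma B_poly_count : poly_count (@B_rel k d) (Bpoly d).
Proof. by move=> F' p w r n; exact: card_B. Qed.

Lemma E_poly_count : poly_count (@E_rel k d) (@Epoly k).
Proof. by move=> F' p w r n; exact: card_E. Qed.

Lemma F_poly_count : poly_count (@F_rel k d) (@Fpoly k).
Proof. by move=> F' p w r n; exact: card_F. Qed.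

Lemma exists_sub (F' : finFieldType) (p : tvar d F') U : (imag p <= U)%VS -> (U <= kern p)%VS ->
  exists x : tvar d F', [/\ flag x = flag p, sub x = U & nil_end x = nil_end p].
Proof.
move=> RU UN; have xT : in_tvar (flag p, U, nil_end p).
  have := valP p; rewrite val_tvar => /and4P[h1 h2 h3 _].
  by apply/and4P; split=> //; rewrite RU.
by exists (Sub (flag p, U, nil_end p) xT).
Qed.

Lemma card_unique (T : finType) (P : pred T) (b : bool) :
  (forall x y : T, P x -> P y -> x = y) -> (forall x : T, P x -> b) -> (b -> exists x : T, P x) ->
  #|[set x | P x]| = b.
Proof.
move=> Pinj Pb bP; case: b Pb bP => [_ /(_ isT)[x Px]|Pb _].
  rewrite /= -[RHS](cards1 x); apply: eq_card => y; rewrite !inE.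
  by apply/idP/eqP => [/Pinj|->//]; apply.
by apply: eq_card0 => x; rewrite inE; apply/negP => /Pb.
Qed.

(** In either order the intermediate point is unique: it combines the flag of y with the W of p, or
    the flag of p with the W of y. In both orders it exists under the same condition b. *)
Lemma card_BE (F' : finFieldType) (p y : tvar d F') :
  #|[set x | B_rel p x && E_rel x y]| = #|[set x | E_rel p x && B_rel x y]|.
Proof.
have [_ _ _ [RWp WNp]] := tvarP p; have [_ _ _ [RWy WNy]] := tvarP y.
pose b := [&& nil_end y == nil_end p, (sub p <= sub y)%VS, \dim (sub y) == (\dim (sub p)).+1 &
  [forall i, aN y i == aN p i]].
transitivity (nat_of_bool b); last apply/esym; apply: card_unique.
- move=> x x' /andP[/and3P[/eqP s1 /eqP t1 _] /and4P[/eqP f1 _ _ _]].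
  move=> /andP[/and3P[/eqP s2 /eqP t2 _] /and4P[/eqP f2 _ _ _]].
  by apply: tvar_inj; rewrite -?f1 ?f2 ?s1 ?s2 ?t1 ?t2.
- move=> x /andP[/and3P[/eqP s1 /eqP t1 h1] /and4P[/eqP f1 /eqP t2 h2 h3]].
  rewrite /b t2 t1 eqxx -s1 h2 h3 /=; apply/forallP => i.
  by have := forallP h1 i; rewrite f1 /kern t2.
- case/and4P=> /eqP ty py dy aNy.
  have [||x [fx sx tx]] := @exists_sub F' y (sub p); rewrite ?/imag ?/kern ?ty //.
  exists x; rewrite /B_rel /E_rel sx tx fx ty py dy !eqxx /= andbT.
  by apply/forallP => i; have := forallP aNy i; rewrite /kern tx ty.
- move=> x x' /andP[/and4P[/eqP f1 /eqP t1 _ _] /and3P[/eqP s1 _ _]].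
  move=> /andP[/and4P[/eqP f2 /eqP t2 _ _] /and3P[/eqP s2 _ _]].
  by apply: tvar_inj; rewrite ?f1 ?f2 -?s1 -?s2 ?t1 ?t2.
- move=> x /andP[/and4P[/eqP f1 /eqP t1 h1 h2] /and3P[/eqP s1 /eqP t2 h3]].
  rewrite /b t2 t1 eqxx s1 h1 h2 /=; apply/forallP => i.
  by have := forallP h3 i; rewrite f1 /kern t2 t1.
case/and4P=> /eqP ty py dy aNy.
have [||x [fx sx tx]] := @exists_sub F' p (sub y); rewrite ?/imag ?/kern -?ty //.
exists x; rewrite /B_rel /E_rel sx tx fx ty py dy !eqxx /=.
by apply/forallP => i; have := forallP aNy i; rewrite /kern tx.
Qed.

Lemma card_BF (F' : finFieldType) (p y : tvar d F') :
  #|[set x | B_rel p x && F_rel x y]| = #|[set x | F_rel p x && B_rel x y]|.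
Proof.
have [_ _ _ [RWp WNp]] := tvarP p; have [_ _ _ [RWy WNy]] := tvarP y.
pose b := [&& nil_end y == nil_end p, (sub y <= sub p)%VS, (\dim (sub y)).+1 == \dim (sub p) &
  [forall i, aN y i == aN p i]].
transitivity (nat_of_bool b); last apply/esym; apply: card_unique.
- move=> x x' /andP[/and3P[/eqP s1 /eqP t1 _] /and4P[/eqP f1 _ _ _]].
  move=> /andP[/and3P[/eqP s2 /eqP t2 _] /and4P[/eqP f2 _ _ _]].
  by apply: tvar_inj; rewrite -?f1 ?f2 ?s1 ?s2 ?t1 ?t2.
- move=> x /andP[/and3P[/eqP s1 /eqP t1 h1] /and4P[/eqP f1 /eqP t2 h2 h3]].
  rewrite /b t2 t1 eqxx -s1 h2 h3 /=; apply/forallP => i.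
  by have := forallP h1 i; rewrite f1 /kern t2.
- case/and4P=> /eqP ty py dy aNy.
  have [||x [fx sx tx]] := @exists_sub F' y (sub p); rewrite ?/imag ?/kern ?ty //.
  exists x; rewrite /B_rel /F_rel sx tx fx ty py dy !eqxx /= andbT.
  by apply/forallP => i; have := forallP aNy i; rewrite /kern tx ty.
- move=> x x' /andP[/and4P[/eqP f1 /eqP t1 _ _] /and3P[/eqP s1 _ _]].
  move=> /andP[/and4P[/eqP f2 /eqP t2 _ _] /and3P[/eqP s2 _ _]].
  by apply: tvar_inj; rewrite ?f1 ?f2 -?s1 -?s2 ?t1 ?t2.
- move=> x /andP[/and4P[/eqP f1 /eqP t1 h1 h2] /and3P[/eqP s1 /eqP t2 h3]].
  rewrite /b t2 t1 eqxx s1 h1 h2 /=; apply/forallP => i.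
  by have := forallP h3 i; rewrite f1 /kern t2 t1.
case/and4P=> /eqP ty py dy aNy.
have [||x [fx sx tx]] := @exists_sub F' p (sub y); rewrite ?/imag ?/kern -?ty //.
exists x; rewrite /B_rel /F_rel sx tx fx ty py dy !eqxx /=.
by apply/forallP => i; have := forallP aNy i; rewrite /kern tx.
Qed.

Lemma chi_B p w r n : chi C (@B_rel k d) p w r n = evq C (Bpoly d (aW p) (aR p) (aN p) w r n).
Proof. exact: chi_poly_count B_poly_count _ _ _ _ _ _. Qed.

(** Points of B_p have the same dimensions of W, im t and ker t as p, so the prefactors of E, F and
    K come out of the sum. *)
Lemma qsum_B_scale (c : nat -> nat -> nat -> K) f p :
  qsum (@B_rel k d) [ffun x => c (\dim (sub x)) (\dim (imag x)) (\dim (kern x)) * f x] p =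
  c (\dim (sub p)) (\dim (imag p)) (\dim (kern p)) * qsum (@B_rel k d) f p.
Proof.
rewrite /qsum mulr_sumr; apply: eq_bigr => w _; rewrite mulr_sumr; apply: eq_bigr => r _.
rewrite mulr_sumr; apply: eq_bigr => n _; rewrite chi_B /Bpoly.
case: ifPn => [/and3P[/eqP ew /eqP er /forallP en]|_]; last by rewrite evq0 !mulr0.
rewrite mulrA; congr (_ * _); rewrite /val_on; case: pickP => [x xA|_]; last by rewrite mulr0.
rewrite ffunE; have [e1 e2 e3] := inA_fun xA.
rewrite -!(sum_alpha _ x) e1 e2 e3 -ew -er !sum_alpha; congr (c _ _ _ * _).
by rewrite -(sum_alpha (kern p) p); apply: eq_bigr => i _; rewrite (eqP (en i)).
Qed.

Lemma xi_actE f : xi_fun (actE_fun f) = actE_fun (xi_fun f).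
Proof.
apply/ffunP => p; rewrite !ffunE.
pose c (a b e : nat) : K := q ^ (- (e%:Z - a%:Z - 1)).
transitivity (qsum (@B_rel k d) [ffun x => c (\dim (sub x)) (\dim (imag x)) (\dim (kern x)) *
   [ffun x => qsum (@E_rel k d) f x] x] p).
  by congr qsum; apply/ffunP => x; rewrite !ffunE.
rewrite qsum_B_scale; congr (_ * _).
by rewrite (qsum_comm B_poly_count E_poly_count (@card_BE)).
Qed.

Lemma xi_actF f : xi_fun (actF_fun f) = actF_fun (xi_fun f).
Proof.
apply/ffunP => p; rewrite !ffunE.
pose c (a b e : nat) : K := q ^ (- (a%:Z - b%:Z - 1)).
transitivity (qsum (@B_rel k d) [ffun x => c (\dim (sub x)) (\dim (imag x)) (\dim (kern x)) *
   [ffun x => qsum (@F_rel k d) f x] x] p).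
  by congr qsum; apply/ffunP => x; rewrite !ffunE.
rewrite qsum_B_scale; congr (_ * _).
by rewrite (qsum_comm B_poly_count F_poly_count (@card_BF)).
Qed.

Lemma xi_actK f : xi_fun (actK_fun f) = actK_fun (xi_fun f).
Proof.
apply/ffunP => p; rewrite !ffunE.
by rewrite -(qsum_B_scale (fun a b e : nat => q ^ ((dsum d)%:Z - 2 * a%:Z))).
Qed.

Lemma xi_actKi f : xi_fun (actKi_fun f) = actKi_fun (xi_fun f).
Proof.
apply/ffunP => p; rewrite !ffunE.
by rewrite -(qsum_B_scale (fun a b e : nat => q ^ (- ((dsum d)%:Z - 2 * a%:Z)))).
Qed.

Lemma ts_predP f : reflect
  (forall y y', \dim (sub y) = \dim (sub y') -> aN y =1 aN y' -> f y = f y') (ts_pred f).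
Proof.
apply: (iffP andP) => [[_ /forallP fc] y y' e1 e2|fc].
  have /forallP/(_ y')/implyP := fc y; rewrite e1 eqxx /= => h; apply/eqP/h.
  by apply/forallP => i; rewrite e2.
split.
  apply/tspaceP => y y' yy'; have [e1 _ _] := same_type_dims yy'.
  by have /same_typeP[_ _ e3] := yy'; exact: fc.
apply/forallP => y; apply/forallP => y'; apply/implyP => /andP[/eqP e1 /forallP e2].
by apply/eqP/fc => // i; apply/eqP.
Qed.

Lemma xi_ts f : ts_pred (xi_fun f).
Proof.
apply/ts_predP => y y' e1 /funext e2; rewrite !ffunE /qsum.
apply: eq_bigr => w _; apply: eq_bigr => r _; apply: eq_bigr => n _; congr (_ * _).
rewrite !chi_B /Bpoly !sum_alpha e1 e2.
suff -> : \dim (imag y) = \dim (imag y') by [].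
apply/eqP; rewrite -(eqn_add2r (\dim (kern y))) rank_nullity.
by rewrite -(sum_alpha (kern y) y) e2 sum_alpha rank_nullity.
Qed.

Lemma ts_neighbour f (ft : ts_pred f) a (n : 'I_k -> nat) :
  exists g : K, forall x, \dim (sub x) = a -> aN x = n -> f x = g.
Proof.
case: (pickP (fun x => (\dim (sub x) == a) && [forall i, aN x i == n i])) => [x /andP[/eqP e1 /forallP e2]|nx].
  exists (f x) => y d1 d2; move/ts_predP: ft; apply; first by rewrite d1.
  by move=> i; rewrite d2 (eqP (e2 i)).
exists 0 => x d1 d2; have := nx x; rewrite d1 d2 eqxx /=.
by move/forallP; case=> i.
Qed.

(** All neighbours of p in the sum carry the same value g, so the coefficients of the boxes add up
    by [qz_telescope]. *)
Lemma ts_actE f (g : K) p :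
  (forall x, \dim (sub x) = (\dim (sub p)).+1 -> aN x = aN p -> f x = g) -> f \in tspace d C F ->
  actE_fun f p = qz C ((\dim (kern p))%:Z - (\dim (sub p))%:Z) * g.
Proof.
move=> fg /tspaceP fT; rewrite actE_raw -(sum_alpha (kern p) p) -(sum_alpha (sub p) p) -sum_idiff.
rewrite -qz_telescope mulr_suml; apply: eq_bigr => i _; apply: Eco_val_on => x xA.
rewrite (val_on_inA xA) //; have [e1 e2 e3] := inA_fun xA; apply: fg => //.
by rewrite -(sum_alpha _ x) e1 sum_wadd sum_alpha.
Qed.

Lemma ts_actF f (g : K) p :
  (forall x, \dim (sub x) = (\dim (sub p)).-1 -> aN x = aN p -> f x = g) -> f \in tspace d C F ->
  actF_fun f p = qz C ((\dim (sub p))%:Z - (\dim (imag p))%:Z) * g.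
Proof.
move=> fg /tspaceP fT; rewrite actF_raw -(sum_alpha (sub p) p) -(sum_alpha (imag p) p) -sum_idiff.
rewrite -qz_telescope_rev mulr_suml; apply: eq_bigr => i _.
have [le|lt] := leqP (aW p i) (aR p i).
  have e : aW p i = aR p i by apply/eqP; rewrite eqn_leq le aR_le_aW.
  by rewrite -/(Fco C (idiff (aW p) (aR p)) i); have /Fco_eq0-> := e; rewrite !mul0r.
apply: Fco_val_on => x xA; rewrite (val_on_inA xA) //; have [e1 e2 e3] := inA_fun xA.
apply: fg => //; rewrite -(sum_alpha _ x) e1 -(sum_alpha (sub p) p).
by rewrite -(sum_wsub (leq_ltn_trans (leq0n _) lt)).
Qed.

Lemma ts_module : uq_module (act_ops d C F) (@ts_pred k d C F).
Proof.
apply: act_uq_module.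
  split; first by apply/ts_predP => y y' _ _; rewrite !ffunE.
  move=> c f g /ts_predP ft /ts_predP gt; apply/ts_predP => y y' e1 e2.
  by rewrite !ffunE (ft y y') // (gt y y').
move=> f fT; have /andP[fT' _] := fT; move: (fT) => /ts_predP fc; split=> //; apply/ts_predP => y y' e1 e2.
- have [g gP] := ts_neighbour (fT : ts_pred f) (\dim (sub y)).+1 (aN y).
  have ea : aN y = aN y' by apply/funext.
  rewrite (@ts_actE _ g) // (@ts_actE _ g) -?e1 -?ea //.
  by rewrite -[\dim (kern y)](sum_alpha _ y) ea sum_alpha.
- have [g gP] := ts_neighbour (fT : ts_pred f) (\dim (sub y)).-1 (aN y).
  have ea : aN y = aN y' by apply/funext.
  rewrite (@ts_actF _ g) // (@ts_actF _ g) -?e1 -?ea //; congr (qz C (_ - _%:Z) * _).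
  apply/eqP; rewrite -(eqn_add2r (\dim (kern y))) rank_nullity.
  by rewrite -(sum_alpha (kern y) y) ea sum_alpha rank_nullity.
- by rewrite !ffunE (fc y y') // e1.
- by rewrite !ffunE (fc y y') // e1.
Qed.

End XiCommutes.

(** * Tensor products and the maps iota and pi *)

Section TensorAction.
Variable C : numFieldType.
Local Notation K := C`(q).
Local Notation q := (qq C).
Variables (k : nat) (e : 'I_k -> nat).
Implicit Types (a b : tidx e) (i j : 'I_k).

Definition tset a (i : 'I_k) (m : nat) : tidx e :=
  finfun (fun j => if j == i then inord m else a j).

Lemma tset_same a i m : (m <= e i)%N -> tset a i m i = m :> nat.
Proof. by move=> mi; rewrite ffunE eqxx inordK. Qed.

Lemma tset_other a i m j : j != i -> tset a i m j = a j.
Proof. by move=> ji; rewrite ffunE (negPf ji). Qed.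

Lemma tset_eq a b i m : a i = m :> nat -> (forall j, j != i -> a j = b j) -> a = tset b i m.
Proof.
move=> ai ab; apply/ffunP => j; case: (eqVneq j i) => [->|ji]; last by rewrite tset_other // ab.
by apply/val_inj; rewrite /= tset_same // -ai -ltnS.
Qed.

Definition twt (a : tidx e) : 'I_k -> int := fun j => (e j)%:Z - 2 * (a j)%:Z.

(** E lowers and F raises the index u of v_(n - 2 u); this is the support of the entry (a, b) of E,
    or (b, a) of F, in position i. *)
Definition tstep a b i : bool := ((a i).+1 == b i :> nat) && [forall j, (j != i) ==> (a j == b j)].

Lemma tstepP a b i : reflect ((a i).+1 = b i :> nat /\ forall j, j != i -> a j = b j) (tstep a b i).
Proof.
apply: (iffP andP) => [[/eqP e1 /forallP e2]|[e1 e2]]; split=> //; try exact/eqP.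
  by move=> j ji; have /implyP/(_ ji)/eqP := e2 j.
by apply/forallP => j; apply/implyP => /e2->.
Qed.

Lemma lsum_agree (m m' : 'I_k -> int) i : (forall j, j != i -> m j = m' j) -> lsum m i = lsum m' i.
Proof. by move=> mm; apply: eq_bigr => j ji; rewrite mm // -val_eqE /= ltn_eqF. Qed.

Lemma rsum_agree (m m' : 'I_k -> int) i : (forall j, j != i -> m j = m' j) -> rsum m i = rsum m' i.
Proof. by move=> mm; apply: eq_bigr => j ji; rewrite mm // -val_eqE /= gtn_eqF. Qed.

Lemma expq_sum (I : Type) (s : seq I) (P : pred I) (m : I -> int) :
  \prod_(i <- s | P i) q ^ m i = q ^ (\sum_(i <- s | P i) m i).
Proof.
apply: (big_rec2 (fun x y => x = q ^ y)); first by rewrite expr0z.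
by move=> i x y _ ->; rewrite expfzDr ?qq_neq0.
Qed.

Lemma tE_entry a b :
  tE C a b = \sum_i if tstep a b i then q ^ lsum (twt b) i * qz C ((e i)%:Z - (b i)%:Z + 1) else 0.
Proof.
apply: eq_bigr => i _; rewrite /tensmx; case: tstepP => [[e1 e2]|nst].
  rewrite (bigID (fun j : 'I_k => (j < i)%N)) /= [X in _ * X](bigD1 i) ?ltnn //= eqxx.
  rewrite /vE e1 eqxx [X in _ * (_ * X)]big1 ?mulr1 => [|j /andP[/negPf ji /negPf jni]]; last first.
    by rewrite ji jni /vid e2 ?eqxx // jni.
  rewrite /lsum -expq_sum; congr (_ * _).
    by apply: eq_bigr => j ji; rewrite ji /vK e2 ?eqxx // -val_eqE /= ltn_eqF.
  rewrite qintE; congr (qz C _); have := ltn_ord (b i); lia.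
apply/eqP; rewrite prodf_seq_eq0; apply/hasP.
case: (eqVneq ((a i).+1 : nat) (b i)) => [e1|ne1]; last first.
  by exists i; rewrite ?mem_index_enum //= ltnn eqxx /vE (negPf ne1) eqxx.
have /forallPn[j] : ~~ [forall j, (j != i) ==> (a j == b j)].
  by apply/forallP => e2; apply: nst; split=> // j ji; have /implyP/(_ ji)/eqP := e2 j.
rewrite negb_imply => /andP[ji /negPf ab]; exists j; rewrite ?mem_index_enum //= (negPf ji).
by case: ifP => _; rewrite /vK /vid ab eqxx.
Qed.

Lemma tF_entry a b :
  tF C a b = \sum_i if tstep b a i then q ^ (- rsum (twt b) i) * qz C ((b i)%:Z + 1) else 0.
Proof.
apply: eq_bigr => i _; rewrite /tensmx; case: tstepP => [[e1 e2]|nst].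
  rewrite (bigID (fun j : 'I_k => (i < j)%N)) /= [X in _ * X](bigD1 i) ?ltnn //= eqxx.
  rewrite /vF e1 eqxx [X in _ * (_ * X)]big1 ?mulr1 => [|j /andP[ij /negPf jni]]; last first.
    have ji : (j < i)%N by rewrite ltn_neqAle leqNgt ij andbT; apply/negP => /eqP/val_inj/eqP; rewrite jni.
    by rewrite ji /vid e2 ?eqxx // jni.
  rewrite /rsum -sumrN -expq_sum; congr (_ * _).
    apply: eq_bigr => j ij; have ji : (j == i) = false by rewrite -val_eqE /= gtn_eqF.
    by rewrite ltnNge (ltnW ij) /= ji /vKi -e2 ?ji ?eqxx.
  by rewrite qintE; congr (qz C _); lia.
apply/eqP; rewrite prodf_seq_eq0; apply/hasP.
case: (eqVneq (a i : nat) (b i).+1) => [e1|ne1]; last first.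
  by exists i; rewrite ?mem_index_enum //= ltnn eqxx /vF (negPf ne1) eqxx.
have /forallPn[j] : ~~ [forall j, (j != i) ==> (b j == a j)].
  by apply/forallP => e2; apply: nst; split=> // j ji; have /implyP/(_ ji)/eqP := e2 j.
rewrite negb_imply => /andP[ji]; rewrite eq_sym => /negPf ab; exists j; rewrite ?mem_index_enum //= (negPf ji).
by case: ifP => _; rewrite /vKi /vid ab eqxx.
Qed.

Lemma tK_entry a b : tK C a b = if a == b then q ^ (\sum_i twt b i) else 0.
Proof.
case: eqP => [->|/eqP ab].
  by rewrite -expq_sum; apply: eq_bigr => i _; rewrite /vK eqxx.
apply/eqP; rewrite prodf_seq_eq0; apply/hasP; have /forallPn[j ne] : ~~ [forall j, a j == b j].
  by apply: contra ab => /forallP h; apply/eqP/ffunP => j; apply/eqP/h.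
by exists j; rewrite ?mem_index_enum //= /vK (negPf ne).
Qed.

Lemma tKi_entry a b : tKi C a b = if a == b then q ^ (- \sum_i twt b i) else 0.
Proof.
case: eqP => [->|/eqP ab].
  by rewrite -sumrN -expq_sum; apply: eq_bigr => i _; rewrite /vKi eqxx.
apply/eqP; rewrite prodf_seq_eq0; apply/hasP; have /forallPn[j ne] : ~~ [forall j, a j == b j].
  by apply: contra ab => /forallP h; apply/eqP/ffunP => j; apply/eqP/h.
by exists j; rewrite ?mem_index_enum //= /vKi (negPf ne).
Qed.

Lemma sum_tstep_row (G : tidx e -> K) a i :
  \sum_b (if tstep a b i then G b else 0) = if (a i < e i)%N then G (tset a i (a i).+1) else 0.
Proof.
case: ifP => lt; last first.
  rewrite big1 // => b _; case: tstepP => // -[e1 _]; have := ltn_ord (b i).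
  by rewrite -e1 ltnS lt.
rewrite (bigD1 (tset a i (a i).+1)) //= big1 ?addr0 => [|b nb]; last first.
  case: tstepP => // -[e1 e2]; case/eqP: nb; apply: tset_eq => // j ji.
  by rewrite e2.
rewrite ifT //; apply/tstepP; rewrite tset_same //; split=> // j ji.
by rewrite tset_other.
Qed.

Lemma sum_tstep_col (G : tidx e -> K) b i :
  \sum_a (if tstep a b i then G a else 0) = if (0 < b i)%N then G (tset b i (b i).-1) else 0.
Proof.
have leb : ((b i).-1 <= e i)%N by rewrite (leq_trans (leq_pred _)) // -ltnS.
case: ifP => lt; last first.
  by rewrite big1 // => a _; case: tstepP => // -[e1 _]; move: lt; rewrite -e1.
rewrite (bigD1 (tset b i (b i).-1)) //= big1 ?addr0 => [|a na]; last first.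
  case: tstepP => // -[e1 e2]; case/eqP: na; apply: tset_eq; last by move=> j /e2.
  by rewrite -e1.
rewrite ifT //; apply/tstepP; rewrite tset_same // prednK //; split=> // j ji.
by rewrite tset_other.
Qed.

Lemma tE_row (g : tidx e -> K) a : \sum_b tE C a b * g b =
  \sum_i if (a i < e i)%N
    then q ^ lsum (twt a) i * qz C ((e i)%:Z - (a i)%:Z) * g (tset a i (a i).+1) else 0.
Proof.
under eq_bigr => b _ do rewrite tE_entry mulr_suml.
rewrite exchange_big /=; apply: eq_bigr => i _.
transitivity (\sum_b (if tstep a b i then q ^ lsum (twt b) i * qz C ((e i)%:Z - (b i)%:Z + 1) * g b else 0)).
  by apply: eq_bigr => b _; case: ifP; rewrite ?mul0r.
rewrite sum_tstep_row; case: ifP => // lt; rewrite tset_same //.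
congr (q ^ _ * qz C _ * _); last by lia.
by apply: lsum_agree => j ji; rewrite /twt tset_other.
Qed.

Lemma tE_col (g : tidx e -> K) b : \sum_a g a * tE C a b =
  \sum_i if (0 < b i)%N
    then q ^ lsum (twt b) i * qz C ((e i)%:Z - (b i)%:Z + 1) * g (tset b i (b i).-1) else 0.
Proof.
under eq_bigr => a _ do rewrite tE_entry mulr_sumr.
rewrite exchange_big /=; apply: eq_bigr => i _.
transitivity (\sum_a (if tstep a b i then q ^ lsum (twt b) i * qz C ((e i)%:Z - (b i)%:Z + 1) * g a else 0)).
  by apply: eq_bigr => a _; case: ifP; rewrite ?mulr0 // mulrC.
by rewrite sum_tstep_col.
Qed.

Lemma tF_row (g : tidx e -> K) a : \sum_b tF C a b * g b =
  \sum_i if (0 < a i)%N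
    then q ^ (- rsum (twt a) i) * qz C (a i)%:Z * g (tset a i (a i).-1) else 0.
Proof.
under eq_bigr => b _ do rewrite tF_entry mulr_suml.
rewrite exchange_big /=; apply: eq_bigr => i _.
transitivity (\sum_b (if tstep b a i then q ^ (- rsum (twt b) i) * qz C ((b i)%:Z + 1) * g b else 0)).
  by apply: eq_bigr => b _; case: ifP; rewrite ?mul0r.
have lea : ((a i).-1 <= e i)%N by rewrite (leq_trans (leq_pred _)) // -ltnS.
rewrite sum_tstep_col; case: ifP => // lt; rewrite tset_same //.
congr (q ^ (- _) * qz C _ * _); last by lia.
by apply: rsum_agree => j ji; rewrite /twt tset_other.
Qed.

Lemma tF_col (g : tidx e -> K) b : \sum_a g a * tF C a b =
  \sum_i if (b i < e i)%N
    then q ^ (- rsum (twt b) i) * qz C ((b i)%:Z + 1) * g (tset b i (b i).+1) else 0.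
Proof.
under eq_bigr => a _ do rewrite tF_entry mulr_sumr.
rewrite exchange_big /=; apply: eq_bigr => i _.
transitivity (\sum_a (if tstep b a i then q ^ (- rsum (twt b) i) * qz C ((b i)%:Z + 1) * g a else 0)).
  by apply: eq_bigr => a _; case: ifP; rewrite ?mulr0 // mulrC.
by rewrite sum_tstep_row.
Qed.

Lemma tK_row (g : tidx e -> K) a : \sum_b tK C a b * g b = q ^ (\sum_i twt a i) * g a.
Proof.
rewrite (bigD1 a) //= tK_entry eqxx [X in _ + X]big1 ?addr0 // => b ba.
by rewrite tK_entry eq_sym (negPf ba) mul0r.
Qed.

Lemma tKi_row (g : tidx e -> K) a : \sum_b tKi C a b * g b = q ^ (- \sum_i twt a i) * g a.
Proof.
rewrite (bigD1 a) //= tKi_entry eqxx [X in _ + X]big1 ?addr0 // => b ba.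
by rewrite tKi_entry eq_sym (negPf ba) mul0r.
Qed.

Lemma tK_col (g : tidx e -> K) b : \sum_a g a * tK C a b = q ^ (\sum_i twt b i) * g b.
Proof.
rewrite (bigD1 b) //= tK_entry eqxx [X in _ + X]big1 ?addr0; first by rewrite mulrC.
by move=> a ba; rewrite tK_entry (negPf ba) mulr0.
Qed.

Lemma tKi_col (g : tidx e -> K) b : \sum_a g a * tKi C a b = q ^ (- \sum_i twt b i) * g b.
Proof.
rewrite (bigD1 b) //= tKi_entry eqxx [X in _ + X]big1 ?addr0; first by rewrite mulrC.
by move=> a ba; rewrite tKi_entry (negPf ba) mulr0.
Qed.

End TensorAction.

(** * Explicit matrices for iota and pi *)

Section IotaPi.
Variable C : numFieldType.
Local Notation K := C`(q).
Local Notation q := (qq C).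

Lemma opmxE (I J : finType) (M : I -> J -> K) f a : opmx M f a = \sum_b M a b * f b.
Proof. by rewrite /opmx lfunE /= ffunE. Qed.

Lemma opmx_basis (I J : finType) (M : I -> J -> K) b a : opmx M (basis C b) a = M a b.
Proof.
rewrite opmxE (bigD1 b) //= ffunE eqxx mulr1 big1 ?addr0 // => c cb.
by rewrite ffunE (negPf cb) mulr0.
Qed.

Lemma opmx_comm (I J : finType) (P : I -> J -> K) (A : J -> J -> K) (B : I -> I -> K) :
  (forall a c, \sum_b P a b * A b c = \sum_b B a b * P b c) ->
  forall f, opmx P (opmx A f) = opmx B (opmx P f).
Proof.
move=> PAB f; apply/ffunP => a; rewrite !opmxE.
under eq_bigr => b _ do rewrite opmxE mulr_sumr.
under [RHS]eq_bigr => b _ do rewrite opmxE mulr_sumr.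
rewrite exchange_big /= [RHS]exchange_big /=; apply: eq_bigr => c _.
under eq_bigr => b _ do rewrite mulrA.
under [RHS]eq_bigr => b _ do rewrite mulrA.
by rewrite -!mulr_suml PAB.
Qed.

Lemma fvec_basis (I : finType) (f : fvec C I) : f = \sum_i f i *: basis C i.
Proof.
apply/ffunP => a; rewrite sum_ffunE; transitivity (\sum_i f i * (a == i)%:R).
  rewrite (bigD1 a) //= eqxx mulr1 big1 ?addr0 // => b ba.
  by rewrite eq_sym (negPf ba) mulr0.
by apply: eq_bigr => i _; rewrite !ffunE.
Qed.

Lemma hom_basis_eq (I : finType) (W : vectType K) (g h : 'Hom(fvec C I, W)) :
  (forall i, g (basis C i) = h (basis C i)) -> g = h.
Proof.
move=> gh; apply/lfunP => f; rewrite (fvec_basis f) !linear_sum; apply: eq_bigr => i _.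
by rewrite !linearZ /= gh.
Qed.

Variable n : nat.
Local Notation e1 := (fun _ : 'I_n => 1%N).
Implicit Types (z y : tidx e1) (u : 'I_n.+1).

Definition zl (z : tidx e1) : 'I_n -> int := fun j => (z j)%:Z.
Definition zc (z : tidx e1) : 'I_n -> int := fun j => 1 - (z j)%:Z.
Definition cnt (z : tidx e1) : nat := (\sum_j z j)%N.

(** For a word in 0 and 1 this counts the pairs with 1 before 0, and [inv01] those with 0 before 1.
    The polynomial form makes the effect of changing one letter a computation. *)
Definition inv10 (m : 'I_n -> int) : int := \sum_(a : 'I_n) \sum_(b : 'I_n | (a < b)%N) m a * (1 - m b).
Definition inv01 (m : 'I_n -> int) : int := \sum_(a : 'I_n) \sum_(b : 'I_n | (a < b)%N) (1 - m a) * m b.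

Lemma sum_pulse_mul (m : 'I_n -> int) i c : \sum_a pulse i c a * m a = c * m i.
Proof.
rewrite (bigD1 i) //= /pulse eqxx big1 ?addr0 // => j ji.
by rewrite (negPf ji) mul0r.
Qed.

Lemma pulse_pulse0 i c (P : rel 'I_n) : ~~ P i i ->
  \sum_a \sum_(b | P a b) pulse i c a * pulse i c b = 0.
Proof.
move=> Pi; rewrite big1 // => a _; rewrite big1 // => b Pab.
rewrite /pulse; case: eqP Pab => [->|]; rewrite ?mul0r //.
by case: eqP => [->|]; rewrite ?mulr0 // (negPf Pi).
Qed.

Lemma sum_pulse_right (m : 'I_n -> int) i c :
  \sum_(a : 'I_n) \sum_(b : 'I_n | (a < b)%N) pulse i c a * m b = c * rsum m i.
Proof.
rewrite -(sum_pulse_mul (fun a => rsum m a)); apply: eq_bigr => a _.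
by rewrite -mulr_sumr.
Qed.

Lemma sum_pulse_left (m : 'I_n -> int) i c :
  \sum_(a : 'I_n) \sum_(b : 'I_n | (a < b)%N) pulse i c b * m a = c * lsum m i.
Proof.
rewrite -(sum_pulse_mul (fun b => lsum m b)) (exchange_big_dep xpredT) //=.
by apply: eq_bigr => b _; rewrite -mulr_sumr.
Qed.

Lemma inv10_pulse (m : 'I_n -> int) i c :
  inv10 (fun j => m j + pulse i c j) =
  inv10 m + c * (rsum (fun j => 1 - m j) i - lsum m i).
Proof.
have e (a b : 'I_n) : (m a + pulse i c a) * (1 - (m b + pulse i c b)) =
  m a * (1 - m b) + (pulse i c a * (1 - m b) - pulse i c b * m a - pulse i c a * pulse i c b) by lia.
rewrite /inv10; under eq_bigr => a _ do under eq_bigr => b _ do rewrite e.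
under eq_bigr => a _ do rewrite big_split /= !sumrB.
rewrite big_split /= !sumrB (@pulse_pulse0 i c (fun a b : 'I_n => (a < b)%N)) ?ltnn // subr0.
by rewrite sum_pulse_right sum_pulse_left mulrBr.
Qed.

Lemma inv01_pulse (m : 'I_n -> int) i c :
  inv01 (fun j => m j + pulse i c j) =
  inv01 m + c * (lsum (fun j => 1 - m j) i - rsum m i).
Proof.
have e (a b : 'I_n) : (1 - (m a + pulse i c a)) * (m b + pulse i c b) =
  (1 - m a) * m b + (pulse i c b * (1 - m a) - pulse i c a * m b - pulse i c a * pulse i c b) by lia.
rewrite /inv01; under eq_bigr => a _ do under eq_bigr => b _ do rewrite e.
under eq_bigr => a _ do rewrite big_split /= !sumrB.
rewrite big_split /= !sumrB (@pulse_pulse0 i c (fun a b : 'I_n => (a < b)%N)) ?ltnn // subr0.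
by rewrite sum_pulse_right sum_pulse_left mulrBr.
Qed.

Lemma zl_tset z i c : (c <= 1)%N -> zl (tset z i c) = fun j => zl z j + pulse i (c%:Z - zl z i) j.
Proof.
move=> c1; apply/funext => j; rewrite /zl /pulse; case: (eqVneq j i) => [->|ji].
  by rewrite tset_same //; lia.
by rewrite tset_other // addr0.
Qed.

Lemma sum_zl z : \sum_j zl z j = (cnt z)%:Z.
Proof. by rewrite /cnt (big_morph Posz PoszD (erefl _)). Qed.

Lemma sum_zc z : \sum_j zc z j = n%:Z - (cnt z)%:Z.
Proof. by rewrite sumrB sum_zl sumr_const card_ord -[_ *+ _]mulr_natl mulr1; lia. Qed.

Lemma cnt_tset z i c : (c <= 1)%N -> (cnt (tset z i c))%:Z = (cnt z)%:Z + c%:Z - zl z i.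
Proof.
move=> c1; rewrite -!sum_zl zl_tset // (sum_pulse xpredT) /=; lia.
Qed.

Lemma cnt_le z : (cnt z <= n)%N.
Proof.
rewrite /cnt -[leqRHS]card_ord -sum1_card; apply: leq_sum => j _; exact: ltn_ord (z j).
Qed.

Lemma twt1 z j : twt z j = zc z j - zl z j.
Proof. by rewrite /twt /zc /zl; lia. Qed.

Lemma lsum_twt z i : lsum (twt z) i = lsum (zc z) i - lsum (zl z) i.
Proof. by rewrite /lsum -sumrB; apply: eq_bigr => j _; exact: twt1. Qed.

Lemma rsum_twt z i : rsum (twt z) i = rsum (zc z) i - rsum (zl z) i.
Proof. by rewrite /rsum -sumrB; apply: eq_bigr => j _; exact: twt1. Qed.

Lemma sum_twt z : \sum_i twt z i = n%:Z - 2 * (cnt z)%:Z.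
Proof.
under eq_bigr do rewrite twt1; rewrite sumrB sum_zc sum_zl; lia.
Qed.

Lemma vE_row (g : 'I_n.+1 -> K) u : \sum_v vE C u v * g v =
  if (u < n)%N then qz C (n%:Z - u%:Z) * g (inord u.+1) else 0.
Proof.
case: ifP => lt; last first.
  rewrite big1 // => v _; rewrite /vE ifF ?mul0r //; apply/negP => /eqP uv.
  by have := ltn_ord v; rewrite -uv ltnS lt.
rewrite (bigD1 (inord u.+1)) //= big1 ?addr0 => [|v uv].
  by rewrite /vE inordK // eqxx qintE; congr (qz C _ * _); lia.
rewrite /vE ifF ?mul0r //; apply: contraNF uv => /eqP uv.
by apply/eqP/val_inj; rewrite /= uv inord_val.
Qed.

Lemma vE_col (g : 'I_n.+1 -> K) u : \sum_v g v * vE C v u =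
  if (0 < u)%N then qz C (n%:Z - u%:Z + 1) * g (inord u.-1) else 0.
Proof.
case: ifP => lt; last first.
  rewrite big1 // => v _; rewrite /vE ifF ?mulr0 //; apply/negP => /eqP uv.
  by move: lt; rewrite -uv.
have lu : (u.-1 < n.+1)%N by rewrite (leq_ltn_trans (leq_pred _)).
rewrite (bigD1 (inord u.-1)) //= big1 ?addr0 => [|v uv].
  by rewrite /vE inordK // prednK // eqxx mulrC qintE; congr (qz C _ * _); have := ltn_ord u; lia.
rewrite /vE ifF ?mulr0 //; apply: contraNF uv => /eqP uv.
by apply/eqP/val_inj; rewrite /= inordK // -uv.
Qed.

Lemma vF_row (g : 'I_n.+1 -> K) u : \sum_v vF C u v * g v =
  if (0 < u)%N then qz C u%:Z * g (inord u.-1) else 0.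
Proof.
case: ifP => lt; last first.
  rewrite big1 // => v _; rewrite /vF ifF ?mul0r //; apply/negP => /eqP uv.
  by move: lt; rewrite uv.
have lu : (u.-1 < n.+1)%N by rewrite (leq_ltn_trans (leq_pred _)).
rewrite (bigD1 (inord u.-1)) //= big1 ?addr0 => [|v uv].
  by rewrite /vF inordK // prednK // eqxx qintE.
rewrite /vF ifF ?mul0r //; apply: contraNF uv => /eqP uv.
by apply/eqP/val_inj; rewrite /= inordK // uv.
Qed.

Lemma vF_col (g : 'I_n.+1 -> K) u : \sum_v g v * vF C v u =
  if (u < n)%N then qz C (u%:Z + 1) * g (inord u.+1) else 0.
Proof.
case: ifP => lt; last first.
  rewrite big1 // => v _; rewrite /vF ifF ?mulr0 //; apply/negP => /eqP uv.
  by have := ltn_ord v; rewrite uv ltnS lt.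
rewrite (bigD1 (inord u.+1)) //= big1 ?addr0 => [|v uv].
  by rewrite /vF inordK // eqxx mulrC qintE; congr (qz C _ * _); lia.
rewrite /vF ifF ?mulr0 //; apply: contraNF uv => /eqP uv.
by apply/eqP/val_inj; rewrite /= -uv inord_val.
Qed.

Lemma vK_row (g : 'I_n.+1 -> K) u : \sum_v vK C u v * g v = q ^ (n%:Z - 2 * u%:Z) * g u.
Proof.
rewrite (bigD1 u) //= /vK eqxx [X in _ + X]big1 ?addr0 // => v uv.
by rewrite eq_sym (negPf uv) mul0r.
Qed.

Lemma vK_col (g : 'I_n.+1 -> K) u : \sum_v g v * vK C v u = q ^ (n%:Z - 2 * u%:Z) * g u.
Proof.
rewrite (bigD1 u) //= /vK eqxx [X in _ + X]big1 ?addr0 1?mulrC // => v uv.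
by rewrite (negPf uv) mulr0.
Qed.

Lemma vKi_row (g : 'I_n.+1 -> K) u : \sum_v vKi C u v * g v = q ^ (- (n%:Z - 2 * u%:Z)) * g u.
Proof.
rewrite (bigD1 u) //= /vKi eqxx [X in _ + X]big1 ?addr0 // => v uv.
by rewrite eq_sym (negPf uv) mul0r.
Qed.

Lemma vKi_col (g : 'I_n.+1 -> K) u : \sum_v g v * vKi C v u = q ^ (- (n%:Z - 2 * u%:Z)) * g u.
Proof.
rewrite (bigD1 u) //= /vKi eqxx [X in _ + X]big1 ?addr0 1?mulrC // => v uv.
by rewrite (negPf uv) mulr0.
Qed.

Definition iota_coef z u : K := if cnt z == u then q ^ (- inv10 (zl z)) else 0.

Lemma qz1 : qz C 1 = 1.
Proof. by rewrite /qz expr1z exprN1 divff // qden_neq0. Qed.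

Lemma bit_cases z i : z i = 0%N :> nat \/ z i = 1%N :> nat.
Proof. by case: (z i) => [[|[]]] //= _; [left|right]. Qed.

(** Changing a letter 0 at i to 1 alters [inv10], and together with the power of q from K on the
    left the exponent becomes the one of [qz_telescope] for [zc z], whose sum is n - cnt z. The
    other three of the E and F identities for iota and pi work the same way. *)
Lemma iota_E z u : \sum_v iota_coef z v * vE C v u = \sum_y tE C z y * iota_coef y u.
Proof.
rewrite vE_col tE_row.
have lu : (u.-1 < n.+1)%N by rewrite (leq_ltn_trans (leq_pred _)).
transitivity (if (cnt z).+1 == u then q ^ (- inv10 (zl z)) * qz C (\sum_j zc z j) else 0).
  rewrite /iota_coef inordK //; case: (posnP u) => [->|u0] //=.
  rewrite -(eqn_add2r 1) !addn1 prednK //; case: eqP => [e|_]; last by rewrite mulr0.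
  by rewrite mulrC sum_zc; congr (_ * qz C _); lia.
rewrite -qz_telescope; case: ifP => zu; last first.
  rewrite big1 // => i _; case: ifP => // zi; rewrite /iota_coef ifF ?mulr0 //.
  have := cnt_tset z i (c := (z i).+1) zi; rewrite /zl.
  by move=> e; apply/negP => /eqP h; move/negP: zu; apply; apply/eqP; lia.
rewrite mulr_sumr; apply: eq_bigr => i _; case: (bit_cases z i) => zi; rewrite /zc zi /=; last first.
  by rewrite subrr qz0 !mulr0.
rewrite subr0 qz1 !mulr1 /iota_coef ifT.
  rewrite -!expfzDr ?qq_neq0 // zl_tset // inv10_pulse lsum_twt; congr (q ^ _).
  by rewrite /zl zi -/(zl z) -/(zc z); lia.
have := cnt_tset z i (c := 1) isT; rewrite /zl zi => e; apply/eqP; move/eqP: zu; lia.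
Qed.

Lemma iota_F z u : \sum_v iota_coef z v * vF C v u = \sum_y tF C z y * iota_coef y u.
Proof.
rewrite vF_col tF_row.
transitivity (if cnt z == u.+1 then q ^ (- inv10 (zl z)) * qz C (\sum_j zl z j) else 0).
  rewrite /iota_coef; case: ifP => lt.
    by rewrite inordK //; case: eqP => [e|_]; rewrite ?mulr0 // mulrC sum_zl e; congr (_ * qz C _); lia.
  by rewrite ifF //; apply/negP => /eqP e; have := cnt_le z; rewrite e lt.
rewrite -qz_telescope_rev; case: ifP => zu; last first.
  rewrite big1 // => i _; case: (bit_cases z i) => zi; rewrite zi //= /iota_coef ifF ?mulr0 //.
  have := cnt_tset z i (c := 0) isT; rewrite /zl zi.
  by move=> e; apply/negP => /eqP h; move/negP: zu; apply; apply/eqP; lia.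
rewrite mulr_sumr; apply: eq_bigr => i _; case: (bit_cases z i) => zi; have zli : zl z i = (z i)%:Z by []; rewrite zi in zli; rewrite zli zi /=.
  by rewrite qz0 !mulr0.
rewrite qz1 !mulr1 /iota_coef ifT.
  rewrite -!expfzDr ?qq_neq0 // zl_tset // inv10_pulse rsum_twt; congr (q ^ _).
  by rewrite /zl zi -/(zl z) -/(zc z); lia.
have := cnt_tset z i (c := 0) isT; rewrite /zl zi => e; apply/eqP; move/eqP: zu; lia.
Qed.

Lemma iota_K z u : \sum_v iota_coef z v * vK C v u = \sum_y tK C z y * iota_coef y u.
Proof.
rewrite vK_col tK_row sum_twt /iota_coef; case: eqP => [->|_] //.
by rewrite !mulr0.
Qed.

Lemma iota_Ki z u : \sum_v iota_coef z v * vKi C v u = \sum_y tKi C z y * iota_coef y u.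
Proof.
rewrite vKi_col tKi_row sum_twt /iota_coef; case: eqP => [->|_] //.
by rewrite !mulr0.
Qed.

(** The inverse of the quantum binomial of n over u, forced by equivariance and the value 1 at u =
    0. *)
Fixpoint pi_norm (u : nat) : K :=
  if u is v.+1 then pi_norm v * qz C u%:Z / qz C (n%:Z - v%:Z) else 1.

Lemma pi_normS v : (v < n)%N -> qz C (n%:Z - v%:Z) * pi_norm v.+1 = pi_norm v * qz C v.+1%:Z.
Proof. by move=> lt; rewrite /= mulrC divfK // qz_eq0; lia. Qed.

Definition pi_coef u z : K := if cnt z == u then pi_norm u * q ^ inv01 (zl z) else 0.

Lemma pi_E u z : \sum_y pi_coef u y * tE C y z = \sum_v vE C u v * pi_coef v z.
Proof.
rewrite vE_row tE_col.
transitivity (if cnt z == u.+1 then pi_norm u * q ^ inv01 (zl z) * qz C (\sum_j zl z j) else 0); last first.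
  rewrite /pi_coef; case: (ltnP u n) => lt.
    rewrite inordK //; case: (eqVneq (cnt z) u.+1) => [e|_]; last by rewrite mulr0.
    by rewrite sum_zl e mulrA pi_normS // mulrAC.
  by rewrite ifF //; apply/negP => /eqP e; have := cnt_le z; rewrite e ltnNge lt.
rewrite -qz_telescope_rev; case: ifP => zu; last first.
  rewrite big1 // => i _; case: (bit_cases z i) => zi; rewrite zi //= /pi_coef ifF ?mulr0 //.
  have := cnt_tset z i (c := 0) isT; rewrite /zl zi.
  by move=> e; apply/negP => /eqP h; move/negP: zu; apply; apply/eqP; lia.
rewrite mulr_sumr; apply: eq_bigr => i _; case: (bit_cases z i) => zi; have zli : zl z i = (z i)%:Z by []; rewrite zi in zli; rewrite zli zi /=.
  by rewrite qz0 !mulr0.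
rewrite subrr add0r qz1 !mulr1 /pi_coef ifT.
  rewrite mulrCA -mulrA -!expfzDr ?qq_neq0 // zl_tset // inv01_pulse lsum_twt; congr (_ * q ^ _).
  by rewrite /zl zi -/(zl z) -/(zc z); lia.
have := cnt_tset z i (c := 0) isT; rewrite /zl zi => e; apply/eqP; move/eqP: zu; lia.
Qed.

Lemma pi_F u z : \sum_y pi_coef u y * tF C y z = \sum_v vF C u v * pi_coef v z.
Proof.
rewrite vF_row tF_col.
have lu : (u.-1 < n.+1)%N by rewrite (leq_ltn_trans (leq_pred _)).
transitivity (if (cnt z).+1 == u then pi_norm u * q ^ inv01 (zl z) * qz C (\sum_j zc z j) else 0); last first.
  rewrite /pi_coef inordK //; have := ltn_ord u; case: (nat_of_ord u) => [|v] //= lv.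
  rewrite eqSS; case: (eqVneq (cnt z) v) => [e|_]; last by rewrite mulr0.
  by rewrite sum_zc e mulrAC [pi_norm v.+1 * _]mulrC pi_normS // mulrAC mulrC.
rewrite -qz_telescope; case: ifP => zu; last first.
  rewrite big1 // => i _; case: ifP => // zi; rewrite /pi_coef ifF ?mulr0 //.
  have := cnt_tset z i (c := (z i).+1) zi; rewrite /zl.
  by move=> e; apply/negP => /eqP h; move/negP: zu; apply; apply/eqP; lia.
rewrite mulr_sumr; apply: eq_bigr => i _; case: (bit_cases z i) => zi; have zci : zc z i = 1 - (z i)%:Z by []; rewrite zi in zci; rewrite zci zi /=.
  rewrite add0r subr0 qz1 !mulr1 /pi_coef ifT.
    rewrite mulrCA -mulrA -!expfzDr ?qq_neq0 // zl_tset // inv01_pulse rsum_twt; congr (_ * q ^ _).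
    by rewrite /zl zi -/(zl z) -/(zc z); lia.
  have := cnt_tset z i (c := 1) isT; rewrite /zl zi => e; apply/eqP; move/eqP: zu; lia.
by rewrite subrr qz0 !mulr0.
Qed.

Lemma pi_K u z : \sum_y pi_coef u y * tK C y z = \sum_v vK C u v * pi_coef v z.
Proof.
rewrite vK_row tK_col sum_twt /pi_coef; case: eqP => [->|_] //.
by rewrite !mulr0.
Qed.

Lemma pi_Ki u z : \sum_y pi_coef u y * tKi C y z = \sum_v vKi C u v * pi_coef v z.
Proof.
rewrite vKi_row tKi_col sum_twt /pi_coef; case: eqP => [->|_] //.
by rewrite !mulr0.
Qed.

End IotaPi.

Section IotaPiMaps.
Variables (C : numFieldType) (n : nat).
Local Notation K := C`(q).
Local Notation q := (qq C).
Local Notation e1 := (fun _ : 'I_n => 1%N).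
Implicit Types (z y : tidx e1) (u : 'I_n.+1).

Lemma iota_coef_hom : uq_hom (vops C n) (v1ops C n) predT predT (opmx (@iota_coef C n)).
Proof.
move=> f _; split=> //; split; apply: opmx_comm => z u.
- exact: iota_E.
- exact: iota_F.
- exact: iota_K.
- exact: iota_Ki.
Qed.

Lemma pi_coef_hom : uq_hom (v1ops C n) (vops C n) predT predT (opmx (@pi_coef C n)).
Proof.
move=> f _; split=> //; split; apply: opmx_comm => z u.
- exact: pi_E.
- exact: pi_F.
- exact: pi_K.
- exact: pi_Ki.
Qed.

Lemma cnt_eq0 z : cnt z = 0%N -> z = finfun (fun _ => ord0).
Proof.
move=> /eqP; rewrite sum_nat_eq0 => /forallP z0; apply/ffunP => j.
by apply/val_inj; rewrite ffunE /=; apply/eqP/(implyP (z0 j)).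
Qed.

Lemma cnt_top : cnt (finfun (fun _ : 'I_n => ord0 : 'I_2) : tidx e1) = 0%N.
Proof. by rewrite /cnt big1 // => j _; rewrite ffunE. Qed.

Lemma iota_coef_top : opmx (@iota_coef C n) (basis C ord0) = v1top C n.
Proof.
apply/ffunP => z; rewrite opmx_basis /iota_coef ffunE.
case: (eqVneq z _) => [->|zt].
  rewrite cnt_top eqxx /inv10 big1 ?oppr0 ?expr0z // => a _.
  by rewrite big1 // => b _; rewrite /zl ffunE mul0r.
rewrite ifF //; apply: contraNF zt => /eqP cz; apply/eqP/cnt_eq0.
exact: cz.
Qed.

Lemma pi_coef_top : opmx (@pi_coef C n) (v1top C n) = basis C ord0.
Proof.
apply/ffunP => u; rewrite opmx_basis /pi_coef ffunE cnt_top.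
case: (eqVneq u ord0) => [->|u0].
  rewrite eqxx /= mul1r /inv01 big1 ?expr0z // => a _.
  by rewrite big1 // => b _; rewrite /zl !ffunE mulr0.
by rewrite ifF //; apply: contraNF u0 => /eqP cz; apply/eqP/val_inj.
Qed.

(** The map chosen in [iota_map] is unique, because F carries each basis vector of V_n to a nonzero
    multiple of the next one. *)
Lemma iota_mapE u z : iota_map C n (basis C u) z = iota_coef C z u.
Proof.
rewrite /iota_map (xget_unique 0 (x := opmx (@iota_coef C n))) ?opmx_basis //.
  by split; [exact: iota_coef_hom | exact: iota_coef_top].
move=> g [ghom gtop]; apply: hom_basis_eq => v.
have stepF m : (m < n)%N -> uF (vops C n) (basis C (inord m)) = qz C (m%:Z + 1) *: basis C (inord m.+1).
  move=> lt; apply/ffunP => w; rewrite opmx_basis !ffunE /GRing.scale /= /vF inordK 1?ltnW //.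
  have -> : (w == inord m.+1) = (nat_of_ord w == m.+1) by rewrite -val_eqE /= inordK.
  case: (nat_of_ord w == m.+1); rewrite /= ?mulr0n ?mulr0 // mulr1n mulr1 qintE.
  by congr (qz C _); lia.
have -> : v = inord (nat_of_ord v) by apply/val_inj; rewrite /= inordK.
move: (nat_of_ord v) (ltn_ord v); elim=> [|m IH] lt.
  have -> : inord 0 = ord0 :> 'I_n.+1 by apply/val_inj; rewrite /= inordK.
  by rewrite gtop iota_coef_top.
have {}IH := IH (ltnW lt).
have nz : qz C (m%:Z + 1) != 0 by rewrite qz_eq0; lia.
have -> : basis C (inord m.+1) = (qz C (m%:Z + 1))^-1 *: uF (vops C n) (basis C (inord m)).
  by rewrite stepF // scalerA mulVf // scale1r.
rewrite !linearZ /=; congr (_ *: _).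
have [_ [_ gF _ _]] := ghom (basis C (inord m)) isT; rewrite gF IH.
by have [_ [_ -> _ _]] := @iota_coef_hom (basis C (inord m)) isT.
Qed.

(** V_1^(x n) is in general not generated by its highest weight vector, so the argument for iota
    does not carry over. What is kept of [pi_map] is its equivariance and its value at the top;
    [pi_coef] shows that such a map exists. *)
Lemma pi_map_hom : uq_hom (v1ops C n) (vops C n) predT predT (pi_map C n) /\
  pi_map C n (v1top C n) = basis C ord0.
Proof.
rewrite /pi_map; case: xgetP => [g -> //|/(_ (opmx (@pi_coef C n)))]; case.
by split; [exact: pi_coef_hom | exact: pi_coef_top].
Qed.

Definition pic (a : 'I_n.+1) (z : tidx e1) : K := pi_map C n (basis C z) a.
Definition iotac (z : tidx e1) (u : 'I_n.+1) : K := iota_map C n (basis C u) z.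

Lemma iotacE z u : iotac z u = iota_coef C z u.
Proof. exact: iota_mapE. Qed.

Lemma pi_map_opmx : pi_map C n = opmx pic.
Proof. by apply: hom_basis_eq => z; apply/ffunP => a; rewrite opmx_basis. Qed.

Lemma opmx_entry (I J : finType) (P : I -> J -> K) (A : J -> J -> K) (B : I -> I -> K) :
  (forall f, opmx P (opmx A f) = opmx B (opmx P f)) ->
  forall a c, \sum_b P a b * A b c = \sum_b B a b * P b c.
Proof.
move=> h a c; transitivity (opmx P (opmx A (basis C c)) a).
  by rewrite opmxE; apply: eq_bigr => b _; rewrite opmx_basis.
by rewrite h opmxE; apply: eq_bigr => b _; rewrite opmx_basis.
Qed.

Lemma pic_E a z : \sum_y pic a y * tE C y z = \sum_b vE C a b * pic b z.
Proof.
apply: opmx_entry => f; rewrite -pi_map_opmx.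
by have [/(_ f isT)[_ [-> _ _ _]] _] := pi_map_hom.
Qed.

Lemma pic_F a z : \sum_y pic a y * tF C y z = \sum_b vF C a b * pic b z.
Proof.
apply: opmx_entry => f; rewrite -pi_map_opmx.
by have [/(_ f isT)[_ [_ -> _ _]] _] := pi_map_hom.
Qed.

Lemma pic_K a z : \sum_y pic a y * tK C y z = \sum_b vK C a b * pic b z.
Proof.
apply: opmx_entry => f; rewrite -pi_map_opmx.
by have [/(_ f isT)[_ [_ _ -> _]] _] := pi_map_hom.
Qed.

Lemma pic_cnt a z : pic a z != 0 -> cnt z = a :> nat.
Proof.
move=> nz; have := pic_K a z; rewrite tK_col vK_row sum_twt => /(mulIf nz)/expq_inj.
by lia.
Qed.

Lemma pic_top : pic ord0 (finfun (fun _ => ord0)) = 1.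
Proof.
rewrite /pic; have [_] := pi_map_hom; rewrite /v1top => ->.
by rewrite ffunE eqxx.
Qed.

Lemma iotac_cnt z u : iotac z u != 0 -> cnt z = u :> nat.
Proof. by rewrite iotacE /iota_coef; case: ifP => [/eqP //|_ /eqP]. Qed.

Lemma iotac_neq0 z u : cnt z = u -> iotac z u != 0.
Proof. by rewrite iotacE /iota_coef => ->; rewrite eqxx expfz_neq0 ?qq_neq0. Qed.

(** The entry (z, u) of iota composed with E, computed on either side. The next three lemmas do the
    same for F and for pi; in this form E and F act by changing single letters. *)
Lemma iotac_up z (u : 'I_n.+1) :
  (if (0 < u)%N then qz C (n%:Z - u%:Z + 1) * iotac z (inord u.-1) else 0) =
  \sum_i if z i == 0%N :> nat then q ^ lsum (twt z) i * iotac (tset z i 1) u else 0.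
Proof.
rewrite -vE_col; under eq_bigr do rewrite iotacE; rewrite iota_E tE_row.
apply: eq_bigr => i _; case: (bit_cases z i) => zi; rewrite zi //= qz1 mulr1.
by rewrite iotacE.
Qed.

Lemma iotac_down z (u : 'I_n.+1) :
  (if (u < n)%N then qz C (u%:Z + 1) * iotac z (inord u.+1) else 0) =
  \sum_i if z i == 1%N :> nat then q ^ (- rsum (twt z) i) * iotac (tset z i 0) u else 0.
Proof.
rewrite -vF_col; under eq_bigr do rewrite iotacE; rewrite iota_F tF_row.
apply: eq_bigr => i _; case: (bit_cases z i) => zi; rewrite zi //= qz1 mulr1.
by rewrite iotacE.
Qed.

Lemma pic_up (a : 'I_n.+1) z :
  (if (a < n)%N then qz C (n%:Z - a%:Z) * pic (inord a.+1) z else 0) =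
  \sum_i if z i == 1%N :> nat then q ^ lsum (twt z) i * pic a (tset z i 0) else 0.
Proof.
rewrite -(vE_row (fun a => pic a z)) -pic_E tE_col; apply: eq_bigr => i _.
by case: (bit_cases z i) => zi; rewrite zi //= subrr add0r qz1 mulr1.
Qed.

Lemma pic_down (a : 'I_n.+1) z :
  (if (0 < a)%N then qz C a%:Z * pic (inord a.-1) z else 0) =
  \sum_i if z i == 0%N :> nat then q ^ (- rsum (twt z) i) * pic a (tset z i 1) else 0.
Proof.
rewrite -(vF_row (fun a => pic a z)) -pic_F tF_col; apply: eq_bigr => i _.
by case: (bit_cases z i) => zi; rewrite zi //= add0r qz1 mulr1.
Qed.

End IotaPiMaps.

(** * Contraction along a match *)

Section Vertices.
Variables (k : nat) (d : 'I_k -> nat).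
Local Notation vx := (vertex d).
Implicit Types (u v : vx).

Definition vtx (i : 'I_k) (l : 'I_(d i)) : vx := Tagged (fun i => 'I_(d i)) l.

Lemma sum_vertex (A : nmodType) (P : pred vx) (g : vx -> A) :
  \sum_(v | P v) g v = \sum_i \sum_(l : 'I_(d i) | P (vtx l)) g (vtx l).
Proof.
rewrite (sig_big_dep xpredT (fun i (l : 'I_(d i)) => P (vtx l)) (fun i l => g (vtx l))) /=.
by apply: eq_big => -[i l].
Qed.

(** The position of a vertex among all vertices, which turns [vlt] into the order of [nat]. *)
Definition vidx v : nat := (psum (ext0 d) (tag v) + tagged v)%N.

Lemma psum_mono (f : nat -> nat) i j : (i <= j)%N -> (psum f i <= psum f j)%N.
Proof. by move=> /subnKC <-; elim: (j - i)%N => [|m IH]; rewrite ?addn0 // addnS psumS (leq_trans IH) ?leq_addr. Qed.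

Lemma vidx_ltS v : (vidx v < psum (ext0 d) (tag v).+1)%N.
Proof. by rewrite psumS ext0E ltn_add2l ltn_ord. Qed.

Lemma vidx_tag_lt u v : (tag u < tag v)%N -> (vidx u < vidx v)%N.
Proof.
move=> uv; apply: leq_trans (vidx_ltS u) _; apply: leq_trans (leq_addr _ _).
exact: psum_mono.
Qed.

Lemma vltE u v : vlt u v = (vidx u < vidx v)%N.
Proof.
rewrite /vlt; case: (ltngtP (tag u) (tag v)) => [uv|vu|/val_inj euv] /=.
- by rewrite vidx_tag_lt.
- rewrite -val_eqE /= gtn_eqF //=; apply/esym/negbTE; rewrite -leqNgt ltnW //.
  exact: vidx_tag_lt.
have -> : (tag u == tag v) = true by apply/eqP.
have e : psum (ext0 d) (tag u) = psum (ext0 d) (tag v) by rewrite euv.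
by rewrite /vidx e ltn_add2l.
Qed.

Lemma vidx_inj : injective vidx.
Proof.
move=> u v; case: (ltngtP (tag u) (tag v)) => [uv|vu|].
- by have := vidx_tag_lt uv; move=> /ltn_eqF + e; rewrite e eqxx.
- by have := vidx_tag_lt vu; move=> /gtn_eqF + e; rewrite e eqxx.
case: u => i l; case: v => j m /= /val_inj eij; case: j / eij m => m.
by rewrite /vidx /= => /addnI/val_inj->.
Qed.

Section Labels.
Local Notation label := {ffun vx -> 'I_2}.
Implicit Types (x y : label) (S : {set vx * vx}).

Definition setv x v (c : nat) : label := [ffun u => if u == v then inord c else x u].
Definition wv x v : int := 1 - 2 * (x v)%:Z.

Lemma setv_same x v c : (c <= 1)%N -> setv x v c v = c :> nat.
Proof. by move=> c1; rewrite ffunE eqxx inordK. Qed.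

Lemma setv_other x v c u : u != v -> setv x v c u = x u.
Proof. by move=> uv; rewrite ffunE (negPf uv). Qed.

Definition frees S (i : 'I_k) : seq 'I_(d i) := [seq l <- enum 'I_(d i) | ~~ matched S (vtx l)].

Lemma frees_uniq S i : uniq (frees S i).
Proof. by rewrite filter_uniq // enum_uniq. Qed.

Lemma frees_sorted S i : sorted (fun l m : 'I_(d i) => (l < m)%N) (frees S i).
Proof.
apply: sorted_filter; first by move=> a b c; exact: ltn_trans.
by have := iota_ltn_sorted 0 (d i); rewrite -val_enum_ord sorted_map.
Qed.

Section Boxes.
Variables (S : {set vx * vx}) (e : 'I_k -> nat).
Hypothesis size_frees : forall i, size (frees S i) = e i.

Definition ftup i : (e i).-tuple 'I_(d i) := Tuple (introT eqP (size_frees i)).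
Definition fvtx i (j : 'I_(e i)) : vx := vtx (tnth (ftup i) j).

Definition fidx x i : tidx (fun _ : 'I_(e i) => 1%N) := free_idx S x i (e i).

Lemma fidxE x i j : fidx x i j = x (fvtx j).
Proof.
rewrite /fidx ffunE /fvtx (tnth_nth (tnth (ftup i) j)) (nth_map (tnth (ftup i) j)) //.
by rewrite -[X in (_ < X)%N]/(size (frees S i)) size_frees ltn_ord.
Qed.

Lemma fvtx_inj i : injective (@fvtx i).
Proof.
move=> j j' /eqP; rewrite eq_Tagged /= => /eqP; apply/tuple_uniqP/frees_uniq.
Qed.

Lemma fvtx_lt i (j j' : 'I_(e i)) : (tnth (ftup i) j < tnth (ftup i) j')%N = (j < j')%N.
Proof.
have tr : transitive (fun l m : 'I_(d i) => (l < m)%N) by move=> a b c; exact: ltn_trans.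
have lt_mono (a b : 'I_(e i)) : (a < b)%N -> (tnth (ftup i) a < tnth (ftup i) b)%N.
  move=> ab; have x0 : 'I_(d i) := tnth (ftup i) a; rewrite !(tnth_nth x0).
  apply: (sorted_ltn_nth tr _ (frees_sorted S i)) => //; rewrite inE size_frees; exact: ltn_ord.
case: (ltngtP j j') => [/lt_mono//|/lt_mono|/val_inj->]; last by rewrite ltnn.
by move=> lt; apply/negbTE; rewrite -leqNgt ltnW.
Qed.

Lemma sum_frees (A : nmodType) (P : pred vx) (g : vx -> A) :
  \sum_(v | ~~ matched S v && P v) g v = \sum_i \sum_(j : 'I_(e i) | P (fvtx j)) g (fvtx j).
Proof.
rewrite sum_vertex; apply: eq_bigr => i _.
rewrite -(big_tuple _ _ (ftup i) (fun l => P (vtx l)) (fun l => g (vtx l))) /=.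
by rewrite big_filter_cond big_enum_cond /=.
Qed.

Lemma fidx_setv_same x i (j : 'I_(e i)) c : (c <= 1)%N ->
  fidx (setv x (fvtx j) c) i = tset (fidx x i) j c.
Proof.
move=> c1; apply/ffunP => j'; rewrite fidxE; case: (eqVneq j' j) => [->|jj].
  by apply/val_inj; rewrite /= setv_same // tset_same.
by rewrite tset_other // fidxE setv_other // (inj_eq (@fvtx_inj i)).
Qed.

Lemma fidx_setv_other x i (j : 'I_(e i)) c i' : i' != i ->
  fidx (setv x (fvtx j) c) i' = fidx x i'.
Proof.
move=> ii; apply/ffunP => j'; rewrite !fidxE setv_other //.
by apply: contra ii => /eqP/(congr1 tag)/= ->.
Qed.

Definition FL x v : int := \sum_(u | ~~ matched S u && vlt u v) wv x u.
Definition FR x v : int := \sum_(u | ~~ matched S u && vlt v u) wv x u.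

Lemma twt_fidx x i (j : 'I_(e i)) : twt (fidx x i) j = wv x (fvtx j).
Proof. by rewrite /twt fidxE. Qed.

Lemma FL_fvtx x i (j : 'I_(e i)) :
  FL x (fvtx j) = lsum (fun i => \sum_j twt (fidx x i) j) i + lsum (twt (fidx x i)) j.
Proof.
rewrite /FL sum_frees (bigID (fun i' : 'I_k => (i' < i)%N)) /=; congr (_ + _).
  apply: eq_bigr => i' lt; apply: eq_big => [j'|j' _]; last by rewrite twt_fidx.
  by rewrite /vlt /= lt.
rewrite (bigD1 i) ?ltnn //= [X in _ + X]big1 ?addr0 => [|i' /andP[ge ne]].
  by apply: eq_big => [j'|j' _]; rewrite ?twt_fidx // /vlt /= ltnn eqxx /= fvtx_lt.
by rewrite big_pred0 // => j'; rewrite /vlt /= (negPf ge) (negPf ne).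
Qed.

Lemma FR_fvtx x i (j : 'I_(e i)) :
  FR x (fvtx j) = rsum (fun i => \sum_j twt (fidx x i) j) i + rsum (twt (fidx x i)) j.
Proof.
rewrite /FR sum_frees (bigID (fun i' : 'I_k => (i < i')%N)) /=; congr (_ + _).
  apply: eq_bigr => i' lt; apply: eq_big => [j'|j' _]; last by rewrite twt_fidx.
  by rewrite /vlt /= lt.
rewrite (bigD1 i) ?ltnn //= [X in _ + X]big1 ?addr0 => [|i' /andP[ge ne]].
  by apply: eq_big => [j'|j' _]; rewrite ?twt_fidx // /vlt /= ltnn eqxx /= fvtx_lt.
by rewrite big_pred0 // => j'; rewrite /vlt /= (negPf ge) eq_sym (negPf ne).
Qed.

Variable C : numFieldType.
Local Notation K := C`(q).
Local Notation q := (qq C).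
Variables (G : forall i, tidx (fun _ : 'I_(e i) => 1%N) -> K) (t : 'I_k -> int).
Hypothesis Gt : forall i z, G (i := i) z != 0 -> \sum_j twt z j = t i.

(** If the product is nonzero, the weight of the labels in each box i is t i, so exponents may be
    compared under this assumption. *)
Lemma scale_boxes (s s' : int) x (P : pred 'I_k) :
  ((forall i, P i -> \sum_j twt (fidx x i) j = t i) -> s = s') ->
  q ^ s * \prod_(i | P i) G (fidx x i) = q ^ s' * \prod_(i | P i) G (fidx x i).
Proof.
move=> ss; case: (eqVneq (\prod_(i | P i) G (fidx x i)) 0) => [->|/prodf_neq0 nz].
  by rewrite !mulr0.
by rewrite ss // => i Pi; apply/Gt/nz.
Qed.

(** Coassociativity: the sum over free vertices is grouped into a sum over boxes of sums within a
    box. *)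
Lemma box_left x (b c : nat) : (c <= 1)%N ->
  \sum_(v | ~~ matched S v && (x v == b :> nat)) q ^ FL x v * \prod_i G (fidx (setv x v c) i) =
  \sum_i q ^ lsum t i * (\prod_(i' | i' != i) G (fidx x i')) *
    \sum_(j : 'I_(e i)) if fidx x i j == b :> nat
      then q ^ lsum (twt (fidx x i)) j * G (tset (fidx x i) j c) else 0.
Proof.
move=> c1; rewrite sum_frees; apply: eq_bigr => i _; rewrite mulr_sumr [RHS]big_mkcond /= big_mkcond /=.
apply: eq_bigr => j _; rewrite fidxE; case: ifP => _; last by rewrite mulr0.
rewrite (bigD1 i) //= fidx_setv_same // FL_fvtx.
under eq_bigr => i' ii do rewrite fidx_setv_other //.
rewrite [G _ * _]mulrC !mulrA; congr (_ * _).
rewrite [RHS]mulrAC -expfzDr ?qq_neq0 //; apply: scale_boxes => tw; congr (_ + _).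
by apply: eq_bigr => i' lt; apply: tw; rewrite -val_eqE /= ltn_eqF.
Qed.

Lemma box_right x (b c : nat) : (c <= 1)%N ->
  \sum_(v | ~~ matched S v && (x v == b :> nat)) q ^ (- FR x v) * \prod_i G (fidx (setv x v c) i) =
  \sum_i q ^ (- rsum t i) * (\prod_(i' | i' != i) G (fidx x i')) *
    \sum_(j : 'I_(e i)) if fidx x i j == b :> nat
      then q ^ (- rsum (twt (fidx x i)) j) * G (tset (fidx x i) j c) else 0.
Proof.
move=> c1; rewrite sum_frees; apply: eq_bigr => i _; rewrite mulr_sumr [RHS]big_mkcond /= big_mkcond /=.
apply: eq_bigr => j _; rewrite fidxE; case: ifP => _; last by rewrite mulr0.
rewrite (bigD1 i) //= fidx_setv_same // FR_fvtx opprD.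
under eq_bigr => i' ii do rewrite fidx_setv_other //.
rewrite [G _ * _]mulrC !mulrA; congr (_ * _).
rewrite [RHS]mulrAC -expfzDr ?qq_neq0 //; apply: scale_boxes => tw; congr (- _ - _).
by apply: eq_bigr => i' lt; apply: tw; rewrite -val_eqE /= gtn_eqF.
Qed.

End Boxes.
End Labels.
End Vertices.

(** * Weights along the arcs of a non-crossing match *)

Section Matching.
Variables (k : nat) (d : 'I_k -> nat).
Local Notation vx := (vertex d).
Local Notation label := {ffun vx -> 'I_2}.
Variable S : {set vx * vx}.
Hypothesis Sm : lower_match S.
Implicit Types (u v : vx) (c : vx * vx).

Lemma match_tag c : c \in S -> (tag c.1 < tag c.2)%N.
Proof. by case/and4P: Sm => /forall_inP h _ _ _; apply: h. Qed.

Lemma match_disj c c' : c \in S -> c' \in S -> c != c' ->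
  [/\ c.1 != c'.1, c.1 != c'.2, c.2 != c'.1 & c.2 != c'.2].
Proof.
case/and4P: Sm => _ /forall_inP h _ _ cS c'S ne.
by have /forall_inP/(_ _ c'S)/implyP/(_ ne)/and4P := h _ cS.
Qed.

Lemma match_lt c : c \in S -> (vidx c.1 < vidx c.2)%N.
Proof. by move=> cS; apply/vidx_tag_lt/match_tag. Qed.

Lemma match_noncross c c' : c \in S -> c' \in S ->
  (vidx c.1 < vidx c'.1)%N -> (vidx c'.1 < vidx c.2)%N -> (vidx c'.2 <= vidx c.2)%N.
Proof.
case/and4P: Sm => _ _ /forall_inP h _ cS c'S l1 l2.
by have /forall_inP/(_ _ c'S) := h _ cS; rewrite !vltE l1 l2 /= -leqNgt.
Qed.

Lemma match_under c v : c \in S -> (vidx c.1 < vidx v)%N -> (vidx v < vidx c.2)%N -> matched S v.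
Proof.
case/and4P: Sm => _ _ _ /forall_inP h cS l1 l2.
by have /forallP/(_ v)/implyP := h _ cS; apply; rewrite !vltE l1.
Qed.

Lemma matchedP v : reflect (exists2 c, c \in S & c.1 = v \/ c.2 = v) (matched S v).
Proof.
apply: (iffP exists_inP) => [[c cS /orP[/eqP<-|/eqP<-]]|[c cS [<-|<-]]].
- by exists c; [|left].
- by exists c; [|right].
- by exists c; rewrite ?eqxx.
- by exists c; rewrite ?eqxx ?orbT.
Qed.

Lemma match_neq c : c \in S -> c.1 != c.2.
Proof. by move=> /match_tag; apply: contraTneq => ->; rewrite ltnn. Qed.

Lemma sum_matched (A : nmodType) (g : vx -> A) :
  \sum_(v | matched S v) g v = \sum_(c in S) (g c.1 + g c.2).
Proof.
have inj1 : {in S &, injective fst}.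
  by move=> c c' cS c'S /eqP e; apply: contraTeq e => /(match_disj cS c'S)[].
have inj2 : {in S &, injective snd}.
  by move=> c c' cS c'S /eqP e; apply: contraTeq e => /(match_disj cS c'S)[].
rewrite big_split /= -(big_imset g inj1) -(big_imset g inj2) /= -bigU /=.
  apply: eq_bigl => v; rewrite !inE; apply/matchedP/orP => [[c cS [<-|<-]]|[]/imsetP[c cS ->]].
  - by left; apply: imset_f.
  - by right; apply: imset_f.
  - by exists c; [|left].
  - by exists c; [|right].
rewrite -setI_eq0; apply/eqP/setP => v; rewrite !inE; apply/negP => /andP[].
case/imsetP=> c cS -> /imsetP[c' c'S] /eqP; apply/negP.
case: (eqVneq c c') => [<-|ne]; first exact: match_neq.
by have [] := match_disj cS c'S ne.
Qed.

(** Every vertex of box i is free, a left endpoint or a right endpoint, and only one of these. *)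
Lemma size_frees_match i : size (frees S i) = (nS S i - rS S i)%N.
Proof.
rewrite /nS; set rt := #|[set a in S | tag a.2 == i]|.
suff e : (size (frees S i) + (rS S i + rt))%N = d i by rewrite -subnDA [(rt + _)%N]addnC -[X in (X - _)%N]e addnK.
have <- : (\sum_(v | matched S v) (tag v == i))%N = (rS S i + rt)%N.
  rewrite [LHS]sum_matched -[LHS]/(\sum_(c in S) ((tag c.1 == i) + (tag c.2 == i)))%N big_split /=.
  by rewrite /rS /rt -!sum1_card; congr (_ + _)%N; rewrite [RHS]big_mkcond [LHS]big_mkcond /=;
     apply: eq_bigr => c _; rewrite inE; case: (c \in S) => //=; case: eqP.
rewrite sum_vertex (bigD1 i) //= [X in (_ + (_ + X))%N]big1 => [|j ji]; last first.
  by rewrite big1 // => l _; rewrite (negPf ji).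
rewrite eqxx /= -[RHS]card_ord -(cardC (fun l : 'I_(d i) => matched S (vtx l))) addn0.
rewrite sum1_card addnC; congr (_ + _)%N.
by rewrite -sum1_size big_filter big_enum_cond /= sum1_card; apply: eq_card => l; rewrite !inE.
Qed.

Definition balanced (x : label) c : Prop := wv x c.1 + wv x c.2 = 0.

Definition WL (x : label) v : int := \sum_(u | vlt u v) wv x u.
Definition WR (x : label) v : int := \sum_(u | vlt v u) wv x u.

Lemma sum_split_matched (P : pred vx) (g : vx -> int) :
  \sum_(u | P u) g u = \sum_(u | ~~ matched S u && P u) g u +
    \sum_(c in S) ((if P c.1 then g c.1 else 0) + (if P c.2 then g c.2 else 0)).
Proof.
rewrite -(sum_matched (fun u => if P u then g u else 0)) -big_mkcondr /=.
rewrite (bigID (matched S)) /= addrC; congr (_ + _); apply: eq_bigl => u; exact: andbC.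
Qed.

(** A free vertex lies under no arc, so every arc is entirely on one side of it and, being balanced,
    adds 0 to the weight. *)
Lemma WL_free x v : ~~ matched S v -> (forall c, c \in S -> balanced x c) -> WL x v = FL S x v.
Proof.
move=> fv bal; rewrite /WL sum_split_matched [X in _ + X]big1 ?addr0 // => c cS; rewrite !vltE.
have l12 := match_lt cS; case: ifP => l1; case: ifP => l2; rewrite ?addr0 //; first exact: bal.
  have l2v : vidx c.2 != vidx v.
    by rewrite (inj_eq (@vidx_inj _ _)); apply: contraNneq fv => <-; apply/matchedP; exists c; [|right].
  by case/negP: fv; apply: (match_under cS l1); rewrite ltn_neqAle eq_sym l2v leqNgt l2.
by rewrite (ltn_trans l12 l2) in l1.
Qed.

Lemma WR_free x v : ~~ matched S v -> (forall c, c \in S -> balanced x c) -> WR x v = FR S x v.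
Proof.
move=> fv bal; rewrite /WR sum_split_matched [X in _ + X]big1 ?addr0 // => c cS; rewrite !vltE.
have l12 := match_lt cS; case: ifP => l1; case: ifP => l2; rewrite ?addr0 //; first exact: bal.
  by rewrite (ltn_trans l1 l12) in l2.
have l1v : vidx c.1 != vidx v.
  by rewrite (inj_eq (@vidx_inj _ _)); apply: contraNneq fv => <-; apply/matchedP; exists c; [|left].
by case/negP: fv; apply: (match_under cS _ l2); rewrite ltn_neqAle l1v leqNgt l1.
Qed.

(** All vertices under an arc are matched, and as arcs do not cross, their partners are under it
    too. *)
Lemma between_arc x c : c \in S -> (forall c', c' \in S -> c' != c -> balanced x c') ->
  \sum_(u | vlt c.1 u && vlt u c.2) wv x u = 0.
Proof.
move=> cS bal; rewrite sum_split_matched big_pred0 ?add0r => [|u]; last first.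
  apply/negbTE; rewrite !vltE; apply/negP => /and3P[fu l1 l2]; case/negP: fu.
  exact: match_under cS l1 l2.
apply: big1 => c' c'S; rewrite !vltE; case: (eqVneq c' c) => [->|ne].
  by rewrite ltnn /= ltnn andbF addr0.
have l12 := match_lt c'S; have [d1 d2 d3 d4] := match_disj c'S cS ne.
case: ifP => l1; case: ifP => l2; rewrite ?addr0 //; first exact: bal.
  case/andP: l1 => l1 l1'; have := match_noncross cS c'S l1 l1'; rewrite leq_eqVlt.
  by rewrite (inj_eq (@vidx_inj _ _)) (negPf d4) /= => l2'; rewrite l2' (ltn_trans l1 l12) in l2.
case/andP: l2 => l2 l2'; rewrite (ltn_trans l12 l2') andbT in l1.
have l1' : (vidx c'.1 < vidx c.1)%N by rewrite ltn_neqAle (inj_eq (@vidx_inj _ _)) d1 leqNgt l1.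
by have := match_noncross c'S cS l1' l2; rewrite leqNgt l2'.
Qed.

Lemma WL_arc x c : c \in S -> (forall c', c' \in S -> c' != c -> balanced x c') ->
  WL x c.2 = WL x c.1 + wv x c.1.
Proof.
move=> cS bal; have l12 := match_lt cS; rewrite /WL.
rewrite (bigID (fun u => vlt u c.1)) /=; congr (_ + _).
  by apply: eq_bigl => u; rewrite !vltE; case: (ltnP (vidx u) (vidx c.1)) => [l|]; rewrite ?andbF // (ltn_trans l).
rewrite (bigD1 c.1) /=; last by rewrite !vltE l12 ltnn.
rewrite -[RHS]addr0; congr (_ + _); rewrite -[RHS](@between_arc x c cS bal); apply: eq_bigl => u.
rewrite !vltE -leqNgt -(inj_eq (@vidx_inj _ _)).
by case: (ltngtP (vidx c.1) (vidx u)) => _; rewrite ?andbF ?andbT.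
Qed.

End Matching.

(** * gamma_S commutes with the action *)

Section Contraction.
Variables (k : nat) (d : 'I_k -> nat) (C : numFieldType).
Local Notation K := C`(q).
Local Notation q := (qq C).
Local Notation vx := (vertex d).
Local Notation label := {ffun vx -> 'I_2}.
Variable S : {set vx * vx}.
Hypothesis Sm : lower_match S.
Implicit Types (u v : vx) (c : vx * vx) (x y : label).

Definition kappa x : K := \prod_(c in S) ev C (x c.1) (x c.2).
Definition kappaD x c : K := \prod_(c' in S | c' != c) ev C (x c'.1) (x c'.2).

Lemma bit_val (b : 'I_2) : b = inord 0 \/ b = inord 1.
Proof. by case: b => [[|[]]] //= lt; [left|right]; apply/val_inj; rewrite /= inordK. Qed.

Lemma evE : [/\ ev C (inord 0) (inord 0) = 0, ev C (inord 0) (inord 1) = - q^-1,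
  ev C (inord 1) (inord 0) = 1 & ev C (inord 1) (inord 1) = 0].
Proof. by rewrite /ev -!val_eqE /= !inordK. Qed.

Lemma ev_balanced x c : ev C (x c.1) (x c.2) != 0 -> balanced x c.
Proof.
rewrite /balanced /wv; have [e00 e01 e10 e11] := evE.
by case: (bit_val (x c.1)) => ->; case: (bit_val (x c.2)) => ->;
  rewrite ?e00 ?e01 ?e10 ?e11 ?eqxx // !inordK.
Qed.

Lemma kappa_balanced x c : kappa x != 0 -> c \in S -> balanced x c.
Proof. by move=> /prodf_neq0 nz cS; apply/ev_balanced/nz. Qed.

Lemma kappaD_balanced x c c' : kappaD x c != 0 -> c' \in S -> c' != c -> balanced x c'.
Proof. by move=> /prodf_neq0 nz c'S ne; apply/ev_balanced/nz; rewrite c'S. Qed.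

Lemma kappaD_setv x c v m : c \in S -> v = c.1 \/ v = c.2 -> kappaD (setv x v m) c = kappaD x c.
Proof.
move=> cS vc; apply: eq_bigr => c' /andP[c'S ne].
have [d1 d2 d3 d4] := match_disj Sm c'S cS ne.
by rewrite !setv_other //; case: vc => ->.
Qed.

Lemma kappa_setv1 x c m : c \in S -> kappa (setv x c.1 m) = ev C (inord m) (x c.2) * kappaD x c.
Proof.
move=> cS; rewrite /kappa (bigD1 c) //= -/(kappaD (setv x c.1 m) c) kappaD_setv //; last by left.
by rewrite ffunE eqxx setv_other // eq_sym (match_neq Sm).
Qed.

Lemma kappa_setv2 x c m : c \in S -> kappa (setv x c.2 m) = ev C (x c.1) (inord m) * kappaD x c.
Proof.
move=> cS; rewrite /kappa (bigD1 c) //= -/(kappaD (setv x c.2 m) c) kappaD_setv //; last by right.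
by rewrite [X in ev C _ X]ffunE eqxx setv_other // (match_neq Sm).
Qed.

Lemma kappa_setv_free x v m : ~~ matched S v -> kappa (setv x v m) = kappa x.
Proof.
move=> fv; apply: eq_bigr => c cS; rewrite !setv_other //.
  by apply: contraNneq fv => <-; apply/matchedP; exists c; [|right].
by apply: contraNneq fv => <-; apply/matchedP; exists c; [|left].
Qed.

Lemma WLR x v : WL x v + wv x v + WR x v = \sum_u wv x u.
Proof.
rewrite /WL /WR [RHS](bigID (fun u => vlt u v)) /= -addrA; congr (_ + _).
rewrite [RHS](bigD1 v) ?vltE ?ltnn //=; congr (_ + _); apply: eq_bigl => u.
by rewrite !vltE -leqNgt ltn_neqAle (inj_eq (@vidx_inj _ _)) andbC eq_sym.
Qed.

(** Invariance of the contraction under E, arc by arc: terms survive only when both ends carry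
    v_{-1}, and the coefficient -q^-1 of [ev] cancels the factor that K picks up at the left end. *)
Lemma arcs_up x : \sum_(v | matched S v && (x v == 1%N :> nat)) q ^ WL x v * kappa (setv x v 0) = 0.
Proof.
rewrite big_mkcondr (sum_matched Sm) big1 // => c cS; rewrite kappa_setv1 // kappa_setv2 //.
case: (eqVneq (kappaD x c) 0) => [->|nz]; first by rewrite !mulr0 !if_same addr0.
rewrite (WL_arc Sm cS) => [|c' c'S ne]; last exact: kappaD_balanced nz c'S ne.
have [e00 e01 e10 e11] := evE; rewrite /wv.
case: (bit_val (x c.1)) => ->; case: (bit_val (x c.2)) => ->;
  rewrite ?e00 ?e01 ?e10 ?e11 !inordK //= ?mul0r ?mulr0 ?addr0 //.
rewrite !mulNr mulrN mul1r addrC expfzDr ?qq_neq0 // -exprN1 !mulrA.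
by apply/eqP; rewrite subr_eq0.
Qed.

Lemma arcs_down x : \sum_(v | matched S v && (x v == 0%N :> nat)) q ^ (- WR x v) * kappa (setv x v 1) = 0.
Proof.
rewrite big_mkcondr (sum_matched Sm) big1 // => c cS; rewrite kappa_setv1 // kappa_setv2 //.
case: (eqVneq (kappaD x c) 0) => [->|nz]; first by rewrite !mulr0 !if_same addr0.
have R v : - WR x v = WL x v + wv x v - \sum_u wv x u by rewrite -(WLR x v); lia.
rewrite !R (WL_arc Sm cS) => [|c' c'S ne]; last exact: kappaD_balanced nz c'S ne.
have [e00 e01 e10 e11] := evE; rewrite /wv.
case: (bit_val (x c.1)) => ->; case: (bit_val (x c.2)) => ->;
  rewrite ?e00 ?e01 ?e10 ?e11 !inordK //= ?mul0r ?mulr0 ?addr0 //.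
set T := \sum_u _; set W := WL x _.
rewrite mul1r mulNr mulrN -exprN1 mulrA -expfzDr ?qq_neq0 //; apply/eqP; rewrite subr_eq0.
by apply/eqP; congr (q ^ _ * _); lia.
Qed.

Section GammaS.
Variables (r n : 'I_k -> nat).
Hypotheses (rE : forall i, rS S i = r i) (nE : forall i, nS S i = n i).
Local Notation e := (fun i => n i - r i)%N.

Lemma size_fr i : size (frees S i) = e i.
Proof. by rewrite (size_frees_match Sm) rE nE. Qed.

Lemma size_all i : size (frees (d := d) finset.set0 i) = d i.
Proof.
rewrite size_filter -[RHS]card_ord cardE; apply/eqP; rewrite -all_count; apply/allP => l _.
by apply/exists_inP => -[c]; rewrite inE.
Qed.

Lemma box_idxE x i : box_idx x i = fidx finset.set0 d x i.
Proof.
apply/ffunP => j; rewrite (fidxE size_all) ffunE /fvtx; congr (x (vtx _)).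
apply/val_inj; rewrite /= (tnth_nth j) /=.
have -> : frees (d := d) finset.set0 i = enum 'I_(d i).
  by apply/all_filterP/allP => l _; apply/exists_inP => -[c]; rewrite inE.
by rewrite nth_ord_enum.
Qed.

Definition iota_boxes x (b : tidx d) : K := \prod_i iotac C (fidx finset.set0 d x i) (b i).
Definition pi_boxes (a : tidx e) x : K := \prod_i pic C (a i) (fidx S e x i).

Lemma gammaSE (a : tidx e) (b : tidx d) :
  gammaS C S a b = \sum_x iota_boxes x b * kappa x * pi_boxes a x.
Proof.
by apply: eq_bigr => x _; congr (_ * _ * _); apply: eq_bigr => i _; rewrite /iotac box_idxE.
Qed.

Lemma FL0 x v : FL finset.set0 x v = WL x v.
Proof. by apply: eq_bigl => u; rewrite andb_idl // => _; apply/exists_inP => -[c]; rewrite inE. Qed.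

Lemma FR0 x v : FR finset.set0 x v = WR x v.
Proof. by apply: eq_bigl => u; rewrite andb_idl // => _; apply/exists_inP => -[c]; rewrite inE. Qed.

Lemma free0 v : ~~ matched finset.set0 v.
Proof. by apply/exists_inP => -[c]; rewrite inE. Qed.

Lemma iotac_twt (b : tidx d) i (z : tidx (fun _ : 'I_(d i) => 1%N)) :
  iotac C z (b i) != 0 -> \sum_j twt z j = twt b i.
Proof. by move=> /iotac_cnt e; rewrite sum_twt e. Qed.

Lemma pic_twt (a : tidx e) i (z : tidx (fun _ : 'I_(e i) => 1%N)) :
  pic C (a i) z != 0 -> \sum_j twt z j = twt a i.
Proof. by move=> /pic_cnt ez; rewrite sum_twt ez. Qed.

Lemma prod_tset (ee : 'I_k -> nat) (b : tidx ee) i m (G : forall j, 'I_(ee j).+1 -> K) :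
  \prod_j G j (tset b i m j) = (\prod_(j | j != i) G j (b j)) * G i (inord m).
Proof.
rewrite (bigD1 i) //= ffunE eqxx mulrC; congr (_ * _).
by apply: eq_bigr => j ji; rewrite tset_other.
Qed.

Lemma iota_boxes_up x (b : tidx d) :
  \sum_i (if (0 < b i)%N then q ^ lsum (twt b) i * qz C ((d i)%:Z - (b i)%:Z + 1) *
     iota_boxes x (tset b i (b i).-1) else 0) =
  \sum_(v | x v == 0%N :> nat) q ^ WL x v * iota_boxes (setv x v 1) b.
Proof.
transitivity (\sum_(v | ~~ matched finset.set0 v && (x v == 0%N :> nat))
    q ^ FL finset.set0 x v * iota_boxes (setv x v 1) b); last first.
  by apply: eq_big => v; rewrite ?free0 // FL0.
rewrite (box_left size_all (G := fun i z => iotac C z (b i)) (@iotac_twt b)) //.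
apply: eq_bigr => i _; rewrite -iotac_up; case: ifP => _; last by rewrite mulr0.
rewrite /iota_boxes (prod_tset b i (b i).-1 (fun j s => iotac C (fidx finset.set0 d x j) s)).
exact: mulrACA.
Qed.

Lemma iota_boxes_down x (b : tidx d) :
  \sum_i (if (b i < d i)%N then q ^ (- rsum (twt b) i) * qz C ((b i)%:Z + 1) *
     iota_boxes x (tset b i (b i).+1) else 0) =
  \sum_(v | x v == 1%N :> nat) q ^ (- WR x v) * iota_boxes (setv x v 0) b.
Proof.
transitivity (\sum_(v | ~~ matched finset.set0 v && (x v == 1%N :> nat))
    q ^ (- FR finset.set0 x v) * iota_boxes (setv x v 0) b); last first.
  by apply: eq_big => v; rewrite ?free0 // FR0.
rewrite (box_right size_all (G := fun i z => iotac C z (b i)) (@iotac_twt b)) //.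
apply: eq_bigr => i _; rewrite -iotac_down; case: ifP => _; last by rewrite mulr0.
rewrite /iota_boxes (prod_tset b i (b i).+1 (fun j s => iotac C (fidx finset.set0 d x j) s)).
exact: mulrACA.
Qed.

Lemma pi_boxes_up x (a : tidx e) :
  \sum_i (if (a i < e i)%N then q ^ lsum (twt a) i * qz C ((e i)%:Z - (a i)%:Z) *
     pi_boxes (tset a i (a i).+1) x else 0) =
  \sum_(v | ~~ matched S v && (x v == 1%N :> nat)) q ^ FL S x v * pi_boxes a (setv x v 0).
Proof.
rewrite (box_left size_fr (G := fun i z => pic C (a i) z) (@pic_twt a)) //.
apply: eq_bigr => i _; rewrite -pic_up; case: ifP => _; last by rewrite mulr0.
rewrite /pi_boxes (prod_tset a i (a i).+1 (fun j s => pic C s (fidx S e x j))).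
exact: mulrACA.
Qed.

Lemma pi_boxes_down x (a : tidx e) :
  \sum_i (if (0 < a i)%N then q ^ (- rsum (twt a) i) * qz C (a i)%:Z *
     pi_boxes (tset a i (a i).-1) x else 0) =
  \sum_(v | ~~ matched S v && (x v == 0%N :> nat)) q ^ (- FR S x v) * pi_boxes a (setv x v 1).
Proof.
rewrite (box_right size_fr (G := fun i z => pic C (a i) z) (@pic_twt a)) //.
apply: eq_bigr => i _; rewrite -pic_down; case: ifP => _; last by rewrite mulr0.
rewrite /pi_boxes (prod_tset a i (a i).-1 (fun j s => pic C s (fidx S e x j))).
exact: mulrACA.
Qed.

Lemma pi_boxes_matched x (a : tidx e) v m : matched S v -> pi_boxes a (setv x v m) = pi_boxes a x.
Proof.
move=> mv; apply: eq_bigr => i _; congr (pic C _ _); apply/ffunP => j.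
rewrite !(fidxE size_fr) setv_other //; apply: contraTneq mv => <-.
by have := mem_tnth j (ftup size_fr i); rewrite mem_filter => /andP[].
Qed.

Lemma setvK x v (m m' : nat) : x v = m :> nat -> setv (setv x v m') v m = x.
Proof.
move=> xm; apply/ffunP => u; rewrite !ffunE; case: (eqVneq u v) => [->|//].
by apply/val_inj; rewrite /= inordK // -xm ltn_ord.
Qed.

(** Changing the label at v matches the labellings on the two sides; it moves an operator from the
    iota factor to the arcs and the pi factor. *)
Lemma sum_flip (m m' : nat) (g : label -> vx -> K) : (m <= 1)%N -> (m' <= 1)%N ->
  \sum_(x : label) \sum_(v | x v == m :> nat) g x v =
  \sum_(y : label) \sum_(v | y v == m' :> nat) g (setv y v m) v.
Proof.
move=> m1 m1'; rewrite (exchange_big_dep xpredT) //= [RHS](exchange_big_dep xpredT) //=.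
apply: eq_bigr => v _.
rewrite (reindex_onto (fun y => setv y v m) (fun x => setv x v m')) /=; last by move=> x /eqP; exact: setvK.
apply: eq_bigl => y; rewrite setv_same // eqxx /=; apply/eqP/eqP => [<-|]; last exact: setvK.
exact: setv_same.
Qed.

Lemma WL_setv x v m : WL (setv x v m) v = WL x v.
Proof. by apply: eq_bigr => u; rewrite vltE /wv => uv; rewrite setv_other //; apply: contraTneq uv => ->; rewrite ltnn. Qed.

Lemma WR_setv x v m : WR (setv x v m) v = WR x v.
Proof. by apply: eq_bigr => u; rewrite vltE /wv => uv; rewrite setv_other //; apply: contraTneq uv => ->; rewrite ltnn. Qed.

(** The matched vertices cancel by [arcs_up]; at a free vertex the balanced arcs do not affect the
    power of q, so [WL] may be replaced by [FL]. *)
Lemma contract_up x (a : tidx e) :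
  \sum_(v | x v == 1%N :> nat) q ^ WL x v * (kappa (setv x v 0) * pi_boxes a (setv x v 0)) =
  kappa x * \sum_(v | ~~ matched S v && (x v == 1%N :> nat)) q ^ FL S x v * pi_boxes a (setv x v 0).
Proof.
rewrite (bigID (matched S)) /= [X in X + _](_ : _ = 0) ?add0r; last first.
  transitivity (\sum_(v | matched S v && (x v == 1%N :> nat)) q ^ WL x v * kappa (setv x v 0) * pi_boxes a x).
    apply: eq_big => [v|v /andP[_ mv]]; first exact: andbC.
    rewrite mulrA; congr (_ * _).
    exact: pi_boxes_matched.
  by rewrite -mulr_suml arcs_up mul0r.
rewrite mulr_sumr; apply: eq_big => [v|v /andP[_ fv]]; first exact: andbC.
rewrite kappa_setv_free // mulrCA; case: (eqVneq (kappa x) 0) => [->|nz]; first by rewrite !mul0r.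
by rewrite (WL_free Sm fv) // => c; exact: kappa_balanced.
Qed.

Lemma contract_down x (a : tidx e) :
  \sum_(v | x v == 0%N :> nat) q ^ (- WR x v) * (kappa (setv x v 1) * pi_boxes a (setv x v 1)) =
  kappa x * \sum_(v | ~~ matched S v && (x v == 0%N :> nat)) q ^ (- FR S x v) * pi_boxes a (setv x v 1).
Proof.
rewrite (bigID (matched S)) /= [X in X + _](_ : _ = 0) ?add0r; last first.
  transitivity (\sum_(v | matched S v && (x v == 0%N :> nat)) q ^ (- WR x v) * kappa (setv x v 1) * pi_boxes a x).
    apply: eq_big => [v|v /andP[_ mv]]; first exact: andbC.
    rewrite mulrA; congr (_ * _).
    exact: pi_boxes_matched.
  by rewrite -mulr_suml arcs_down mul0r.
rewrite mulr_sumr; apply: eq_big => [v|v /andP[_ fv]]; first exact: andbC.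
rewrite kappa_setv_free // mulrCA; case: (eqVneq (kappa x) 0) => [->|nz]; first by rewrite !mul0r.
by rewrite (WR_free Sm fv) // => c; exact: kappa_balanced.
Qed.

(** E on V_(d_1) (x) ... is spread over all vertices by iota, the labels are flipped, the arcs drop
    out by [contract_up], and pi collects the free vertices into E on the target. *)
Lemma gammaS_E (a : tidx e) (b : tidx d) :
  \sum_b' gammaS C S a b' * tE C b' b = \sum_a' tE C a a' * gammaS C S a' b.
Proof.
rewrite tE_col tE_row.
transitivity (\sum_(x : label) \sum_(v | x v == 0%N :> nat) q ^ WL x v * iota_boxes (setv x v 1) b * (kappa x * pi_boxes a x)).
  under [RHS]eq_bigr => x _ do rewrite -mulr_suml -iota_boxes_up mulr_suml.
  rewrite exchange_big /=; apply: eq_bigr => i _.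
  case: ifP => _; last by rewrite big1 // => x _; rewrite mul0r.
  rewrite gammaSE mulr_sumr; apply: eq_bigr => x _.
  have assoc (a1 a2 a3 a4 : K) : a1 * (a2 * a3 * a4) = a1 * a2 * (a3 * a4) by rewrite !mulrA.
  exact: assoc.
rewrite (@sum_flip 0 1) //.
transitivity (\sum_(x : label) iota_boxes x b * (kappa x * \sum_(v | ~~ matched S v && (x v == 1%N :> nat)) q ^ FL S x v * pi_boxes a (setv x v 0))).
  apply: eq_bigr => x _; rewrite -contract_up mulr_sumr; apply: eq_bigr => v xv.
  by rewrite WL_setv (@setvK x v 1 0 (eqP xv)) [q ^ _ * iota_boxes _ _]mulrC -mulrA.
under eq_bigr => x _ do rewrite -pi_boxes_up mulrA mulr_sumr.
rewrite exchange_big /=; apply: eq_bigr => i _.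
case: ifP => _; last by rewrite big1 // => x _; rewrite mulr0.
by rewrite gammaSE mulr_sumr; apply: eq_bigr => x _; rewrite mulrCA.
Qed.

Lemma gammaS_F (a : tidx e) (b : tidx d) :
  \sum_b' gammaS C S a b' * tF C b' b = \sum_a' tF C a a' * gammaS C S a' b.
Proof.
rewrite tF_col tF_row.
transitivity (\sum_(x : label) \sum_(v | x v == 1%N :> nat) q ^ (- WR x v) * iota_boxes (setv x v 0) b * (kappa x * pi_boxes a x)).
  under [RHS]eq_bigr => x _ do rewrite -mulr_suml -iota_boxes_down mulr_suml.
  rewrite exchange_big /=; apply: eq_bigr => i _.
  case: ifP => _; last by rewrite big1 // => x _; rewrite mul0r.
  rewrite gammaSE mulr_sumr; apply: eq_bigr => x _.
  have assoc (a1 a2 a3 a4 : K) : a1 * (a2 * a3 * a4) = a1 * a2 * (a3 * a4) by rewrite !mulrA.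
  exact: assoc.
rewrite (@sum_flip 1 0) //.
transitivity (\sum_(x : label) iota_boxes x b * (kappa x * \sum_(v | ~~ matched S v && (x v == 0%N :> nat)) q ^ (- FR S x v) * pi_boxes a (setv x v 1))).
  apply: eq_bigr => x _; rewrite -contract_down mulr_sumr; apply: eq_bigr => v xv.
  by rewrite WR_setv (@setvK x v 0 1 (eqP xv)) [q ^ _ * iota_boxes _ _]mulrC -mulrA.
under eq_bigr => x _ do rewrite -pi_boxes_down mulrA mulr_sumr.
rewrite exchange_big /=; apply: eq_bigr => i _.
case: ifP => _; last by rewrite big1 // => x _; rewrite mulr0.
by rewrite gammaSE mulr_sumr; apply: eq_bigr => x _; rewrite mulrCA.
Qed.

Lemma gammaS_weight (a : tidx e) (b : tidx d) : gammaS C S a b != 0 ->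
  \sum_i twt a i = \sum_i twt b i.
Proof.
rewrite gammaSE => nz; have [x xnz] : exists x, iota_boxes x b * kappa x * pi_boxes a x != 0.
  apply/existsP; apply: contraNT nz => /existsPn h; apply/eqP/big1 => x _.
  by have := h x; rewrite negbK => /eqP.
move: xnz; rewrite !mulf_eq0 !negb_or => /andP[/andP[inz knz] pnz].
transitivity (\sum_(v | ~~ matched S v && true) wv x v).
  rewrite (sum_frees size_fr); apply: eq_bigr => i _.
  have /prodf_neq0/(_ i isT)/pic_twt <- := pnz.
  by apply: eq_bigr => j _; rewrite (twt_fidx size_fr).
transitivity (\sum_(v | ~~ matched finset.set0 v && true) wv x v); last first.
  rewrite (sum_frees size_all); apply: eq_bigr => i _.
  have /prodf_neq0/(_ i isT)/iotac_twt <- := inz.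
  by apply: eq_bigr => j _; rewrite (twt_fidx size_all).
under [RHS]eq_bigl => v do rewrite free0.
rewrite [RHS](sum_split_matched Sm) [X in _ = _ + X]big1 ?addr0 // => c cS.
exact: (kappa_balanced knz cS).
Qed.

End GammaS.
End Contraction.

(** * Matches with prescribed right endpoints *)

Section MatchingByRightEndpoints.
Import Order.TTheory.
Variables (k : nat) (d : 'I_k -> nat).
Local Notation vx := (vertex d).
Implicit Types (S T : {set vx * vx}) (u v : vx) (c : vx * vx).

Definition rights S : {set vx} := [set c.2 | c in S].

Lemma downset_ord m (A : {set 'I_m}) :
  (forall l l' : 'I_m, (l < l')%N -> l' \in A -> l \in A) -> forall l, (l \in A) = (l < #|A|)%N.
Proof.
move=> Adown; have aux (l : 'I_m) : l \in A -> (l < #|A|)%N.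
  move=> lA; rewrite -[X in (X < _)%N](card_ord_lt (ltnW (ltn_ord l))); apply: proper_card.
  apply/properP; split; last by exists l; rewrite // inE ltnn.
  by apply/fintype.subsetP => j; rewrite inE => /Adown; apply.
move=> l; apply/idP/idP => [/aux//|]; apply: contraTT => lA; rewrite -leqNgt.
rewrite -[leqRHS](card_ord_lt (ltnW (ltn_ord l))); apply/subset_leq_card/fintype.subsetP => j jA.
rewrite inE ltnNge; apply: contra lA; rewrite leq_eqVlt => /orP[/eqP/val_inj->//|/Adown]; exact.
Qed.

(** l lies under the arc ending at l', so it is matched. If it were a left endpoint, non-crossing
    would force its partner to end by l', hence in the same box, but arcs lead to later boxes. *)
Lemma rights_down S (Sm : lower_match S) i (l l' : 'I_(d i)) :
  (l < l')%N -> vtx l' \in rights S -> vtx l \in rights S.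
Proof.
move=> ll' /imsetP[c cS ec]; have lv : (vidx (vtx l) < vidx c.2)%N by rewrite -ec /vidx /= ltn_add2l.
have la : (vidx c.1 < vidx (vtx l))%N.
  by apply: vidx_tag_lt; have := match_tag Sm cS; rewrite -ec.
have /matchedP[c' c'S [e1|e2]] := match_under Sm cS la lv; last by rewrite -e2; apply: imset_f.
have := match_noncross Sm cS c'S; rewrite e1 => /(_ la lv); rewrite leqNgt.
suff -> : (vidx c.2 < vidx c'.2)%N by [].
by apply: vidx_tag_lt; have := match_tag Sm c'S; rewrite e1 -ec.
Qed.

Lemma match_inj2 S (Sm : lower_match S) : {in S &, injective snd}.
Proof. by move=> c c' cS c'S /eqP e; apply: contraTeq e => /(match_disj Sm cS c'S)[]. Qed.

Lemma match_inj1 S (Sm : lower_match S) : {in S &, injective fst}.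
Proof. by move=> c c' cS c'S /eqP e; apply: contraTeq e => /(match_disj Sm cS c'S)[]. Qed.

Lemma card_rights_box S (Sm : lower_match S) i :
  #|[set l : 'I_(d i) | vtx l \in rights S]| = #|[set a in S | tag a.2 == i]|.
Proof.
have vinj : injective (@vtx k d i) by move=> l l' /eqP; rewrite eq_Tagged /= => /eqP.
rewrite -(card_imset _ vinj) -(card_in_imset (f := snd)); last first.
  by move=> c c'; rewrite !inE => /andP[cS _] /andP[c'S _]; exact: (match_inj2 Sm cS c'S).
apply: eq_card => v; apply/imsetP/imsetP => [[l]|[c]]; rewrite inE.
  by case/imsetP=> c cS e ->; exists c => //; rewrite inE cS -e /= eqxx.
case/andP=> cS /eqP; case: c cS => a [j l] /= cS ej; case: i / ej {vinj} => ->.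
by exists l => //; rewrite inE; apply/imsetP; exists (a, vtx l).
Qed.

Lemma rights_box_le S (Sm : lower_match S) i : (#|[set a in S | tag a.2 == i]| <= d i)%N.
Proof. by rewrite -card_rights_box // -[leqRHS]card_ord max_card. Qed.

Lemma rightsE S (Sm : lower_match S) i (l : 'I_(d i)) :
  (vtx l \in rights S) = (l < d i - nS S i)%N.
Proof.
have := @downset_ord _ [set l : 'I_(d i) | vtx l \in rights S] _ l.
rewrite inE card_rights_box // /nS subKn ?rights_box_le //; apply=> l1 l2 l12.
by rewrite !inE; exact: rights_down.
Qed.

(** Let c' be the arc of T with the right endpoint of c. If c.1 lies left of c'.1, then c'.1 is
    matched in S: as a right endpoint it would also be one in T, and as a left endpoint its arc ends
    earlier, so by hypothesis it lies in T and clashes with c'. The other case is symmetric. *)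
Lemma match_step S T (Sm : lower_match S) (Tm : lower_match T) c :
  (forall v, (v \in rights S) = (v \in rights T)) -> c \in S ->
  (forall c', (vidx c'.2 < vidx c.2)%N -> (c' \in S) = (c' \in T)) -> c \in T.
Proof.
move=> eR cS IH; have : c.2 \in rights T by rewrite -eR; apply: imset_f.
case/imsetP=> c' c'T e2; case: (ltngtP (vidx c.1) (vidx c'.1)) => [lt|gt|/vidx_inj e1].
- have l2 : (vidx c'.1 < vidx c.2)%N by rewrite e2; exact: match_lt Tm _ c'T.
  have /matchedP[c'' c''S [e|e]] := match_under Sm cS lt l2.
    have := match_noncross Sm cS c''S; rewrite e => /(_ lt l2); rewrite leq_eqVlt.
    case/orP=> [/eqP/vidx_inj ee|lt2].
      by have := match_inj2 Sm c''S cS ee => ec; move: lt; rewrite -ec e ltnn.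
    have c''T : c'' \in T by rewrite -IH.
    by have := match_inj1 Tm c''T c'T e => ec; move: lt2; rewrite ec e2 ltnn.
  have /imsetP[c3 c3T e3] : c'.1 \in rights T by rewrite -eR -e; apply: imset_f.
  case: (eqVneq c' c3) => [ec|ne]; first by have := match_neq Tm c'T; rewrite {1}e3 ec eqxx.
  by have [_ + _ _] := match_disj Tm c'T c3T ne; rewrite e3 eqxx.
- have l2 : (vidx c.1 < vidx c'.2)%N by rewrite -e2; exact: match_lt Sm _ cS.
  have /matchedP[c'' c''T [e|e]] := match_under Tm c'T gt l2.
    have := match_noncross Tm c'T c''T; rewrite e => /(_ gt l2); rewrite leq_eqVlt.
    case/orP=> [/eqP/vidx_inj ee|lt2].
      by have := match_inj2 Tm c''T c'T ee => ec; move: gt; rewrite -ec e ltnn.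
    have c''S : c'' \in S by rewrite IH // e2.
    by have := match_inj1 Sm c''S cS e => ec; move: lt2; rewrite ec e2 ltnn.
  have /imsetP[c3 c3S e3] : c.1 \in rights S by rewrite eR -e; apply: imset_f.
  case: (eqVneq c c3) => [ec|ne]; first by have := match_neq Sm cS; rewrite {1}e3 ec eqxx.
  by have [_ + _ _] := match_disj Sm cS c3S ne; rewrite e3 eqxx.
by rewrite (_ : c = c') //; case: c c' e1 e2 {cS IH c'T} => [a b] [a' b'] /= -> ->.
Qed.

Lemma match_unique S T : lower_match S -> lower_match T -> nS S =1 nS T -> S = T.
Proof.
move=> Sm Tm nST; have eR v : (v \in rights S) = (v \in rights T).
  by case: v => i l; rewrite !(rightsE _ l) // nST.
apply/setP => c; move: {2}(vidx c.2).+1 (ltnSn (vidx c.2)) => m; elim: m c => // m IH c lt.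
have IHc c' : (vidx c'.2 < vidx c.2)%N -> (c' \in S) = (c' \in T).
  by move=> l; apply: IH; rewrite (leq_trans l).
apply/idP/idP => [cS|cT]; first exact: match_step eR cS IHc.
by apply: (match_step Tm Sm _ cT) => [v|c' /IHc->].
Qed.

Section Existence.
Variable n : 'I_k -> nat.
Hypotheses (n_le : forall i, (n i <= d i)%N)
  (n_feas : forall i : 'I_k,
    (\sum_(j : 'I_k | (j <= i)%N) (d j - n j) <= \sum_(j : 'I_k | (j < i)%N) n j)%N).

(** The vertices that [rightsE] forces to be right endpoints if n^S = n. *)
Definition closer v : bool := (tagged v < d (tag v) - n (tag v))%N.
Definition sg v : int := if closer v then -1 else 1.
(** Height before position p of the lattice path that descends at closers and ascends elsewhere. *)
Definition ht (p : nat) : int := \sum_(u | (vidx u < p)%N) sg u.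

Lemma ht0 : ht 0 = 0.
Proof. exact: big_pred0. Qed.

Lemma htS v : ht (vidx v).+1 = ht (vidx v) + sg v.
Proof.
rewrite /ht (bigD1 v) //= addrC; congr (_ + _); apply: eq_bigl => u.
by rewrite ltnS ltn_neqAle (inj_eq (@vidx_inj _ _)) andbC.
Qed.

Lemma vidx_lt v : (vidx v < dsum d)%N.
Proof.
rewrite (leq_trans (vidx_ltS v)) // /dsum -psum_ext0; apply: psum_mono; exact: ltn_ord.
Qed.

Lemma vidx_surj p : (p < dsum d)%N -> exists v, vidx v = p.
Proof.
move=> lt; pose f v := Ordinal (vidx_lt v).
have finj : injective f by move=> u v /(congr1 val)/vidx_inj.
have : Ordinal lt \in codom f.
  apply: (inj_card_onto finj); rewrite card_ord card_tagged sumnE big_map big_enum /=.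
  by rewrite /dsum; under [leqRHS]eq_bigr do rewrite card_ord.
by case/codomP=> v /(congr1 val)/= e; exists v.
Qed.

Lemma card_closers (i : 'I_k) : #|[set l : 'I_(d i) | closer (vtx l)]| = (d i - n i)%N.
Proof.
by rewrite -[RHS](card_ord_lt (leq_subr (n i) (d i))); apply: eq_card => l; rewrite !inE.
Qed.

Lemma sgE v : sg v = 1 - 2 * (closer v)%:Z.
Proof. by rewrite /sg; case: (closer v). Qed.

Lemma sum_sg (i : 'I_k) : \sum_(l : 'I_(d i)) sg (vtx l) = (n i)%:Z - (d i - n i)%N%:Z.
Proof.
under eq_bigr => l _ do rewrite sgE.
rewrite sumrB sumr_const card_ord -mulr_sumr -Posz_sum -[_ *+ _]mulr_natl mulr1.
have -> : (\sum_(l : 'I_(d i)) closer (vtx l))%N = (d i - n i)%N.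
  by rewrite -card_closers -sum1_card [RHS]big_mkcond; apply: eq_bigr => l _; rewrite inE; case: (closer _).
by have := n_le i; rewrite natz; lia.
Qed.

(** The closers come first in their box, so at the l-th of them the path has lost l since the box
    began, and [n_feas] bounds the loss in the whole box by the height at its beginning. *)
Lemma ht_closer v : closer v -> 1 <= ht (vidx v).
Proof.
case: v => i l cl; rewrite /ht sum_vertex (bigID (fun j : 'I_k => (j < i)%N)) /=.
have -> : \sum_(j < k | (j < i)%N) \sum_(l' : 'I_(d j) | (vidx (vtx l') < vidx (existT _ i l))%N) sg (vtx l') =
    \sum_(j < k | (j < i)%N) ((n j)%:Z - (d j - n j)%N%:Z).
  apply: eq_bigr => j ji; rewrite -sum_sg; apply: eq_bigl => l'.
  by apply: vidx_tag_lt.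
rewrite [X in _ + X](bigD1 i) ?ltnn //= [X in _ + (_ + X)]big1 ?addr0 => [|j /andP[ge ne]]; last first.
  rewrite big_pred0 // => l'; apply/negbTE; rewrite -leqNgt ltnW //; apply: vidx_tag_lt => /=.
  by rewrite ltn_neqAle eq_sym ne leqNgt ge.
have -> : \sum_(l' : 'I_(d i) | (vidx (vtx l') < vidx (existT _ i l))%N) sg (vtx l') = - l%:Z.
  transitivity (\sum_(l' : 'I_(d i) | (l' < l)%N) (-1 : int)).
    apply: eq_big => [l'|l']; first by rewrite /vidx /= ltn_add2l.
    rewrite /vidx /= ltn_add2l => ll; rewrite /sg (_ : closer _) //.
    exact: ltn_trans ll cl.
  rewrite sumr_const (_ : #|_| = l) ?mulNrn -?natz // -[RHS](card_ord_lt (ltnW (ltn_ord l))).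
  by apply: eq_card => l'; rewrite !inE.
rewrite sumrB -!Posz_sum; have := n_feas i; rewrite (bigD1 i) //=.
rewrite (eq_bigl (fun j : 'I_k => (j < i)%N)) => [|j]; last first.
  by rewrite ltn_neqAle andbC.
by move: cl; rewrite /closer /=; lia.
Qed.

Lemma ht_step p : (p < dsum d)%N -> exists2 v, vidx v = p & ht p.+1 = ht p + sg v.
Proof. by move=> /vidx_surj[v <-]; exists v => //; rewrite htS. Qed.

(* The right endpoint b is joined to the last earlier vertex at which the path [ht] has the
   height that it reaches after its descent at b. *)
Definition match_of : {set vx * vx} :=
  [set c | [&& ~~ closer c.1, closer c.2, (vidx c.1 < vidx c.2)%N, ht (vidx c.1) + 1 == ht (vidx c.2) &
     [forall u : vx, (vidx c.1 < vidx u <= vidx c.2)%N ==> (ht (vidx c.1) < ht (vidx u))]]].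

Lemma match_ofP a b : reflect [/\ ~~ closer a, closer b, (vidx a < vidx b)%N,
  ht (vidx a) + 1 = ht (vidx b) &
  forall p, (vidx a < p <= vidx b)%N -> ht (vidx a) < ht p] ((a, b) \in match_of).
Proof.
rewrite inE /=; apply: (iffP and5P) => [[h1 h2 h3 /eqP h4 /forallP h5]|[h1 h2 h3 /eqP h4 h5]].
  split=> // p pab; have [u eu] : exists u, vidx u = p.
    by apply: vidx_surj; case/andP: pab => _ /leq_ltn_trans; apply; exact: vidx_lt.
  by have /implyP := h5 u; rewrite eu; apply.
by split=> //; apply/forallP => u; apply/implyP; exact: h5.
Qed.

Lemma match_left b : closer b -> exists a, (a, b) \in match_of.
Proof.
(* The candidate is the last position before b with height below that of b; position 0 qualifies by
   [ht_closer]. By maximality and unit steps the path ascends there by exactly the missing 1. *)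
move=> cb; have hb := ht_closer cb; pose P p := (p < vidx b)%N && (ht p + 1 <= ht (vidx b)).
have exP : exists p, P p.
  exists 0%N; rewrite /P ht0; apply/andP; split; last by lia.
  by rewrite lt0n; apply/eqP => e; move: hb; rewrite e ht0.
have ubP p : P p -> (p <= vidx b)%N by case/andP=> /ltnW.
case: (ex_maxnP exP ubP) => p /andP[lt hp] pmax.
have [a ea hS] := ht_step (ltn_trans lt (vidx_lt b)).
have hS1 : ht (vidx b) <= ht p.+1.
  move: lt; rewrite leq_eqVlt => /orP[/eqP->//|lt].
  have := pmax p.+1; rewrite /P lt ltnn /=.
  by case: (boolP (ht p.+1 + 1 <= ht (vidx b))) => [_ /(_ isT)//|]; lia.
have ca : ~~ closer a by apply/negP => ca; move: hS; rewrite /sg ca; lia.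
exists a; apply/match_ofP; split=> //; rewrite ea //.
  by move: hS; rewrite /sg (negPf ca); lia.
move=> p' /andP[l1]; rewrite leq_eqVlt => /orP[/eqP->|l2]; first by lia.
have := pmax p'; rewrite /P l2 /= leqNgt l1.
by case: (boolP (ht p' + 1 <= ht (vidx b))) => [_ /(_ isT)//|]; lia.
Qed.

Lemma match_right a b v : (a, b) \in match_of -> ~~ closer v -> (vidx a < vidx v < vidx b)%N ->
  exists b', (v, b') \in match_of.
Proof.
move=> /match_ofP[ca cb lab hab hgt] cv /andP[av vb].
(* The first step after v that brings the path back to the height of v. The step at b is one, since
   v lies above the height of a and the path reaches that height after b. *)
pose P p := (vidx v < p)%N && (ht p.+1 <= ht (vidx v)).
have exP : exists p, P p.
  exists (vidx b); rewrite /P vb htS /sg cb.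
  by have := hgt (vidx v); rewrite av ltnW // => /(_ isT); lia.
case: (ex_minnP exP) => p /andP[lt hp] pmin.
have pb : (p <= vidx b)%N.
  apply: pmin; rewrite /P vb htS /sg cb.
  by have := hgt (vidx v); rewrite av ltnW // => /(_ isT); lia.
have hgt' p' : (vidx v < p' <= p)%N -> ht (vidx v) < ht p'.
  case: p' => // p' /andP[]; rewrite ltnS leq_eqVlt => /orP[/eqP<- _|l1 l2].
    by rewrite htS /sg (negPf cv); lia.
  have := pmin p'; rewrite /P l1 leqNgt l2 /=.
  by case: (boolP (ht p'.+1 <= ht (vidx v))) => [_ /(_ isT)//|]; lia.
have [b' eb hS] := ht_step (leq_ltn_trans pb (vidx_lt b)).
have h1 := hgt' p; rewrite lt leqnn in h1; have {h1} h1 := h1 isT.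
have cb' : closer b' by apply/negPn/negP => ncb; move: hS; rewrite /sg (negPf ncb); lia.
exists b'; apply/match_ofP; split=> //; rewrite eb //.
by move: hS; rewrite /sg cb'; lia.
Qed.

Lemma match_of_lower : lower_match match_of.
Proof.
apply/and4P; split.
- apply/forall_inP => -[a b] /match_ofP[ca cb ab _ _] /=; rewrite ltnNge leq_eqVlt.
  apply/negP => /orP[/eqP/val_inj e|ba]; last by have := vidx_tag_lt ba; rewrite ltnNge ltnW.
  (* In one box every vertex to the left of a closer is a closer, which a is not. *)
  case/negP: ca; rewrite /closer; case: a b e ab cb => [i l] [j m] /= e.
  case: i / e l => l; rewrite /vidx /= ltn_add2l /closer /= => lm; exact: ltn_trans.
- apply/forall_inP => -[a b] ab; apply/forall_inP => -[a' b'] ab'; apply/implyP => ne.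
  have /match_ofP[ca cb lab hab hgt] := ab; have /match_ofP[ca' cb' lab' hab' hgt'] := ab'.
  (* After a right endpoint the path is back at the height of the left endpoint; of two arcs with
     the same left endpoint, the longer one would then violate its height condition. *)
  have end_ht x y : (x, y) \in match_of -> ht (vidx y).+1 = ht (vidx x).
    by case/match_ofP=> _ cy _ hxy _; rewrite htS /sg cy; lia.
  apply/and4P; split; rewrite /=.
  + apply: contra ne => /eqP e; case: (ltngtP (vidx b) (vidx b')) => [lt|gt|/vidx_inj->]; last by rewrite e.
      have := hgt' (vidx b).+1; rewrite lt ltnS -e ltnW // => /(_ isT).
      by rewrite (end_ht a b) // ltxx.
    have := hgt (vidx b').+1; rewrite gt ltnS e ltnW // => /(_ isT).
    by rewrite (end_ht a' b') // ltxx.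
  + by apply: contraNneq ca => ->.
  + by apply: contraNneq ca' => <-.
  apply: contra ne => /eqP e; case: (ltngtP (vidx a) (vidx a')) => [lt|gt|/vidx_inj->]; last by rewrite e.
    have := hgt (vidx a'); rewrite lt e ltnW // => /(_ isT); move: hab hab'; rewrite e; lia.
  have := hgt' (vidx a); rewrite gt -e ltnW // => /(_ isT); move: hab hab'; rewrite e; lia.
- apply/forall_inP => -[a b] /match_ofP[ca cb lab hab hgt].
  apply/forall_inP => -[a' b'] /match_ofP[ca' cb' lab' hab' hgt'] /=.
  rewrite !vltE; apply/and3P => -[l1 l2 l3].
  have h1 := hgt (vidx a'); rewrite l1 ltnW // in h1; have {h1} h1 := h1 isT.
  have h2 := hgt' (vidx b).+1; rewrite ltnS ltnW // l3 in h2; have {h2} := h2 isT.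
  by rewrite htS /sg cb; move: h1 hab; lia.
apply/forall_inP => -[a b] ab; apply/forallP => v; apply/implyP => /andP[]; rewrite !vltE => l1 l2.
apply/matchedP; case: (boolP (closer v)) => cv.
  by have [a' a'v] := match_left cv; exists (a', v); [|right].
have [|b' vb'] := match_right ab cv; first by rewrite l1.
by exists (v, b'); [|left].
Qed.

Lemma match_of_nS i : nS match_of i = n i.
Proof.
have Sm := match_of_lower; rewrite /nS -card_rights_box //.
have -> : [set l : 'I_(d i) | vtx l \in rights match_of] = [set l : 'I_(d i) | closer (vtx l)].
  apply/setP => l; rewrite !inE; apply/imsetP/idP => [[[a b] /match_ofP[_ cb _ _ _] -> //]|cl].
  by have [a al] := match_left cl; exists (a, vtx l).
by rewrite card_closers subKn.
Qed.

Lemma match_exists : exists2 S : {set vx * vx}, lower_match S & forall i, nS S i = n i.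
Proof. by exists match_of; [exact: match_of_lower | exact: match_of_nS]. Qed.

End Existence.
End MatchingByRightEndpoints.

(** * Points attached to a match *)

Section MatchingPoints.
Variables (k : nat) (d : 'I_k -> nat) (F : finFieldType).
Local Notation vx := (vertex d).
Local Notation m := (dsum d).
Implicit Types (v : vx) (A : {set vx}).

Definition vord v : 'I_m := Ordinal (vidx_lt v).

Lemma vord_inj : injective vord.
Proof. by move=> u v /(congr1 val)/vidx_inj. Qed.

Lemma vidx_lt_psum v j : (vidx v < psum (ext0 d) j)%N = (tag v < j)%N.
Proof.
case: ltnP => [lt|le].
  by apply/esym; rewrite ltnNge; apply: contraTN lt => /(psum_mono (ext0 d)) le;
     rewrite -leqNgt (leq_trans le) ?leq_addr.
apply/esym/negbTE; rewrite -leqNgt; rewrite leqNgt; apply: contraTN le => lt.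
by rewrite -ltnNge (leq_trans (vidx_ltS v)) // psum_mono.
Qed.

Definition pos_lt (j : nat) : {set 'I_m} := [set p : 'I_m | (p < psum (ext0 d) j)%N].

Lemma psum_le_dsum j : (j <= k)%N -> (psum (ext0 d) j <= m)%N.
Proof. by move=> jk; rewrite /dsum -psum_ext0; apply: psum_mono. Qed.

Definition std_flag : {ffun 'I_k.+1 -> {vspace dspace d F}} := [ffun j : 'I_k.+1 => cspan F (pos_lt j)].

Lemma alpha_std A i : alpha (cspan F [set vord v | v in A]) std_flag i = #|[set v in A | tag v == i]|.
Proof.
rewrite /alpha !ffunE !cspanI !dim_cspan /=.
have card j : #|[set vord v | v in A] :&: pos_lt j| = #|[set v in A | (tag v < j)%N]|.
  rewrite -[RHS](card_imset _ vord_inj); apply: eq_card => p; rewrite inE.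
  apply/andP/imsetP => [[/imsetP[v vA ->]]|[v]]; rewrite !inE /= ?vidx_lt_psum.
    by move=> tv; exists v; rewrite // inE vA.
  by case/andP=> vA tv ->; rewrite imset_f //= vidx_lt_psum.
rewrite -[X in pos_lt X]/(i.+1) !card -(cardsID [set v : vx | (tag v < i)%N] [set v in A | (tag v < i.+1)%N]).
rewrite (_ : _ :&: _ = [set v in A | (tag v < i)%N]); last first.
  apply/setP => v; rewrite !inE -andbA; congr (_ && _); case: (ltnP (tag v) i) => lt; rewrite ?andbF ?andbT //.
  by rewrite ltnS ltnW.
rewrite addKn; apply: eq_card => v; rewrite !inE -leqNgt andbCA ltnS -(inj_eq val_inj) [RHS]andbC eqn_leq; move: (v \in A) (_ <= _)%N (_ <= _)%N => [] [] []; done.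
Qed.

(** Vertices index a basis, the flag is given by the boxes, t sends each right endpoint to its left
    endpoint and kills the other basis vectors, and W = im t. That t lowers the flag is the
    condition that arcs join different boxes. *)
Lemma point_exists (S : {set vx * vx}) : lower_match S -> exists p : tvar d F,
  [/\ aW p =1 rS S, aR p =1 rS S & aN p =1 nS S].
Proof.
move=> Sm; pose vv (c : vx * vx) := (vord c.1, vord c.2).
pose SS := [set vv c | c in S]; pose t : 'End(dspace d F) := pairing_end F SS.
have inj1 : {in SS &, injective fst}.
  move=> _ _ /imsetP[c cS ->] /imsetP[c' c'S ->] /= /vord_inj e.
  by rewrite (match_inj1 Sm cS c'S e).
have inj2 : {in SS &, injective snd}.
  move=> _ _ /imsetP[c cS ->] /imsetP[c' c'S ->] /= /vord_inj e.
  by rewrite (match_inj2 Sm cS c'S e).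
pose L := [set c.1 | c in S].
have S1 : [set c.1 | c in SS] = [set vord v | v in L] by rewrite -!imset_comp.
have S2 : [set c.2 | c in SS] = [set vord v | v in rights S] by rewrite -!imset_comp.
have S2C : (~: [set c.2 | c in SS])%SET = [set vord v | v in ~: rights S].
  rewrite S2; apply/setP => p; have [v ->] : exists v, p = vord v.
    by have [v e] := vidx_surj (ltn_ord p); exists v; apply/val_inj.
  by rewrite inE !(mem_imset _ _ vord_inj) inE.
have LR : L \subset ~: rights S.
  apply/fintype.subsetP => _ /imsetP[c cS ->]; rewrite inE; apply/imsetP => -[c' c'S e].
  case: (eqVneq c c') => [ec|ne]; first by have := match_neq Sm cS; rewrite {1}e ec eqxx.
  by have [_ + _ _] := match_disj Sm cS c'S ne; rewrite e eqxx.
pose W := cspan F [set vord v | v in L].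
have xT : in_tvar (std_flag, W, t).
  apply/and4P; split.
  - rewrite ffunE (_ : pos_lt _ = finset.set0) ?cspan0 //.
    by apply/setP => p; rewrite !inE /psum big_ord0.
  - rewrite ffunE (_ : pos_lt _ = [set: 'I_m]) ?cspanT //.
    by apply/setP => p; rewrite !inE /= psum_ext0 ltn_ord.
  - apply/forallP => i; rewrite !ffunE; apply/and3P; split.
    + apply/cspanS/fintype.subsetP => p; rewrite !inE => /leq_trans; apply.
      by apply: psum_mono; rewrite /= /bump.
    + rewrite !dim_cspan !card_ord_lt ?psum_le_dsum //=; last exact: ltnW.
      by rewrite /bump /= add1n psumS ext0E.
    apply: pairing_img => // _ /imsetP[c cS ->]; rewrite !inE /= !vidx_lt_psum.
    by rewrite /bump /= add1n ltnS => /(leq_trans (match_tag Sm cS)).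
  by rewrite limg_pairing // lker_pairing // S1 S2C /W subvv cspanS // imsetS.
exists (Sub (std_flag, W, t) xT); rewrite /sub /imag /kern /flag /nil_end /=.
have rE i : #|[set v in L | tag v == i]| = rS S i.
  rewrite /rS -[RHS](card_in_imset (f := fst)); last first.
    by move=> c c'; rewrite !inE => /andP[cS _] /andP[c'S _]; exact: (match_inj1 Sm cS c'S).
  apply: eq_card => v; rewrite inE; apply/andP/imsetP => [[/imsetP[c cS ->] ti]|[c]].
    by exists c; rewrite // inE cS.
  by rewrite inE => /andP[cS ti] ->; rewrite imset_f.
split=> i; first by rewrite alpha_std.
  by rewrite limg_pairing // S1 alpha_std.
rewrite lker_pairing // S2C alpha_std /nS -card_rights_box //.
have vinj : injective (@vtx k d i) by move=> l l' /eqP; rewrite eq_Tagged /= => /eqP.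
have -> : #|[set v in (~: rights S)%SET | tag v == i]| = #|(~: [set l : 'I_(d i) | vtx l \in rights S])%SET|.
  rewrite -[RHS](card_imset _ vinj); apply: eq_card => v; rewrite !inE.
  apply/andP/imsetP => [[vR /eqP]|[l]].
    by case: v vR => j l /= vR ej; case: i / ej {vinj}; exists l; rewrite // !inE.
  by rewrite !inE => lR ->; rewrite lR /= eqxx.
by rewrite cardsCs finset.setCK card_ord.
Qed.

Lemma up_points (p : tvar d F) (w : 'I_k -> nat) : (forall i, aW p i <= w i <= aN p i)%N ->
  exists x : tvar d F, inA w (aR p) (aN p) x.
Proof.
move: {2}(\sum_i (w i - aW p i))%N (erefl (\sum_i (w i - aW p i))%N) => s.
elim: s p => [|s IH] p e wp.
  exists p; apply/inAP; split=> // i; apply/eqP; have /andP[le _] := wp i.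
  rewrite eqn_leq le; move/eqP: e; rewrite sum_nat_eq0 => /forallP/(_ i)/implyP/(_ isT).
  by rewrite subn_eq0.
have [i lt] : exists i, (aW p i < w i)%N.
  apply/existsP; apply: contra_eqT e => /existsPn le; rewrite big1 // => i _.
  by have := le i; rewrite -leqNgt => /eqP.
have /andP[_ wn] := wp i; have [x xA] := up_point (leq_trans lt wn).
have [e1 e2 e3] := inA_fun xA.
have [||y] := IH x; last by rewrite e2 e3; exists y.
- apply/eqP; rewrite -eqSS -e e1 [X in _ == X](bigD1 i) //= (bigD1 i) //= /wadd eqxx -addSn.
  apply/eqP; congr (_ + _)%N; first by lia.
  by apply: eq_bigr => j ji; rewrite (negPf ji) addn0.
move=> j; rewrite e1 e3 /wadd; have /andP[l1 l2] := wp j; rewrite l2 andbT.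
by case: (eqVneq j i) => [->|_]; rewrite ?addn0 // addn1.
Qed.

End MatchingPoints.

(** * The space T_c *)

Section EtaInverse.
Variables (k : nat) (d : 'I_k -> nat) (C : numFieldType) (F : finFieldType).
Local Notation K := C`(q).
Local Notation q := (qq C).
Implicit Types (p x : tvar d F) (w r n : 'I_k -> nat) (f : tfun d C F).

(** The change of the normalising exponent of f_(w,r,n); it converts the symmetric exponents of
    [Eco] and [Fco] into the one-sided ones of the coproduct. *)
Lemma fexp_wadd w r n i : fexp (wadd w i) r n = fexp w r n +
  (lsum (idiff r w) i + rsum (idiff n w) i).
Proof.
have e (a b : 'I_k) : (r a)%:Z * (wadd w i b)%:Z + (wadd w i a)%:Z * (n b)%:Z - (wadd w i a)%:Z * (wadd w i b)%:Z =
  ((r a)%:Z * (w b)%:Z + (w a)%:Z * (n b)%:Z - (w a)%:Z * (w b)%:Z) +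
  (pulse i 1 b * ((r a)%:Z - (w a)%:Z) + pulse i 1 a * ((n b)%:Z - (w b)%:Z) - pulse i 1 a * pulse i 1 b).
  have pE (j : 'I_k) : (wadd w i j)%:Z = (w j)%:Z + pulse i 1 j.
    by rewrite /wadd /pulse; case: eqP => _; rewrite ?addn0 ?addr0 ?addn1 // intS addrC.
  by rewrite !pE; ring.
rewrite /fexp; under eq_bigr => a _ do under eq_bigr => b _ do rewrite e.
under eq_bigr => a _ do rewrite big_split /=.
rewrite big_split /=; congr (_ + _).
have /= el := sum_pulse_left (fun j => (r j)%:Z - (w j)%:Z) i 1.
have /= er := sum_pulse_right (fun j => (n j)%:Z - (w j)%:Z) i 1.
under eq_bigr => a _ do rewrite sumrB big_split /=.
rewrite sumrB big_split /= el er !mul1r.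
by rewrite (@pulse_pulse0 _ i 1 (fun a b => (a < b)%N)) ?ltnn // subr0.
Qed.

Lemma fexp_wsub w r n i : (0 < w i)%N -> fexp (wsub w i) r n = fexp w r n -
  (lsum (idiff r w) i + rsum (idiff n w) i).
Proof.
move=> wi; have e : w = wadd (wsub w i) i.
  by apply/funext => j; rewrite /wadd /wsub; case: eqP => [->|_] /=; lia.
rewrite {2}e fexp_wadd; apply/eqP; rewrite eq_sym subr_eq; apply/eqP; congr (_ + (_ + _)).
  by apply: lsum_agree => j ji; rewrite /idiff /wsub (negPf ji) subn0.
by apply: rsum_agree => j ji; rewrite /idiff /wsub (negPf ji) subn0.
Qed.

Lemma expq_regroup (A B X Y : int) (Z P : K) : A + B = X + Y ->
  q ^ A * (q ^ B * Z * P) = q ^ X * Z * (q ^ Y * P).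
Proof. by move=> e; rewrite [RHS]mulrACA !mulrA -!expfzDr ?qq_neq0 // e. Qed.

Section Types.
(** e is a variable with an equation because it is used both as n - r and, for r = 0 and n = d, as d
    itself. *)
Variables (e r n : 'I_k -> nat).
Hypothesis e_def : forall i, e i = (n i - r i)%N.
Implicit Types (u : tidx e) (phi : tens C e).

Definition widx p : tidx e := finfun (fun i => inord (aW p i - r i)).

Lemma etainvE phi p : etainv d C F e r n phi p =
  \sum_u phi u * (q ^ fexp (fun i => u i + r i)%N r n * (inA (fun i => u i + r i)%N r n p)%:R).
Proof. by rewrite /etainv lfunE /= sum_ffunE; apply: eq_bigr => u _; rewrite !ffunE. Qed.

Lemma etainv_tspace phi : etainv d C F e r n phi \in tspace d C F.
Proof.
apply/tspaceP => y y' yy'; rewrite !etainvE; apply: eq_bigr => u _.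
by rewrite (inA_type _ _ _ yy').
Qed.

Lemma etainv_out phi p : ~ (aR p = r /\ aN p = n) -> etainv d C F e r n phi p = 0.
Proof.
move=> out; rewrite etainvE big1 // => u _.
by case: (boolP (inA _ _ _ _)) => [/inA_fun[_ e1 e2]|_]; [case: out | rewrite !mulr0].
Qed.

Lemma widxE p : aR p = r -> aN p = n -> forall i, (widx p i + r i)%N = aW p i.
Proof.
move=> pr pn i; rewrite ffunE inordK; first by rewrite subnK // -pr aR_le_aW.
by rewrite ltnS e_def leq_sub2r // -pn aW_le_aN.
Qed.

Lemma twt_widx p j : aR p = r -> aN p = n ->
  twt (widx p) j = idiff n (aW p) j + idiff r (aW p) j.
Proof.
move=> pr pn; have := widxE pr pn j; have := e_def j.
by have := aW_le_aN p j; rewrite /twt /idiff pn; lia.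
Qed.

Lemma lsum_twt_widx p i : aR p = r -> aN p = n ->
  lsum (twt (widx p)) i = lsum (idiff n (aW p)) i + lsum (idiff r (aW p)) i.
Proof. by move=> pr pn; rewrite -big_split; apply: eq_bigr => j _; exact: twt_widx. Qed.

Lemma rsum_twt_widx p i : aR p = r -> aN p = n ->
  rsum (twt (widx p)) i = rsum (idiff n (aW p)) i + rsum (idiff r (aW p)) i.
Proof. by move=> pr pn; rewrite -big_split; apply: eq_bigr => j _; exact: twt_widx. Qed.

Lemma etainv_in phi p : aR p = r -> aN p = n ->
  etainv d C F e r n phi p = q ^ fexp (aW p) r n * phi (widx p).
Proof.
move=> pr pn; have wE := widxE pr pn; rewrite etainvE (bigD1 (widx p)) //= big1 ?addr0 => [|u ne].
  have -> : (fun i => widx p i + r i)%N = aW p by apply/funext.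
  by rewrite (_ : inA _ _ _ _) ?mulr1 1?mulrC //; apply/inAP; rewrite pr pn.
case: (boolP (inA _ _ _ _)) => [/inAP[e1 _ _]|_]; last by rewrite !mulr0.
case/eqP: ne; apply/ffunP => i; apply/val_inj/eqP; rewrite /= -(eqn_add2r (r i)) wE.
by rewrite e1.
Qed.

(** At a point of type (w, r, n) the weight of box i of the tensor index is (n_i - w_i) + (r_i -
    w_i). Hence the exponent of K on the left in the coproduct and that of [Eco] differ by the
    increment in [fexp_wadd]. *)
Lemma etainv_actE phi : etainv d C F e r n (opmx (@tE C k e) phi) = actE_fun (etainv d C F e r n phi).
Proof.
apply/ffunP => p; rewrite actE_raw.
case: (pselect (aR p = r /\ aN p = n)) => [[pr pn]|out]; last first.
  rewrite etainv_out // big1 // => i _; rewrite /val_on.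
  case: pickP => [x /inA_fun[_ xr xn]|]; last by rewrite mulr0.
  by rewrite etainv_out ?mulr0 // xr xn.
have wE := widxE pr pn; rewrite etainv_in // opmxE tE_row mulr_sumr; apply: eq_bigr => i _.
rewrite -[RHS](@Eco_val_on _ _ _ _ p i
   (q ^ fexp (wadd (aW p) i) r n * phi (tset (widx p) i (widx p i).+1))); last first.
  move=> x xA; rewrite (val_on_inA xA); last exact/tspaceP/etainv_tspace.
  have [xw xr xn] := inA_fun xA; rewrite etainv_in ?xr ?xn // xw; congr (_ * phi _).
  apply/esym/ffunP => j; apply/val_inj; rewrite /= [in LHS]ffunE xw /wadd.
  have ltj (l : nat) : (l <= aN p j)%N -> (inord (l - r j) : 'I_(e j).+1) = (l - r j)%N :> nat.
    by move=> le; rewrite inordK // ltnS e_def -pn leq_sub2r.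
  have wj := wE j; have le := aW_le_aN x j; rewrite xw xn /wadd in le.
  rewrite ltj //; case: eqP le wj => [->|/eqP ji] le wj; last by rewrite tset_other // -wj addn0 addnK.
  by rewrite tset_same; have := e_def i; rewrite -?pn; lia.
have ei : (e i)%:Z - (widx p i)%:Z = idiff (aN p) (aW p) i.
  by have := wE i; have := aW_le_aN p i; have := e_def i; rewrite /idiff -pn; lia.
case: ltnP => lt; last first.
  rewrite mulr0 (iffRL (Eco_eq0 _ _ _ _)) ?mul0r //.
  by have := wE i; have := aW_le_aN p i; have := e_def i; rewrite pn; lia.
rewrite ei /Eco; apply: expq_regroup; rewrite fexp_wadd (lsum_twt_widx _ pr pn) pn.
by ring.
Qed.

Lemma etainv_actF phi : etainv d C F e r n (opmx (@tF C k e) phi) = actF_fun (etainv d C F e r n phi).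
Proof.
apply/ffunP => p; rewrite actF_raw.
case: (pselect (aR p = r /\ aN p = n)) => [[pr pn]|out]; last first.
  rewrite etainv_out // big1 // => i _; rewrite /val_on.
  case: pickP => [x /inA_fun[_ xr xn]|]; last by rewrite mulr0.
  by rewrite etainv_out ?mulr0 // xr xn.
have wE := widxE pr pn; rewrite etainv_in // opmxE tF_row mulr_sumr; apply: eq_bigr => i _.
rewrite -[RHS](@Fco_val_on _ _ _ _ p i
   (q ^ fexp (wsub (aW p) i) r n * phi (tset (widx p) i (widx p i).-1))); last first.
  move=> x xA; rewrite (val_on_inA xA); last exact/tspaceP/etainv_tspace.
  have [xw xr xn] := inA_fun xA; rewrite etainv_in ?xr ?xn // xw; congr (_ * phi _).
  apply/esym/ffunP => j; apply/val_inj; rewrite /= [in LHS]ffunE xw /wsub.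
  have ltj (l : nat) : (l <= aN p j)%N -> (inord (l - r j) : 'I_(e j).+1) = (l - r j)%N :> nat.
    by move=> le; rewrite inordK // ltnS e_def -pn leq_sub2r.
  have wj := wE j; have le := aW_le_aN p j; have le' : (aW p j - (j == i) <= aN p j)%N by lia.
  rewrite ltj //; case: eqP wj => [->|/eqP ji] wj; last by rewrite tset_other // -wj subn0 addnK.
  by rewrite tset_same; have := ltn_ord (widx p i); lia.
case: posnP => [e0|gt]; last first.
  have ei : (widx p i)%:Z = idiff (aW p) (aR p) i.
    by have := wE i; rewrite /idiff -pr; lia.
  rewrite ei /Fco; apply: expq_regroup; rewrite fexp_wsub; last by rewrite -wE addn_gt0 gt.
  rewrite (rsum_twt_widx _ pr pn) pr.
  have opp (a b : 'I_k -> nat) : rsum (idiff a b) i = - rsum (idiff b a) i /\ lsum (idiff a b) i = - lsum (idiff b a) i.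
    by split; rewrite -sumrN; apply: eq_bigr => j _; rewrite opprB.
  by rewrite (opp (aW p) r).1 (opp (aW p) r).2; ring.
by rewrite mulr0 (iffRL (Fco_eq0 _ _ _ _)) ?mul0r // -wE e0 pr.
Qed.

Lemma sum_twt_widx p : aR p = r -> aN p = n ->
  \sum_i twt (widx p) i = (dsum d)%:Z - 2 * (\dim (sub p))%:Z.
Proof.
move=> pr pn; under eq_bigr => i _ do rewrite (twt_widx _ pr pn).
rewrite big_split /= !sum_idiff -pr -pn !sum_alpha.
by have := rank_nullity p; rewrite /dsum; lia.
Qed.

Lemma etainv_actK phi : etainv d C F e r n (opmx (@tK C k e) phi) = actK_fun (etainv d C F e r n phi).
Proof.
apply/ffunP => p; rewrite ffunE.
case: (pselect (aR p = r /\ aN p = n)) => [[pr pn]|out]; last by rewrite !etainv_out // mulr0.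
by rewrite !etainv_in // opmxE tK_row sum_twt_widx // mulrCA.
Qed.

Lemma etainv_actKi phi : etainv d C F e r n (opmx (@tKi C k e) phi) = actKi_fun (etainv d C F e r n phi).
Proof.
apply/ffunP => p; rewrite ffunE.
case: (pselect (aR p = r /\ aN p = n)) => [[pr pn]|out]; last by rewrite !etainv_out // mulr0.
by rewrite !etainv_in // opmxE tKi_row sum_twt_widx // mulrCA.
Qed.

End Types.
End EtaInverse.

(** * T_c as a quotient of the tensor product *)

Section TcSpace.
Variables (k : nat) (d : 'I_k -> nat) (C : numFieldType) (F : finFieldType).
Local Notation K := C`(q).
Local Notation q := (qq C).
Implicit Types (p x : tvar d F) (w r n : 'I_k -> nat) (f : tfun d C F) (phi : tens C d).

Lemma lower_match0 : lower_match (finset.set0 : {set vertex d * vertex d}).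
Proof. by apply/and4P; split; apply/forall_inP => a; rewrite inE. Qed.

(** The empty match gives a point with t = 0 and W = 0, and W can then be enlarged box by box. *)
Lemma zero_stratum (u : tidx d) : exists x : tvar d F, inA (fun i => u i + 0)%N (fun=> 0%N) d x.
Proof.
have [p [pw pr pn]] := point_exists F lower_match0.
have S0 (P : pred (vertex d * vertex d)) : #|[set a in (finset.set0 : {set vertex d * vertex d}) | P a]| = 0%N.
  by apply: eq_card0 => a; rewrite !inE.
have [i|x] := @up_points _ _ _ p (fun i => u i + 0)%N.
  by have := ltn_ord (u i); rewrite pw pn /rS /nS !S0; lia.
have -> : (fun=> 0%N) = aR p by apply/esym/funext => i; rewrite pr /rS S0.
suff e : aN p = d by rewrite e => xA; exists x.
by apply/funext => i; rewrite pn /nS S0 subn0.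
Qed.

Lemma subn0_dims i : d i = (d i - 0)%N.
Proof. by rewrite subn0. Qed.

Lemma etainvK phi : eta d C F d (fun=> 0%N) d (etainv d C F d (fun=> 0%N) d phi) = phi.
Proof.
apply/ffunP => u; rewrite /eta lfunE /= ffunE; have [x xA] := zero_stratum u.
have [xw xr xn] := inA_fun xA.
rewrite (val_on_inA xA); last exact/tspaceP/etainv_tspace.
rewrite (etainv_in subn0_dims) // xw mulrA -expfzDr ?qq_neq0 // addNr mul1r; congr (phi _).
apply/ffunP => i; apply/val_inj/eqP; rewrite /= -(eqn_add2r 0) (widxE subn0_dims xr xn).
by rewrite xw.
Qed.

(** The map epsilon after the inverse of eta_(0,d); it parametrises T_c by the tensor product. *)
Definition Phi phi : tfun d C F := \sum_(r : midx d) \sum_(n : midx d)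
  etainv d C F (fun i => n i - r i)%N r n (gamma d C r n phi).

Lemma epsilon_etainv phi : epsilon d C F (etainv d C F d (fun=> 0%N) d phi) = Phi phi.
Proof.
rewrite /epsilon sum_lfunE; apply: eq_bigr => r _; rewrite sum_lfunE.
by apply: eq_bigr => n _; rewrite !comp_lfunE etainvK.
Qed.

Lemma t0spaceP f : reflect (exists phi, f = etainv d C F d (fun=> 0%N) d phi) (f \in t0space d C F).
Proof.
apply: (iffP idP) => [f0|[phi ->]].
  suff /subvP h : (t0space d C F <= limg (etainv d C F d (fun=> 0%N) d))%VS.
    by have /memv_imgP[phi _ e] := h f f0; exists phi.
  apply/span_subvP => _ /fintype.imageP[w _ ->].
  case: (boolP [forall i, w i <= d i]%N) => [/forallP wd|/forallPn[i wd]].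
    apply/memv_imgP; exists (basis C (finfun (fun i => inord (w i)) : tidx d)); rewrite ?memvf //.
    rewrite /etainv lfunE /= /etainv_fun (bigD1 (finfun (fun i => inord (w i)) : tidx d)) //=.
    rewrite ffunE eqxx scale1r big1 ?addr0 => [|u ne]; last by rewrite ffunE (negPf ne) scale0r.
    congr (fwrn _ _ _ _ _); apply/funext => i; rewrite ffunE inordK ?ltnS ?wd //.
    by rewrite addn0.
  rewrite (_ : fwrn _ _ _ _ _ _ = 0) ?mem0v //; apply/ffunP => x; rewrite !ffunE.
  case: (boolP (inA _ _ _ _)) => [/inAP[e _ _]|]; last by rewrite mulr0.
  by case/negP: wd; rewrite -[X in (X <= _)%N]e (leq_trans (aW_le_aN _ _)) // aN_le_d.
rewrite /etainv lfunE /= /etainv_fun; apply: memv_suml => u _; apply/memvZ/memv_span.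
have ud i : (u i < (dsum d).+1)%N.
  by rewrite (leq_trans (ltn_ord _)) // ltnS /dsum (bigD1 i) //= leq_addr.
apply/fintype.imageP; exists [ffun i => Ordinal (ud i)] => //; congr (fwrn _ _ _ _ _).
by apply/funext => i; rewrite /mval ffunE addn0.
Qed.

Lemma tc_spaceP f : reflect (exists phi, f = Phi phi) (f \in tc_space d C F).
Proof.
apply: (iffP memv_imgP) => [[_ /t0spaceP[phi ->] ->]|[phi ->]].
  by exists phi; rewrite epsilon_etainv.
exists (etainv d C F d (fun=> 0%N) d phi); last by rewrite epsilon_etainv.
by apply/t0spaceP; exists phi.
Qed.

Lemma gamma_intertwines r n phi (A : tidx d -> tidx d -> K)
   (B : tidx (fun i => n i - r i)%N -> tidx (fun i => n i - r i)%N -> K) :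
  (forall S, lower_match S -> (forall i, rS S i = r i) -> (forall i, nS S i = n i) -> forall a b,
    \sum_b' gammaS C S a b' * A b' b = \sum_a' B a a' * gammaS C S a' b) ->
  gamma d C r n (opmx A phi) = opmx B (gamma d C r n phi).
Proof.
move=> AB; rewrite /gamma; case: pickP => [S /andP[Sm /forallP E]|_]; last first.
  by rewrite !zero_lfunE linear0.
by apply: opmx_comm; apply: AB => // i; have /andP[/eqP e1 /eqP e2] := E i.
Qed.

Lemma Phi_intertwines phi (A : tidx d -> tidx d -> K)
    (B : forall e : 'I_k -> nat, tidx e -> tidx e -> K) (act : {linear tfun d C F -> tfun d C F}) :
  (forall r n S, lower_match S -> (forall i, rS S i = r i) -> (forall i, nS S i = n i) -> forall a b,
    \sum_b' gammaS C S a b' * A b' b = \sum_a' @B (fun i => n i - r i)%N a a' * gammaS C S a' b) ->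
  (forall r n psi, let e := (fun i => n i - r i)%N in
     etainv d C F e r n (opmx (@B e) psi) = act (etainv d C F e r n psi)) ->
  Phi (opmx A phi) = act (Phi phi).
Proof.
move=> AB Bact; rewrite /Phi linear_sum; apply: eq_bigr => r _; rewrite linear_sum.
by apply: eq_bigr => n _; rewrite (gamma_intertwines _ (AB (mval r) (mval n))) Bact.
Qed.

Lemma Phi_actE phi : Phi (opmx (@tE C k d) phi) = actE_fun (Phi phi).
Proof.
apply: (@Phi_intertwines _ _ (@tE C k)) => [r n S Sm rE nE|r n psi /=]; first exact: gammaS_E.
exact: etainv_actE.
Qed.

Lemma Phi_actF phi : Phi (opmx (@tF C k d) phi) = actF_fun (Phi phi).
Proof.
apply: (@Phi_intertwines _ _ (@tF C k)) => [r n S Sm rE nE|r n psi /=]; first exact: gammaS_F.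
exact: etainv_actF.
Qed.

Lemma Phi_actK phi : Phi (opmx (@tK C k d) phi) = actK_fun (Phi phi).
Proof.
apply: (@Phi_intertwines _ _ (@tK C k)) => [r n S Sm rE nE a b|r n psi /=]; last exact: etainv_actK.
rewrite tK_col (tK_row (fun a => gammaS C S a b)).
by case: (eqVneq (gammaS C S a b) 0) => [->|/(gammaS_weight Sm rE nE)->]; rewrite ?mulr0.
Qed.

Lemma Phi_actKi phi : Phi (opmx (@tKi C k d) phi) = actKi_fun (Phi phi).
Proof.
apply: (@Phi_intertwines _ _ (@tKi C k)) => [r n S Sm rE nE a b|r n psi /=]; last exact: etainv_actKi.
rewrite tKi_col (tKi_row (fun a => gammaS C S a b)).
by case: (eqVneq (gammaS C S a b) 0) => [->|/(gammaS_weight Sm rE nE)->]; rewrite ?mulr0.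
Qed.

Lemma Phi_tspace phi : Phi phi \in tspace d C F.
Proof. by apply: memv_suml => r _; apply: memv_suml => n _; apply: etainv_tspace. Qed.

Lemma tc_module : uq_module (act_ops d C F) (fun f => f \in tc_space d C F).
Proof.
apply: act_uq_module.
  by split=> [|a f g fM gM]; [exact: mem0v | apply: memvD => //; exact: memvZ].
move=> f /tc_spaceP[phi ->]; split; first exact: Phi_tspace.
- by apply/tc_spaceP; exists (opmx (@tE C k d) phi); rewrite Phi_actE.
- by apply/tc_spaceP; exists (opmx (@tF C k d) phi); rewrite Phi_actF.
- by apply/tc_spaceP; exists (opmx (@tK C k d) phi); rewrite Phi_actK.
by apply/tc_spaceP; exists (opmx (@tKi C k d) phi); rewrite Phi_actKi.
Qed.

End TcSpace.

(** * Bijectivity of xi *)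

Section LowestCoefficient.
Variables (k : nat) (d : 'I_k -> nat) (C : numFieldType).
Local Notation K := C`(q).
Local Notation q := (qq C).
Local Notation vx := (vertex d).
Local Notation label := {ffun vx -> 'I_2}.
Implicit Types (v : vx) (x : label).

(* Moving a v_{-1} along an arc from the right to the left endpoint lowers this statistic. *)
Definition stat (b : 'I_k -> nat) : nat := (\sum_(i < k) i * b i)%N.

Variable S : {set vx * vx}.
Hypothesis Sm : lower_match S.
Variables (r n : 'I_k -> nat).
Hypotheses (rE : forall i, rS S i = r i) (nE : forall i, nS S i = n i).
Local Notation e := (fun i => n i - r i)%N.
Variable a : tidx e.
Hypothesis a0 : forall i, a i = ord0.

Lemma iota_boxes_cnt x (b : tidx d) : iota_boxes C x b != 0 ->
  forall i, b i = (\sum_(l : 'I_(d i)) x (vtx l))%N :> nat.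
Proof.
move=> /prodf_neq0 nz i; rewrite -(iotac_cnt (nz i isT)) -box_idxE /cnt.
by apply: eq_bigr => l _; rewrite ffunE.
Qed.

Lemma kappa_arc x : kappa C S x != 0 -> forall c, c \in S -> (x c.1 + x c.2 = 1)%N.
Proof.
move=> nz c cS; have := kappa_balanced nz cS; rewrite /balanced /wv.
have arith (A B : nat) : 1 - 2 * A%:Z + (1 - 2 * B%:Z) = 0 -> (A + B = 1)%N by lia.
exact: arith.
Qed.

Lemma free_cnt x : (\sum_(v | ~~ matched S v) x v)%N = (\sum_i cnt (fidx S e x i))%N.
Proof.
have /= := sum_frees (size_fr Sm rE nE) xpredT (fun v => x v : nat).
rewrite (eq_bigl (fun v => ~~ matched S v)) => [->|v]; last by rewrite andbT.
apply: eq_bigr => i _; apply: eq_bigr => j _.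
by rewrite (fidxE (size_fr Sm rE nE)).
Qed.

Lemma pi_boxes_free x : pi_boxes C S a x != 0 -> forall v, ~~ matched S v -> x v = 0%N :> nat.
Proof.
move=> /prodf_neq0 nz v vS; apply/eqP; have := free_cnt x.
rewrite [RHS]big1 => [|i _]; last by have := pic_cnt (nz i isT); rewrite a0.
by move/eqP; rewrite sum_nat_eq0 => /forallP/(_ v); rewrite vS.
Qed.

Definition closers_at (i : 'I_k) : nat := #|[set c in S | tag c.2 == i]|.

Lemma stat_closers : stat closers_at = (\sum_(c in S) tag c.2)%N.
Proof.
rewrite /stat (partition_big (fun c : vx * vx => tag c.2) xpredT) //=.
apply: eq_bigr => i _; rewrite mulnC /closers_at -sum1_card big_distrl /=.
by apply: eq_big => [c|c]; rewrite inE // => /andP[_ /eqP->]; rewrite mul1n.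
Qed.

Lemma stat_label x (b : tidx d) : iota_boxes C x b != 0 -> stat (fun i => b i) = (\sum_(v : vx) tag v * x v)%N.
Proof.
move=> nz; have := sum_vertex xpredT (fun v : vx => (tag v * x v)%N) => ->.
by apply: eq_bigr => i _; rewrite (iota_boxes_cnt nz) big_distrr.
Qed.

Lemma stat_arcs x : (forall v, ~~ matched S v -> x v = 0%N :> nat) ->
  (\sum_(v : vx) tag v * x v = \sum_(c in S) (tag c.1 * x c.1 + tag c.2 * x c.2))%N.
Proof.
move=> free; rewrite (bigID (matched S)) /= [X in (_ + X)%N]big1 ?addn0 => [|v /free->]; last by rewrite muln0.
exact: (sum_matched Sm (fun v : vx => (tag v * x v)%N)).
Qed.

(** As a is the highest weight index, pi forces v_1 at all free vertices. Each arc carries exactly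
    one v_{-1}, which counts most for [stat] at the right endpoint, so equality puts all of them
    there. *)
Lemma coef_stat x (b : tidx d) : iota_boxes C x b * kappa C S x * pi_boxes C S a x != 0 ->
  (stat (fun i => b i) <= stat closers_at)%N /\
  (stat (fun i => b i) = stat closers_at -> forall v, x v = (v \in rights S) :> nat).
Proof.
rewrite !mulf_eq0 !negb_or => /andP[/andP[nz1 nz2] nz3].
have free := pi_boxes_free nz3; have arc := kappa_arc nz2.
have le c : c \in S -> (tag c.1 * x c.1 + tag c.2 * x c.2 <= tag c.2)%N.
  move=> cS; have := arc c cS; have := match_tag Sm cS.
  by case: (x c.1 : nat) (x c.2 : nat) => [|[|?]] [|[|?]] //= lt _; rewrite ?muln0 ?muln1 ?addn0 ?add0n // ltnW.
rewrite (stat_label nz1) stat_arcs // stat_closers; split; first exact: leq_sum.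
move=> es v; have eqc c : c \in S -> x c.2 = 1%N :> nat.
  move=> cS; apply/eqP; move/eqP: es; rewrite eqn_leq => /andP[_].
  apply: contraTT => ne; rewrite -ltnNge (bigD1 c) //= [ltnRHS](bigD1 c) //= -addSn leq_add //.
    have := arc c cS; have := match_tag Sm cS; have := ltn_ord (x c.2); move: ne.
    by case: (x c.1 : nat) (x c.2 : nat) => [|[|?]] [|[|?]] //= _ _ lt _; rewrite muln0 muln1 addn0.
  by apply: leq_sum => c' /andP[c'S _]; exact: le.
case: (boolP (v \in rights S)) => [/imsetP[c cS ->]|vR]; first exact: eqc.
case: (boolP (matched S v)) => [/matchedP[c cS [<-|e2]]|/free//].
  by have := arc c cS; rewrite (eqc c cS); lia.
by case/negP: vR; rewrite -e2 imset_f.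
Qed.

Lemma gammaS_stat (b : tidx d) : gammaS C S a b != 0 ->
  (stat (fun i => b i) <= stat closers_at)%N /\
  (stat (fun i => b i) = stat closers_at -> forall i, b i = closers_at i :> nat).
Proof.
rewrite (gammaSE C S) => nz; have [x nzx] : exists x, iota_boxes C x b * kappa C S x * pi_boxes C S a x != 0.
  apply/existsP; apply: contra_neqT nz => /existsPn h; rewrite big1 // => x _.
  by apply/eqP/negPn/h.
have [le eqx] := coef_stat nzx; split=> // /eqx ex i.
have nz1 : iota_boxes C x b != 0 by apply: contraNneq nzx => ->; rewrite !mul0r.
rewrite (iota_boxes_cnt nz1) /closers_at -card_rights_box // -sum1_card [RHS]big_mkcond.
by apply: eq_bigr => l _; rewrite ex inE; case: (_ \in _).
Qed.

(** By the equality case of [coef_stat] a single labelling contributes, so nothing can cancel; its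
    three factors are nonzero. *)
Lemma gammaS_neq0 (b : tidx d) : (forall i, b i = closers_at i :> nat) -> gammaS C S a b != 0.
Proof.
move=> bE; have sb : stat (fun i => b i) = stat closers_at.
  by apply: eq_bigr => i _; rewrite bE.
pose x0 : label := [ffun v => inord (v \in rights S)].
have x0E v : x0 v = (v \in rights S) :> nat by rewrite ffunE inordK //; case: (_ \in _).
rewrite (gammaSE C S) (bigD1 x0) //= big1 ?addr0 => [|x ne]; last first.
  apply/eqP; apply: contraNT ne => /coef_stat[_ /(_ sb) ex].
  by apply/eqP/ffunP => v; apply/val_inj; rewrite /= ex x0E.
rewrite !mulf_neq0 //.
- apply/prodf_neq0 => i _; apply: iotac_neq0; rewrite bE /closers_at -card_rights_box //.
  rewrite -box_idxE /cnt -sum1_card [RHS]big_mkcond; apply: eq_bigr => l _.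
  by rewrite ffunE x0E inE; case: (_ \in _).
- apply/prodf_neq0 => c cS.
  have x1 : x0 c.1 = inord 0.
    apply/val_inj; rewrite /= x0E inordK //; apply/eqP; rewrite eqb0; apply/imsetP => -[c' c'S e].
    case: (eqVneq c c') => [ec|ne]; first by have := match_neq Sm cS; rewrite {1}e ec eqxx.
    by have [_ + _ _] := match_disj Sm cS c'S ne; rewrite e eqxx.
  have x2 : x0 c.2 = inord 1 by apply/val_inj; rewrite /= x0E inordK // imset_f.
  by rewrite x1 x2; have [_ -> _ _] := evE C; rewrite oppr_eq0 invr_eq0 qq_neq0.
apply/prodf_neq0 => i _; rewrite a0.
have -> : fidx S e x0 i = finfun (fun _ => ord0).
  apply: cnt_eq0; apply/eqP; have := free_cnt x0; rewrite [LHS]big1 => [|v vS].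
    by move/esym/eqP; rewrite sum_nat_eq0 => /forallP/(_ i).
  rewrite x0E; apply/eqP; rewrite eqb0; apply: contra vS => /imsetP[c cS ->].
  by apply/matchedP; exists c; [|right].
by rewrite pic_top oner_neq0.
Qed.

End LowestCoefficient.

(** * Kernel types satisfy the ballot condition *)

Section FeasibleKernels.
Variables (k : nat) (d : 'I_k -> nat) (F : finFieldType).
Implicit Types p x : tvar d F.

Lemma sum_ord_lt (f : 'I_k -> nat) (i : 'I_k) :
  (\sum_(j : 'I_k | (j <= i)%N) f j)%N = (\sum_(j : 'I_k | (j < i)%N) f j + f i)%N.
Proof.
rewrite (bigD1 i) //= addnC; congr (_ + _)%N; apply: eq_bigl => j.
by rewrite andbC -ltn_neqAle.
Qed.

(** t maps step i + 1 of the flag into the part of ker t in step i; rank-nullity on step i + 1 turns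
    this into the inequality. *)
Lemma kernel_feasible p (i : 'I_k) :
  (\sum_(j : 'I_k | (j <= i)%N) (d j - aN p j) <= \sum_(j : 'I_k | (j < i)%N) aN p j)%N.
Proof.
have ik := ltn_ord i.
have img : (nil_end p @: lev p i.+1 <= kern p :&: lev p i)%VS.
  have [_ _ _ [h1 h2]] := tvarP p; rewrite subv_cap nil_lev //.
  by rewrite (subv_trans _ (subv_trans h1 h2)) // /imag limgS ?subvf.
have := dimvS img; rewrite -(leq_add2l (\dim (lev p i.+1 :&: kern p))) limg_ker_dim capvC.
rewrite dim_lev // !dim_cap_lev ?(ltnW ik) // !psumS !ext0E !psum_ord sum_ord_lt.
have -> : (\sum_(j : 'I_k | (j < i)%N) d j = \sum_(j : 'I_k | (j < i)%N) (d j - aN p j) + \sum_(j : 'I_k | (j < i)%N) aN p j)%N.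
  by rewrite -big_split /=; apply: eq_bigr => j _; rewrite subnK ?aN_le_d.
by have := aN_le_d p i; lia.
Qed.

Lemma exists_between (A X : {vspace dspace d F}) m : (A <= X)%VS -> (\dim A <= m <= \dim X)%N ->
  exists2 Z, (A <= Z <= X)%VS & \dim Z = m.
Proof.
move=> + /andP[Am]; move: {2}(\dim X - m)%N (erefl (\dim X - m)%N) => s.
elim: s X => [|s IH] X e AX mX.
  by exists X; [rewrite AX subvv | apply/eqP; rewrite eqn_leq mX -subn_eq0 e].
have lt : (\dim A < \dim X)%N by rewrite (leq_ltn_trans Am) // -subn_gt0 e.
have [Z /andP[AZ ZX] eZ] := hyperplane_between AX lt.
have mZ : (m <= \dim Z)%N by rewrite -ltnS -eZ -subn_gt0 e.
have eZm : (\dim Z - m)%N = s by apply/eqP; rewrite -eqSS -e eZ subSn.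
have [Y /andP[AY YZ] eY] := IH Z eZm AZ mZ.
by exists Y; rewrite // AY (subv_trans YZ).
Qed.

Lemma exists_with_dim p m : (\dim (imag p) <= m <= \dim (kern p))%N ->
  exists x, [/\ aN x = aN p, \dim (imag x) = \dim (imag p) & \dim (sub x) = m].
Proof.
have [_ _ _ [h1 h2]] := tvarP p => mle.
have [Z /andP[AZ ZX] eZ] := exists_between (subv_trans h1 h2) mle.
have [x [e1 e2 e3]] := exists_sub AZ ZX; exists x.
by rewrite /kern /imag e1 e2 e3.
Qed.

End FeasibleKernels.

(** * Embedding tensor indices into pairs of invariants *)

Section Pairs.

(* Reading u from left to right, [(s, a)] counts the unmatched vertices so far and those
   among them that carry v_{-1}; box i closes as many of the others as it can. *)
Fixpoint run (d u : nat -> nat) (i : nat) : nat * nat :=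
  if i is i'.+1 then
    let: (s, a) := run d u i' in
    let c := minn (u i') (s - a) in (s + d i' - 2 * c, a + u i' - c)%N
  else (0, 0)%N.

Definition closed_in d u i : nat := minn (u i) ((run d u i).1 - (run d u i).2).

Lemma runS d u i : run d u i.+1 =
  ((run d u i).1 + d i - 2 * closed_in d u i, (run d u i).2 + u i - closed_in d u i)%N.
Proof. by rewrite /closed_in /=; case: (run d u i). Qed.

Lemma run_le d u i : (forall j, u j <= d j)%N -> ((run d u i).2 <= (run d u i).1)%N.
Proof.
move=> ud; elim: i => // i; rewrite runS /closed_in /=; have := ud i.
by case: (run d u i) => s a /=; lia.
Qed.

(** A closed vertex removes itself and its partner from the unmatched ones, hence the factor 2. *)
Lemma run_sum d u i : (forall j, u j <= d j)%N ->
  ((run d u i).1 + 2 * \sum_(j < i) closed_in d u j = \sum_(j < i) d j)%N.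
Proof.
move=> ud; elim: i => [|i]; first by rewrite !big_ord0.
rewrite !big_ord_recr runS /=; have := run_le i ud; have := ud i.
have : (closed_in d u i <= u i)%N by rewrite geq_minl.
have : (closed_in d u i <= (run d u i).1 - (run d u i).2)%N by rewrite geq_minr.
by move: (closed_in d u i) (run d u i) (\sum_(j < i) _)%N (\sum_(j < i) _)%N => c [s a] /= x y; lia.
Qed.

(* If (s, a) becomes (s', a') at a box closing c vertices, then a = min(a', s - c). *)
Lemma run_inj d u u' m : (forall j, u j <= d j)%N -> (forall j, u' j <= d j)%N ->
  (forall j, (j < m)%N -> closed_in d u j = closed_in d u' j) ->
  (run d u m).2 = (run d u' m).2 -> forall j, (j < m)%N -> u j = u' j.
Proof.
move=> ud ud' cc; elim: m cc => // m IH cc; have cm := cc m (ltnSn m).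
have es : (run d u m).1 = (run d u' m).1.
  have := run_sum m ud; have := run_sum m ud'.
  rewrite (_ : \sum_(j < m) closed_in d u' j = \sum_(j < m) closed_in d u j)%N; first by lia.
  by apply: eq_bigr => j _; rewrite cc // ltnS ltnW.
rewrite !runS /= => ea; have := run_le m ud; have := run_le m ud' => l1 l2.
have [e1 e2] : (run d u m).2 = (run d u' m).2 /\ u m = u' m.
  by move: ea cm l1 l2; rewrite /closed_in es; case: (run d u m) (run d u' m) => [s a] [s' a'] /=; lia.
move=> j; rewrite ltnS leq_eqVlt => /orP[/eqP->//|]; apply: IH => // l lm.
by apply: cc; rewrite ltnS ltnW.
Qed.

End Pairs.

Section PairPoints.
Variables (k : nat) (d : 'I_k -> nat) (F : finFieldType).
Implicit Types (u : tidx d).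

Local Notation ux u := (ext0 (fun i => u i : nat)).
Local Notation cl u i := (closed_in (ext0 d) (ux u) i).

Lemma ux_le u j : (ux u j <= ext0 d j)%N.
Proof. by rewrite /ext0; case: insubP => //= i _ _; rewrite -ltnS. Qed.

Lemma cl_le u (i : 'I_k) : (cl u i <= d i)%N.
Proof. by rewrite (leq_trans (geq_minl _ _)) // (leq_trans (ux_le _ _)) // ext0E. Qed.

Lemma sum_cl u (i : 'I_k) : (\sum_(j < i) cl u j = \sum_(j : 'I_k | (j < i)%N) cl u j)%N.
Proof. by rewrite (big_ord_widen k (fun j => cl u j)) // ltnW. Qed.

(** Each v_{-1} cancels, if possible, an earlier free v_1. The numbers of cancellations per box are
    a feasible d - n, and the surviving v_{-1} prescribe dim W - rank t; their number fits since
    they are among the free vertices, whose number is dim ker t - rank t. *)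
Lemma pair_point u : exists p : tvar d F,
  (forall i, aN p i = d i - cl u i)%N /\
  \dim (sub p) = (\dim (imag p) + (run (ext0 d) (ux u) k).2)%N.
Proof.
have [|i|S Sm nE] := @match_exists k d (fun i => d i - cl u i)%N; first by move=> i; exact: leq_subr.
  have rs := run_sum i (ux_le u); have cs : (cl u i <= (run (ext0 d) (ux u) i).1)%N.
    by rewrite (leq_trans (geq_minr _ _)) // leq_subr.
  have dE (j : 'I_k) : (d j - (d j - cl u j) = cl u j)%N by rewrite subKn ?cl_le.
  under eq_bigr => j _ do rewrite dE.
  rewrite sum_ord_lt -sum_cl; have := psum_ord d i; rewrite /psum => es.
  rewrite es in rs; have : (\sum_(j : 'I_k | (j < i)%N) d j = \sum_(j : 'I_k | (j < i)%N) (d j - cl u j) + \sum_(j < i) cl u j)%N.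
    by rewrite sum_cl -big_split /=; apply: eq_bigr => j _; rewrite subnK ?cl_le.
  by move: rs cs; lia.
have [p [_ _ pn]] := point_exists F Sm.
have pN i : aN p i = (d i - cl u i)%N by rewrite pn nE.
have [|x [xn xr xw]] := @exists_with_dim _ _ _ p (\dim (imag p) + (run (ext0 d) (ux u) k).2)%N.
  rewrite leq_addr /=.
  have := run_sum k (ux_le u); have := run_le k (ux_le u).
  have := rank_nullity p; have := psum_ext0 d; rewrite /psum => ->.
  have : (\sum_i (aN p i + cl u i) = \sum_i d i)%N.
    by apply: eq_bigr => i _; rewrite pN subnK ?cl_le.
  by rewrite big_split /= sum_alpha; lia.
by exists x; rewrite xn xr; split.
Qed.

Lemma pair_inj u u' : (forall i : 'I_k, d i - cl u i = d i - cl u' i)%N ->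
  (run (ext0 d) (ux u) k).2 = (run (ext0 d) (ux u') k).2 -> u = u'.
Proof.
move=> ec ea; apply/ffunP => i; apply/val_inj; rewrite /= -(ext0E (fun i => u i : nat)) -(ext0E (fun i => u' i : nat)).
apply: (@run_inj (ext0 d) (ux u) (ux u') k) => //; try exact: ux_le.
move=> j jk; have := ec (Ordinal jk); have := cl_le u (Ordinal jk); have := cl_le u' (Ordinal jk).
by move=> /= l1 l2 l3; rewrite -(subKn l1) -(subKn l2) l3.
Qed.

End PairPoints.

(** * Values and supports of xi on T_c *)

Section XiOnTc.
Variables (k : nat) (d : 'I_k -> nat) (C : numFieldType) (F : finFieldType).
Local Notation K := C`(q).
Local Notation q := (qq C).
Local Notation vx := (vertex d).
Implicit Types (p x y : tvar d F) (w r n : 'I_k -> nat) (f g : tfun d C F).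
Implicit Types (phi : tens C d) (u : tidx d) (S : {set vx * vx}).

Lemma aR_le p j : (aR p j <= dsum d)%N.
Proof. by rewrite (leq_trans (aR_le_aW p j)) // (leq_trans (aW_le_aN p j)) // aN_le. Qed.

Lemma aW_le p j : (aW p j <= dsum d)%N.
Proof. by rewrite (leq_trans (aW_le_aN p j)) // aN_le. Qed.

Lemma Phi_val phi x : Phi F phi x = q ^ fexp (aW x) (aR x) (aN x) *
  gamma d C (aR x) (aN x) phi (widx (fun i => aN x i - aR x i)%N (aR x) x).
Proof.
pose hh (r n : 'I_k -> nat) : K := etainv d C F (fun i => n i - r i)%N r n (gamma d C r n phi) x.

pose h' (r : 'I_k -> nat) : K := \sum_(n : midx d) if [forall j, n j == aN x j] then hh r n else 0.
rewrite /Phi sum_ffunE; transitivity (\sum_(r : midx d) if [forall j, r j == aR x j] then h' r else 0).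
  apply: eq_bigr => r _; rewrite sum_ffunE; case: forallP => [re|nre]; last first.
    rewrite big1 // => n _; apply: etainv_out => -[e _]; apply: nre => j.
    by rewrite e.
  apply: eq_bigr => n _; case: forallP => // nne; apply: etainv_out => -[_ e]; apply: nne => j.
  by rewrite e.
rewrite sum_midx; last exact: aR_le.
by rewrite /h' sum_midx /hh ?etainv_in //; exact: aN_le.
Qed.

(** The match picked in [gamma] has the same n^S as S, hence equals S by [match_unique]. *)
Lemma Phi_match phi x S : lower_match S -> (forall i, rS S i = aR x i) -> (forall i, nS S i = aN x i) ->
  Phi F phi x = q ^ fexp (aW x) (aR x) (aN x) *
    \sum_b gammaS C S (widx (fun i => aN x i - aR x i)%N (aR x) x) b * phi b.
Proof.
move=> Sm Sr Sn; rewrite Phi_val /gamma; case: pickP => [T /andP[Tm /forallP TE]|/(_ S)]; last first.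
  by rewrite Sm /=; case: forallP => // h; case: h => i; rewrite Sr Sn !eqxx.
rewrite (_ : T = S) ?opmxE //; apply: match_unique => // i; have /andP[_ /eqP->] := TE i.
by rewrite Sn.
Qed.

Lemma Phi_support phi x : Phi F phi x != 0 -> exists S,
  [/\ lower_match S, forall i, rS S i = aR x i & forall i, nS S i = aN x i].
Proof.
rewrite Phi_val /gamma; case: pickP => [S /andP[Sm /forallP SE] _|_]; last first.
  by rewrite zero_lfunE ffunE mulr0 eqxx.
by exists S; split=> // i; have /andP[/eqP e1 /eqP e2] := SE i.
Qed.

Lemma Phi_basis u x S : lower_match S -> (forall i, rS S i = aR x i) -> (forall i, nS S i = aN x i) ->
  Phi F (basis C u) x != 0 = (gammaS C S (widx (fun i => aN x i - aR x i)%N (aR x) x) u != 0).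
Proof.
move=> Sm Sr Sn; rewrite (Phi_match _ Sm Sr Sn) -opmxE opmx_basis.
by rewrite mulf_eq0 expfz_eq0 (negPf (qq_neq0 C)) andbF.
Qed.

Lemma Phi_basis_weight u x : Phi F (basis C u) x != 0 -> \dim (sub x) = (\sum_i u i)%N.
Proof.
move=> nz; have [S [Sm Sr Sn]] := Phi_support nz; move: nz; rewrite (Phi_basis _ Sm Sr Sn).
move/(gammaS_weight Sm Sr Sn); rewrite (sum_twt_widx (fun=> erefl)) //.
have arith (A B D : nat) : D%:Z - 2 * A%:Z = D%:Z - 2 * B%:Z -> A = B by lia.
rewrite /twt sumrB -mulr_sumr -!Posz_sum /dsum; exact: arith.
Qed.

Lemma xi_support f p : xi_fun f p != 0 -> exists x,
  [/\ f x != 0, \dim (sub x) = \dim (sub p), \dim (imag x) = \dim (imag p) & aN x = aN p].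
Proof.
rewrite ffunE /qsum => nz.
have [w [r [n]]] : exists w r n : midx d, val_on f w r n * chi C (@B_rel k d) p w r n != 0.
  apply: contrapT => h; case/eqP: nz; do 3!(rewrite big1 // => ? _).
  by apply/eqP/negPn/negP => nz; apply: h; do 3!eexists; exact: nz.
rewrite chi_B /Bpoly; case: ifP => [/and3P[/eqP ew /eqP er /forallP en]|_]; last by rewrite evq0 mulr0 eqxx.
rewrite /val_on; case: pickP => [x /inA_fun[xw xr xn]|]; last by rewrite mul0r eqxx.
rewrite mulf_eq0 negb_or => /andP[fx _]; exists x; split=> //.
- by rewrite -(sum_alpha (sub x) x) xw -ew sum_alpha.
- by rewrite -(sum_alpha (imag x) x) xr -er sum_alpha.
by rewrite xn; apply/funext => i; apply/esym/eqP.
Qed.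

(** By hypothesis only the stratum of x contributes to the sum, so there is no cancellation. Its
    counting polynomial is that of B_x, which is nonzero because x lies in B_x, and it stays nonzero
    at q^2. *)
Lemma xi_neq0 f p x : f \in tspace d C F -> f x != 0 -> \dim (sub x) = \dim (sub p) ->
  \dim (imag x) = \dim (imag p) -> aN x = aN p ->
  (forall y, f y != 0 -> \dim (sub y) = \dim (sub p) -> \dim (imag y) = \dim (imag p) -> aN y = aN p ->
    aW y = aW x /\ aR y = aR x) -> xi_fun f p != 0.
Proof.
move=> ft fx es ei en uniq; rewrite ffunE /qsum.
pose hh (w r n : 'I_k -> nat) : K := val_on f w r n * chi C (@B_rel k d) p w r n.
have hh0 w r n : hh w r n != 0 -> [/\ w = aW x, r = aR x & n = aN x].
  rewrite /hh chi_B /Bpoly; case: ifP => [/and3P[/eqP ew /eqP er /forallP nE]|_]; last by rewrite evq0 mulr0 eqxx.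
  rewrite /val_on; case: pickP => [y /inA_fun[yw yr yn]|]; last by rewrite mul0r eqxx.
  rewrite mulf_eq0 negb_or => /andP[fy _].
  have eyn : aN y = aN p by rewrite yn; apply/funext => i; apply/esym/eqP.
  have [||e1 e2] := uniq y fy _ _ eyn.
  - by rewrite -(sum_alpha (sub y) y) yw -ew sum_alpha.
  - by rewrite -(sum_alpha (imag y) y) yr -er sum_alpha.
  by rewrite -yw -yr -yn e1 e2 eyn en.
have -> : \sum_(w : midx d) \sum_(r : midx d) \sum_(n : midx d) hh w r n = hh (aW x) (aR x) (aN x).
  rewrite -(sum_midx (fun w => hh w (aR x) (aN x)) (aW_le x)); apply: eq_bigr => w _.
  case: forallP => [we|nwe]; last first.
    do 2!(rewrite big1 // => ? _); apply/eqP/negPn/negP => /hh0[e _ _]; apply: nwe => j.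
    by rewrite e.
  rewrite -(sum_midx (fun r => hh (mval w) r (aN x)) (aR_le x)); apply: eq_bigr => r _.
  case: forallP => [re|nre]; last first.
    rewrite big1 // => ? _; apply/eqP/negPn/negP => /hh0[_ e _]; apply: nre => j.
    by rewrite e.
  rewrite -(sum_midx (fun n => hh (mval w) (mval r) n) (aN_le x)); apply: eq_bigr => n _.
  case: forallP => // nne; apply/eqP/negPn/negP => /hh0[_ _ e]; apply: nne => j.
  by rewrite e.
rewrite /hh mulf_eq0 negb_or (val_on_inA (inA_self x)); last exact/tspaceP.
apply/andP; split; first exact: fx.
rewrite chi_B evq_eq0.
have -> : Bpoly d (aW p) (aR p) (aN p) (aW x) (aR x) (aN x) =
    Bpoly d (aW x) (aR x) (aN x) (aW x) (aR x) (aN x).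
  by rewrite /Bpoly !sum_alpha es ei en.
apply/eqP => B0; have := card_B x (aW x) (aR x) (aN x); rewrite B0 horner0.
move/eqP; rewrite cards_eq0 => /eqP/setP/(_ x); rewrite !inE inA_self andbT.
by rewrite /B_rel !eqxx /=; case: forallP => // h; case: h.
Qed.

End XiOnTc.

(** * Surjectivity by triangularity, injectivity by dimension *)

Section Isomorphism.
Variables (k : nat) (d : 'I_k -> nat) (C : numFieldType) (F : finFieldType).
Local Notation K := C`(q).
Local Notation q := (qq C).
Local Notation vx := (vertex d).
Implicit Types (p x y : tvar d F) (w r n : 'I_k -> nat) (f g : tfun d C F).
Implicit Types (phi : tens C d) (u : tidx d) (S : {set vx * vx}).

Definition same_kw p x : bool := [forall i, aN p i == aN x i] && (\dim (sub p) == \dim (sub x)).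

Lemma same_kwP p x : reflect (aN p = aN x /\ \dim (sub p) = \dim (sub x)) (same_kw p x).
Proof.
apply: (iffP andP) => [[/forallP h /eqP e]|[h e]].
  by split=> //; apply/funext => i; apply/eqP.
by split; [apply/forallP => i; rewrite h | rewrite e].
Qed.

Definition ind x : tfun d C F := [ffun p => (same_kw p x)%:R].

Lemma ind_ts x : ts_pred (ind x).
Proof.
apply/ts_predP => y y' es /funext en; rewrite !ffunE; congr (_%:R); congr nat_of_bool.
by apply/same_kwP/same_kwP => -[e1 e2]; split; rewrite -?e1 -?e2 ?en ?es.
Qed.

Lemma ts_tspace f : ts_pred f -> f \in tspace d C F.
Proof. by case/andP. Qed.

Definition xi_tc : {vspace tfun d C F} := (xi d C F @: tc_space d C F)%VS.

Lemma xi_tcP f : reflect (exists phi, f = xi_fun (Phi F phi)) (f \in xi_tc).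
Proof.
apply: (iffP memv_imgP) => [[_ /tc_spaceP[phi ->] ->]|[phi ->]].
  by exists phi; rewrite /xi lfunE.
by exists (Phi F phi); [apply/tc_spaceP; exists phi | rewrite /xi lfunE].
Qed.

Lemma xi_tc_ts f : f \in xi_tc -> ts_pred f.
Proof. by case/xi_tcP=> phi ->; exact: xi_ts. Qed.

Lemma xi_tc_actF f : f \in xi_tc -> actF_fun f \in xi_tc.
Proof.
case/xi_tcP=> phi ->; rewrite -xi_actF -Phi_actF; apply/xi_tcP.
by exists (opmx (@tF C k d) phi).
Qed.

Lemma ts_decomp f (N : {vspace tfun d C F}) : ts_pred f ->
  (* The proof fixes a representative [rep] of every class of [same_kw]; f is the combination of the
     indicators of the representatives with its values there as coefficients. *)
  (forall x, f x != 0 -> ind x \in N) -> f \in N.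
Proof.
move=> /ts_predP ft fN; pose rep x := odflt x [pick y | same_kw y x].
have repP x : same_kw (rep x) x.
  by rewrite /rep; case: pickP => //= h; apply/same_kwP.
have rep_eq x y : same_kw x y -> rep x = rep y.
  move=> /same_kwP[e1 e2]; have eqk z : same_kw z x = same_kw z y by rewrite /same_kw e1 e2.
  rewrite /rep (eq_pick eqk); case: pickP => //= /(_ y).
  by case: same_kwP => // h; case: h.
suff -> : f = \sum_(x | rep x == x) f x *: ind x.
  apply: memv_suml => x _; case: (eqVneq (f x) 0) => [->|fx]; first by rewrite scale0r mem0v.
  exact/memvZ/fN.
apply/ffunP => p; rewrite sum_ffunE (bigD1 (rep p)) /=; last by apply/eqP/rep_eq/repP.
rewrite big1 ?addr0 => [|x /andP[/eqP ex ne]].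
  have /same_kwP[e1 e2] := repP p; rewrite !ffunE /same_kw e1 e2 eqxx.
  rewrite (_ : [forall i, _]) ?mulr1; last by apply/forallP.
  rewrite -[RHS]/(f (rep p) * 1) mulr1; apply: ft => // i; by rewrite e1.
rewrite !ffunE; case: (boolP (same_kw p x)) => [/rep_eq e|_]; last by rewrite -[LHS]/(_ * 0) mulr0.
by case/eqP: ne; rewrite e ex.
Qed.

Lemma dim_imag_kern x y : aN y = aN x -> \dim (imag y) = \dim (imag x).
Proof.
move=> e; have := rank_nullity x; have := rank_nullity y.
by rewrite -(sum_alpha (kern y) y) e sum_alpha => <- /addIn.
Qed.

Lemma actF_ind x y : aN y = aN x -> \dim (sub y) = (\dim (sub x)).+1 ->
  actF_fun (ind x) = qz C ((\dim (sub y))%:Z - (\dim (imag y))%:Z) *: ind y.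
Proof.
move=> en es; apply/ffunP => p; rewrite [RHS]ffunE.
have [e1|ne] := eqVneq (aN p) (aN y); last first.
  rewrite (@ts_actF _ _ _ _ _ 0) ?ts_tspace ?ind_ts // => [|z zs zn]; rewrite ffunE.
    by case: same_kwP => [[e _]|_]; [case/eqP: ne | rewrite -[RHS]/(_ * 0) !mulr0].
  by case: same_kwP => [[e _]|_] //; case/eqP: ne; rewrite -zn e en.
(* For W = 0 the predecessor in [ts_actF] truncates to 0 and points to dimension 0 again, but the
   coefficient is then [0]. *)
have [s0|spos] := posnP (\dim (sub p)).
  rewrite (@ts_actF _ _ _ _ _ (\dim (sub x) == 0)%:R) ?ts_tspace ?ind_ts // => [|z zs zn]; last first.
    rewrite ffunE /same_kw zs s0 zn e1 en eq_sym; congr (_%:R); rewrite andb_idl // => _.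
    exact/forallP.
  have [_ _ _ [h1 _]] := tvarP p; have := dimvS h1; rewrite s0 leqn0 => /eqP->.
  rewrite ffunE subrr qz0 mul0r; case: same_kwP => [[_ e]|_]; last by rewrite -[RHS]/(_ * 0) mulr0.
  by move: es; rewrite -e s0.
rewrite (@ts_actF _ _ _ _ _ (same_kw p y)%:R) ?ts_tspace ?ind_ts // => [|z zs zn].
  rewrite ffunE -(dim_imag_kern e1); case: same_kwP => [[_ ->]|_] //.
  by rewrite mulr0 -[RHS]/(_ * 0) mulr0.
rewrite ffunE /same_kw zs zn e1 en es; congr (_%:R); congr (nat_of_bool (_ && _)).
by apply/eqP/eqP; lia.
Qed.

(** Repeated use of [actF_ind]: the quantum integer is nonzero because the dimension of W exceeds
    the rank of t after each step. *)
Lemma ind_up x y : aN y = aN x -> (\dim (sub x) <= \dim (sub y))%N -> ind x \in xi_tc -> ind y \in xi_tc.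
Proof.
move: {2}(\dim (sub y) - \dim (sub x))%N (erefl (\dim (sub y) - \dim (sub x))%N) => s.
elim: s x => [|s IH] x e en le xN.
  suff -> : ind y = ind x by [].
  have es : \dim (sub y) = \dim (sub x) by apply/eqP; rewrite eqn_leq le -subn_eq0 e.
  by apply/ffunP => z; rewrite !ffunE /same_kw en es.
have [h1 h2] : (\dim (imag x) <= \dim (sub x))%N /\ (\dim (sub y) <= \dim (kern x))%N.
  have [_ _ _ [ix _]] := tvarP x; have [_ _ _ [_ yk]] := tvarP y; split; first exact: dimvS.
  by rewrite -(sum_alpha (kern x) x) -en sum_alpha dimvS.
have lt : (\dim (sub x) < \dim (sub y))%N by rewrite -subn_gt0 e.
have [|z [zn zi zs]] := @exists_with_dim _ _ _ x (\dim (sub x)).+1.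
  by rewrite (leq_trans h1) //= (leq_trans lt).
apply: (IH z); rewrite ?zs ?zn //; first by rewrite subnS e.
have := xi_tc_actF xN; rewrite (actF_ind zn zs) zs zi rpredZeq qz_eq0.
by rewrite subr_eq0 eqz_nat gtn_eqF // ltnS.
Qed.

Lemma closers_atE S i : lower_match S -> closers_at S i = (d i - nS S i)%N.
Proof. by move=> Sm; rewrite /nS subKn // rights_box_le. Qed.

Definition closer_stat p : nat := stat (fun i => d i - aN p i)%N.

Lemma closer_stat_le p : (closer_stat p <= k * dsum d)%N.
Proof.
rewrite /closer_stat /stat /dsum big_distrr /=; apply: leq_sum => i _.
by rewrite leq_mul ?leq_subr // ltnW.
Qed.

(* Orders the kernel types by increasing rank of t, then by decreasing [closer_stat]. *)
Definition height p : nat := (\dim (imag p) * (k * dsum d).+1 + (k * dsum d - closer_stat p))%N.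

Lemma height_rank p p' : (\dim (imag p') < \dim (imag p))%N -> (height p' < height p)%N.
Proof.
rewrite /height => lt; have le : (\dim (imag p') * (k * dsum d).+1 + (k * dsum d).+1 <= \dim (imag p) * (k * dsum d).+1)%N.
  by rewrite addnC -mulSn leq_mul2r lt orbT.
apply: leq_trans (leq_trans le (leq_addr _ _)); rewrite -addnS leq_add2l ltnS.
exact: leq_subr.
Qed.

Lemma height_stat p p' : \dim (imag p') = \dim (imag p) -> (closer_stat p < closer_stat p')%N ->
  (height p' < height p)%N.
Proof.
rewrite /height => -> lt; rewrite ltn_add2l; apply: ltn_sub2l => //.
by rewrite (leq_trans lt) // closer_stat_le.
Qed.

Lemma imag_sub x : \dim (sub x) = \dim (imag x) -> aW x = aR x.
Proof.
move=> e; have [_ _ _ [h1 _]] := tvarP x; suff -> : sub x = imag x by [].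
by apply/eqP; rewrite eq_sym eqEdim h1 e leqnn.
Qed.

Lemma widx_imag x : \dim (sub x) = \dim (imag x) ->
  forall i, widx (fun i => aN x i - aR x i)%N (aR x) x i = ord0.
Proof.
by move=> /imag_sub e i; apply/val_inj; rewrite /= ffunE e subnn inordK.
Qed.

(** Strong induction on [height]: an element of the image of xi is nonzero at p, and all other
    classes in its support come from smaller heights by [ind_up]. *)
Lemma ind_base p : \dim (sub p) = \dim (imag p) -> ind p \in xi_tc.
Proof.
move: {2}(height p).+1 (ltnSn (height p)) => m; elim: m p => // m IH p pm pi.
have [S Sm Sn] := match_exists (aN_le_d p) (kernel_feasible p).
have cS i : closers_at S i = (d i - aN p i)%N by rewrite closers_atE // Sn.
(* By [gammaS_neq0] this index reaches the highest weight vector through S; its entries sum to the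
   rank of t, matching dim W at p. *)
pose u : tidx d := finfun (fun i => inord (closers_at S i)).
have uE i : u i = closers_at S i :> nat.
  by rewrite ffunE inordK // ltnS cS leq_subr.
have su : (\sum_i u i)%N = \dim (imag p).
  apply/eqP; rewrite -(eqn_add2r (\dim (kern p))) rank_nullity -(sum_alpha (kern p) p) -big_split /=.
  by apply/eqP/eq_bigr => i _; rewrite uE cS subnK ?aN_le_d.
pose h := xi_fun (Phi F (basis C u)).
have hN : h \in xi_tc by apply/xi_tcP; exists (basis C u).
have hts := xi_tc_ts hN.
have hp : h p != 0.
  have [x [xw xr xn]] := point_exists F Sm.
  have {}xw : aW x = aR x by apply/funext => i; rewrite xw xr.
  have {}xn : aN x = aN p by apply/funext => i; rewrite xn Sn.
  have xi := dim_imag_kern xn.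
  have xs : \dim (sub x) = \dim (imag x) by rewrite -(sum_alpha (sub x) x) xw sum_alpha.
  have Sr i : rS S i = aR x i by rewrite xr.
  have Sn' i : nS S i = aN x i by rewrite xn Sn.
  apply: (xi_neq0 (x := x)) => //; first exact: Phi_tspace.
  - rewrite (Phi_basis _ _ Sm Sr Sn'); apply: gammaS_neq0 => //; exact: widx_imag.
  - by rewrite xs xi pi.
  (* W = im t gives w = r at y, and the kernel type determines the match, hence r; so y lies in the
     stratum of x. *)
  move=> y fy ys yi yn; have yw : aW y = aR y by apply: imag_sub; rewrite ys yi pi.
  have [T [Tm Tr Tn]] := Phi_support fy.
  have ST : T = S by apply: match_unique => // i; rewrite Tn yn Sn.
  have yr : aR y = aR x by apply/funext => i; rewrite -Tr -Sr ST.
  by rewrite yw yr xw.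
suff hN' : h - h p *: ind p \in xi_tc.
  by have := memvB hN hN'; rewrite opprB addrCA subrr addr0 rpredZeq (negPf hp).
have subE (c : K) f g z : (f - c *: g) z = f z - c * g z by rewrite !ffunE.
apply: ts_decomp => [|x].
  apply/ts_predP => y y' es en; have /ts_predP ht := hts; have /ts_predP it := ind_ts p.
  by rewrite !subE (ht y y' es en) (it y y' es en).
rewrite subE [ind p x]ffunE; case: (boolP (same_kw x p)) => [/same_kwP[en es]|ne].
  by have /ts_predP ht := hts; rewrite (ht x p es) ?en // mulr1 subrr eqxx.
rewrite mulr0 subr0 => hx.
have [y [fy ys yi yn]] := xi_support hx.
have xs : \dim (sub x) = \dim (imag p) by rewrite -ys (Phi_basis_weight fy).
(* The weight fixes dim W to the rank at p, and im t is contained in W. A smaller rank lowers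
   [height] at once; for equal rank, W = im t holds at y and [gammaS_stat] compares the
   statistics. *)
have le : (\dim (imag x) <= \dim (imag p))%N.
  by have [_ _ _ [h1 _]] := tvarP x; rewrite -xs dimvS.
have [_ _ _ [h1 h2]] := tvarP x.
have [|z [zn zi zs]] := @exists_with_dim _ _ _ x (\dim (imag x)).
  by rewrite leqnn dimvS // (subv_trans h1 h2).
apply: (@ind_up z x) => //; first by rewrite zs dimvS.
apply: IH; last by rewrite zs zi.
rewrite ltnS in pm; apply: leq_trans pm.
have hz : height z = height x by rewrite /height /closer_stat zi zn.
rewrite hz; move: le; rewrite leq_eqVlt => /orP[/eqP eix|]; last exact: height_rank.
apply: height_stat => //.
have [T [Tm Tr Tn]] := Phi_support fy; move: fy; rewrite (Phi_basis _ _ Tm Tr Tn).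
have ysi : \dim (sub y) = \dim (imag y) by rewrite ys xs yi eix.
move/(gammaS_stat Tm Tr Tn (widx_imag ysi)) => [].
have cT i : closers_at T i = (d i - aN x i)%N by rewrite closers_atE // Tn yn.
have -> : stat (fun i => u i) = closer_stat p by apply: eq_bigr => i _; rewrite uE cS.
have -> : stat (closers_at T) = closer_stat x by apply: eq_bigr => i _; rewrite cT.
(* Equal statistics would give x the kernel type of p, and thus its class, which is excluded. *)
rewrite leq_eqVlt => /orP[/eqP e|//] /(_ e) uT; case/negP: ne; apply/same_kwP; split; last by rewrite xs pi.
apply/funext => i; rewrite -(subKn (aN_le_d x i)) -(subKn (aN_le_d p i)) -cT -cS.
by rewrite -uT uE.
Qed.

Lemma ind_xi_tc p : ind p \in xi_tc.
Proof.
have [_ _ _ [h1 h2]] := tvarP p.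
have [|z [zn zi zs]] := @exists_with_dim _ _ _ p (\dim (imag p)).
  by rewrite leqnn dimvS // (subv_trans h1 h2).
by apply: (@ind_up z p) => //; [rewrite zs dimvS | apply: ind_base; rewrite zs zi].
Qed.

Lemma ts_xi_tc f : ts_pred f -> f \in xi_tc.
Proof. by move=> ft; apply: ts_decomp => // x _; exact: ind_xi_tc. Qed.

(** Evaluating at the points [pt u] makes an endomorphism of the tensor product out of xi composed
    with [Phi]. It is onto, hence injective by finite dimension. *)
Lemma xi_Phi_inj phi phi' : xi_fun (Phi F phi) = xi_fun (Phi F phi') -> phi = phi'.
Proof.
have [pt ptP] := choice (@pair_point k d F).
pose A : 'Hom(tens C d, tfun d C F) := (xi d C F \o epsilon d C F \o etainv d C F d (fun=> 0%N) d)%VF.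
have AE psi : A psi = xi_fun (Phi F psi).
  by rewrite /A !comp_lfunE epsilon_etainv /xi lfunE.
pose E : 'Hom(tfun d C F, tens C d) := opmx (fun u x => (x == pt u)%:R : K).
have EE f u : E f u = f (pt u).
  rewrite /E opmxE (bigD1 (pt u)) //= eqxx mul1r big1 ?addr0 // => x ne.
  by rewrite (negPf ne) mul0r.
have Efull : limg (E \o A)%VF = fullv.
  apply/eqP; rewrite eqEsubv subvf /=; apply/subvP => psi _.
  rewrite (fvec_basis psi); apply: memv_suml => u _; apply: memvZ.
  (* By [pair_inj] the points [pt u] lie in distinct classes, so the indicator of [pt u], which is
     in the image of xi, evaluates to the basis vector u. *)
  have /xi_tcP[chi e] := ind_xi_tc (pt u).
  apply/memv_imgP; exists chi; rewrite ?memvf //; apply/ffunP => v.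
  rewrite comp_lfunE AE -e EE !ffunE; congr (_%:R); congr nat_of_bool.
  apply/eqP/same_kwP => [->//|[en es]]; have [n1 s1] := ptP v; have [n2 s2] := ptP u.
  apply: pair_inj; first by move=> i; rewrite -n1 -n2 en.
  by move: es; rewrite s1 s2 (dim_imag_kern en) => /addnI.
have kE : lker (E \o A)%VF == 0%VS.
  have := limg_ker_dim (E \o A)%VF fullv; rewrite capfv Efull -[X in _ = X]add0n.
  by move/addIn/eqP; rewrite dimv_eq0.
move=> e; apply: (lker0P kE); by rewrite ![(E \o A)%VF _]comp_lfunE !AE e.
Qed.

Theorem xi_iso : uq_iso (act_ops d C F) (act_ops d C F)
  (fun f => f \in tc_space d C F) (@ts_pred k d C F) (xi d C F).
Proof.
have xiE f : xi d C F f = xi_fun f by rewrite /xi lfunE.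
split; [exact: tc_module | exact: ts_module | | |].
- move=> f _; rewrite !uE_act !uF_act !uK_act !uKi_act !xiE; split; first exact: xi_ts.
  by rewrite xi_actE xi_actF xi_actK xi_actKi.
- by move=> f g /tc_spaceP[phi ->] /tc_spaceP[psi ->]; rewrite !xiE => /xi_Phi_inj->.
move=> f /ts_xi_tc/xi_tcP[phi ->]; exists (Phi F phi); last by rewrite xiE.
by apply/tc_spaceP; exists phi.
Qed.

End Isomorphism.

(* The complex numbers are R[i], for R the (unique up to isomorphism) realType. *)
Theorem proposition3p7p1 (R : realType) (F : finFieldType) (k : nat)
    (d : 'I_k -> nat) (hk : (0 < k)%N) :
  uq_iso (act_ops d R[i] F) (act_ops d R[i] F)
    (fun f => f \in tc_space d R[i] F) (@ts_pred k d R[i] F) (xi d R[i] F).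
Proof. exact: xi_iso. Qed.
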